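(* Let $p_X,p_{\hat X}$ be distributions on $\mathcal X$ and $\Delta$ a distortion measure, and let $R,R_c\ge 0$. (i) If $(p_X,p_{\hat X},\Delta)$ is uniformly integrable, then $$D(R,R_c|p_X,p_{\hat X})=\inf_{p_{XU\hat X}\in\Omega(p_X,p_{\hat X})}\mathbb E[\Delta(X,\hat X)]\quad\text{subject to}\quad I(X;U)\le R,\ \ I(\hat X;U)\le R+R_c .$$ (ii) If $\mathcal X=\mathbb R$, $\mathbb E[X^2]<\infty$, $\mathbb E[\hat X^2]<\infty$ (where $X\sim p_X$, $\hat X\sim p_{\hat X}$) and $\Delta(x,\hat x)=(x-\hat x)^2$, then $$D(R,R_c|p_X,p_{\hat X})=\inf_{p_{Y|X},\,p_{\hat Y|\hat X}}\Big(\mathbb E[(X-Y)^2]+\mathbb E[(\hat X-\hat Y)^2]+W_2^2(p_Y,p_{\hat Y})\Big)$$ where the infimum is over real-valued $Y$ jointly distributed with $X$ and real-valued $\hat Y$ jointly distributed with $\hat X$ subject to $\mathbb E[X|Y]=Y$ a.s., $\mathbb E[\hat X|\hat Y]=\hat Y$ a.s., $I(X;Y)\le R$, and $I(Y;\hat Y)\le R+R_c$ (here $p_Y$, $p_{\hat Y}$ denote the marginal laws of $Y$ and $\hat Y$).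
   Context: All logarithms are natural. Let $\mathcal X$ be an alphabet (a measurable space; $\mathcal X=\mathbb R$ in the squared-error case), $p_X$ a source distribution on $\mathcal X$, and $\Delta:\mathcal X\times\mathcal X\to[0,\infty)$ a measurable distortion measure. For a block length $n\ge1$, a code consists of finite sets $\mathcal J,\mathcal K$, a random seed $K$ uniform on $\mathcal K$ and independent of the source sequence $X^n=(X_1,\dots,X_n)$ (i.i.d. with marginal $p_X$), a stochastic encoder given by a conditional distribution $p_{J|X^nK}$ producing $J\in\mathcal J$, and a stochastic decoder given by a conditional distribution $p_{\hat X^n|JK}$ producing $\hat X^n=(\hat X_1,\dots,\hat X_n)\in\mathcal X^n$; the joint law is $p_{X^n}p_Kp_{J|X^nK}p_{\hat X^n|JK}$. For $R,R_c\ge0$ and a distribution $p_{\hat X}$ on $\mathcal X$, a distortion level $D$ is achievable with respect to $p_{\hat X}$ subject to rate constraints $(R,R_c)$ if for some $n$ there is such a code with $\frac1n\log|\mathcal J|\le R$, $\frac1n\log|\mathcal K|\le R_c$, $\frac1n\sum_{t=1}^n\mathbb E[\Delta(X_t,\hat X_t)]\le D$, and $\hat X_1,\dots,\hat X_n$ i.i.d. with marginal $p_{\hat X}$. $D(R,R_c|p_X,p_{\hat X})$ denotes the infimum of such achievable $D$. $(p_X,p_{\hat X},\Delta)$ is uniformly integrable if for every $\epsilon>0$ there is $\delta>0$ such that $\mathbb E[\Delta(X,\hat X)1_{\mathcal E}(X,\hat X)]\le\epsilon$ for every coupling $p_{X\hat X}$ of $p_X$ and $p_{\hat X}$ and every measurable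 event $\mathcal E$ with $\mathbb P\{(X,\hat X)\in\mathcal E\}\le\delta$. $\Omega(p_X,p_{\hat X})$ is the set of joint distributions $p_{XU\hat X}$ (with $U$ taking values in an arbitrary alphabet) whose $X$- and $\hat X$-marginals are $p_X$ and $p_{\hat X}$ and such that $X\leftrightarrow U\leftrightarrow\hat X$ is a Markov chain. $W_2^2(p,q):=\inf_{\pi\in\Pi(p,q)}\mathbb E_\pi[(A-B)^2]$, the squared quadratic Wasserstein distance, where $\Pi(p,q)$ is the set of couplings of $p$ and $q$ on $\mathbb R^2$.
   Formalization: In (ii) the constraint I(Y;Ŷ) ≤ R+R_c is undefined, since Y and Ŷ are not jointly distributed; it is replaced by I(X̂;Ŷ) ≤ R+R_c, the analogue of I(X̂;U) ≤ R+R_c in (i). *)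

(* Defs.v *)
From HB Require Import structures.
From mathcomp Require Import all_boot all_order all_algebra.
From mathcomp Require Import all_classical all_reals all_analysis.
Set Implicit Arguments. Unset Strict Implicit. Unset Printing Implicit Defensive.
Import Order.TTheory GRing.Theory Num.Theory.
Local Open Scope classical_set_scope.
Local Open Scope ring_scope.

Section Defs.
Context {R : realType}.

Definition fin_mpartition d (T : measurableType d) (m : nat) (A : 'I_m -> set T) :=
  (forall i, measurable (A i)) /\ trivIset setT A /\ \bigcup_i A i = setT.

(* mutual information I(f;g) of two random variables f, g on (Om, P), in nats,
   with the general (Dobrushin / Gelfand-Yaglom-Perez) definition:
   supremum over finite measurable partitions of the discrete mutual information *)
Definition mi_term (pab pa pb : R) : R :=
  if 0 < pab then pab * ln (pab / (pa * pb)) else 0.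

Definition mutual_info d (Om : measurableType d) (P : probability Om R)
    d1 (T1 : measurableType d1) d2 (T2 : measurableType d2)
    (f : Om -> T1) (g : Om -> T2) : \bar R :=
  ereal_sup [set e | exists (m k : nat) (A : 'I_m -> set T1) (B : 'I_k -> set T2),
     fin_mpartition A /\ fin_mpartition B /\
     e = ((\sum_(i < m) \sum_(j < k)
       mi_term (fine (P (f @^-1` A i `&` g @^-1` B j)))
               (fine (P (f @^-1` A i))) (fine (P (g @^-1` B j))))%:E)%E].

(* f and h are conditionally independent given g (Markov chain f <-> g <-> h):
   for all events, P(f in A, h in B | g) = P(f in A | g) P(h in B | g) a.s.,
   where a o g and b o g are versions of the conditional probabilities *)
Definition cond_indep d (Om : measurableType d) (P : probability Om R)
    d1 (T1 : measurableType d1) d2 (T2 : measurableType d2)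
    d3 (T3 : measurableType d3)
    (f : Om -> T1) (g : Om -> T2) (h : Om -> T3) : Prop :=
  forall A B, measurable A -> measurable B ->
  exists a b : T2 -> R,
    measurable_fun setT a /\ measurable_fun setT b /\
    (forall u, 0 <= a u <= 1) /\ (forall u, 0 <= b u <= 1) /\
    forall C, measurable C ->
      P (f @^-1` A `&` g @^-1` C) = (\int[P]_(w in g @^-1` C) (a (g w))%:E)%E /\
      P (h @^-1` B `&` g @^-1` C) = (\int[P]_(w in g @^-1` C) (b (g w))%:E)%E /\
      P (f @^-1` A `&` h @^-1` B `&` g @^-1` C) =
        (\int[P]_(w in g @^-1` C) (a (g w) * b (g w))%:E)%E.

(* a (stochastic, common-randomness-assisted) code of block length n achieving
   distortion D with i.i.d. output distribution pXh, realized on a probability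
   space (Om, P): X_t source letters, K the seed, J the message, Xh_t outputs.
   The joint law is p_{X^n} p_K p_{J|X^n K} p_{Xh^n|J K}, i.e.
   (X^n i.i.d. pX) independent of (K uniform), and Xh^n independent of X^n
   given (J,K); both conditions are stated on measurable rectangles. *)
Definition achievable d (T : measurableType d) (pX pXh : probability T R)
    (Delta : T -> T -> R) (Rt Rc D : R) : Prop :=
  exists (n jn kn : nat), (0 < n)%N /\ (0 < jn)%N /\ (0 < kn)%N /\
  ln jn%:R <= n%:R * Rt /\ ln kn%:R <= n%:R * Rc /\
  exists (dO : measure_display) (Om : measurableType dO) (P : probability Om R)
    (X : 'I_n -> Om -> T) (K : Om -> 'I_kn) (J : Om -> 'I_jn)
    (Xh : 'I_n -> Om -> T),
  (forall t, measurable_fun setT (X t)) /\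
  (forall t, measurable_fun setT (Xh t)) /\
  (forall k, measurable (K @^-1` [set k])) /\
  (forall j, measurable (J @^-1` [set j])) /\
  (forall (A : 'I_n -> set T), (forall t, measurable (A t)) -> forall k,
     P (\bigcap_t (X t @^-1` A t) `&` K @^-1` [set k]) =
       ((\prod_(t < n) fine (pX (A t))) / kn%:R)%:E) /\
  (* decoder output depends on (X^n, K) only through (J, K) *)
  (forall (A B : 'I_n -> set T), (forall t, measurable (A t)) ->
     (forall t, measurable (B t)) -> forall j k,
     let C := J @^-1` [set j] `&` K @^-1` [set k] in
     let EA := \bigcap_t (X t @^-1` A t) in
     let FB := \bigcap_t (Xh t @^-1` B t) in
     (P (EA `&` FB `&` C) * P C = P (EA `&` C) * P (FB `&` C))%E) /\
  (forall (B : 'I_n -> set T), (forall t, measurable (B t)) ->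
     P (\bigcap_t (Xh t @^-1` B t)) = (\prod_(t < n) fine (pXh (B t)))%:E) /\
  ((n%:R^-1)%:E * \sum_(t < n) \int[P]_w (Delta (X t w) (Xh t w))%:E
     <= D%:E)%E.

Definition Dopt d (T : measurableType d) (pX pXh : probability T R)
    (Delta : T -> T -> R) (Rt Rc : R) : \bar R :=
  ereal_inf [set D%:E | D in [set D | achievable pX pXh Delta Rt Rc D]].

Definition unif_integrable d (T : measurableType d) (pX pXh : probability T R)
    (Delta : T -> T -> R) : Prop :=
  forall eps : R, 0 < eps -> exists delta : R, 0 < delta /\
  forall pi : probability (T * T)%type R,
    (forall A, measurable A -> pi (A `*` setT) = pX A) ->
    (forall B, measurable B -> pi (setT `*` B) = pXh B) ->
    forall E, measurable E -> (pi E <= delta%:E)%E ->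
    (\int[pi]_(z in E) (Delta z.1 z.2)%:E <= eps%:E)%E.

Definition rhs_i d (T : measurableType d) (pX pXh : probability T R)
    (Delta : T -> T -> R) (Rt Rc : R) : \bar R :=
  ereal_inf [set e | exists (dU : measure_display) (U : measurableType dU)
     (p : probability ((T * U) * T)%type R),
     (forall A, measurable A -> p ((A `*` setT) `*` setT) = pX A) /\
     (forall B, measurable B -> p ((setT `*` setT) `*` B) = pXh B) /\
     cond_indep p (fun z => z.1.1) (fun z => z.1.2) (fun z => z.2) /\
     (mutual_info p (fun z => z.1.1) (fun z => z.1.2) <= Rt%:E)%E /\
     (mutual_info p (fun z => z.2) (fun z => z.1.2) <= (Rt + Rc)%:E)%E /\
     (e = \int[p]_z (Delta z.1.1 z.2)%:E)%E].

Definition W2sq (mu nu : set R -> \bar R) : \bar R :=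
  ereal_inf [set (\int[pi]_z ((z.1 - z.2) ^+ 2)%:E)%E
    | pi in [set pi : probability (R * R)%type R |
       (forall A, measurable A -> pi (A `*` setT) = mu A) /\
       (forall B, measurable B -> pi (setT `*` B) = nu B)]].

(* E[X | Y] = Y a.s. for a joint law p of (X, Y) on R * R *)
Definition cexp_id (p : probability (R * R)%type R) : Prop :=
  p.-integrable setT (fun z => z.2%:E) /\
  forall B, measurable B ->
    (\int[p]_(z in setT `*` B) z.1%:E = \int[p]_(z in setT `*` B) z.2%:E)%E.

Definition rhs_ii (pX pXh : probability R R) (Rt Rc : R) : \bar R :=
  ereal_inf [set e | exists (pXY pXYh : probability (R * R)%type R),
     (forall A, measurable A -> pXY (A `*` setT) = pX A) /\
     (forall A, measurable A -> pXYh (A `*` setT) = pXh A) /\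
     cexp_id pXY /\ cexp_id pXYh /\
     (mutual_info pXY fst snd <= Rt%:E)%E /\
     (mutual_info pXYh fst snd <= (Rt + Rc)%:E)%E /\
     (e = \int[pXY]_z ((z.1 - z.2) ^+ 2)%:E + \int[pXYh]_z ((z.1 - z.2) ^+ 2)%:E
          + W2sq (fun B => pXY (setT `*` B)) (fun B => pXYh (setT `*` B)))%E].

End Defs.

(* Main.v *)
Require Import Defs.
From HB Require Import structures.
From mathcomp Require Import all_boot all_order all_algebra.
From mathcomp Require Import all_classical all_reals all_analysis.
From mathcomp Require Import measurable_realfun.
From mathcomp Require Import ring lra.
Set Implicit Arguments. Unset Strict Implicit. Unset Printing Implicit Defensive.
Import Order.TTheory GRing.Theory Num.Theory.

(* Both infima are compared with an intermediate object, a finite test channel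
   [fin_channel]: finitely many weights w(v) and laws mu(v), nu(v) on the source
   alphabet mixing to pX and pXh, whose information constraints hold on every
   finite quantization of the alphabet.

   Converse. From a code, take v = (message, seed, uniform time index); given v
   the two letters are independent, and the bound on mutual information follows
   from ln x <= x - 1.

   Achievability. An element of the right-hand side of (i) is first replaced by a
   step coupling: quantize X, U, Xh by partitions nearly attaining the suprema
   defining the two informations. Refining these partitions hardly increases
   the divergences, so the step coupling is close in total variation to the
   original one, and uniform integrability makes the distortions close. For the
   finite channel so obtained, soft covering (second moment of the output law of
   a random codebook) yields a codebook whose output is nearly i.i.d.; a
   correcting kernel makes it exactly i.i.d.

   Squared error. Squared error with finite second moments is uniformly
   integrable. Given a finite test channel, Y and Yh are the means of mu(v) and
   nu(v), so that the cost splits into two mean square errors and the cost of a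
   coupling of Y and Yh. Conversely, quantizing Y and Yh finely and using the
   cells as v gives a test channel of nearly the same cost; since E[X|Y] = Y, the
   mean of X on a cell is close to the representative of that cell. *)

(** The codebook is indexed by pairs (seed, message). For each fixed seed its jn codewords must
    imitate the source law, so that the message can be drawn from a posterior; this costs rate
    I(X;U). All kn * jn codewords together must imitate the output law; this costs rate I(Xh;U).
    Hence the two bounds Rt and Rt + Rc. Soft covering wants a strict margin in the rates and a
    bounded distortion, whereas the constraints are closed and Delta may be unbounded. The margin
    comes from mixing in, with small weight, an input that carries no information; Rt = 0 is settled
    separately, since zero information forces independence. Boundedness comes from averaging Delta
    over finitely many pairs of cells. The alphabets are arbitrary measurable spaces, so the laws
    are conditioned only on cells of finite partitions. The gain of information under a refinement
    is exactly the divergence of the refined law from its step approximation. The Markov condition,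
    which holds for U and not for its quantization, is recovered up to a small error by also cutting
    U along level sets of conditional probabilities. *)

Local Open Scope ring_scope.

(** * Finite alphabets: relative entropy and soft covering *)

Section LogSum.
Context {R : realType}.
Implicit Types p q x : R.

Lemma ln_le_subr1 x : 0 < x -> ln x <= x - 1.
Proof.
move=> x0; have := @le_ln1Dx R (x - 1); rewrite subrKC; apply; lra.
Qed.

(** A summand of a relative entropy, with 0 ln 0 = 0. Unlike [mi_term], the reference q is
    arbitrary, so that step approximations can take the place of the product of the marginals. *)
Definition kl_term p q : R := if 0 < p then p * ln (p / q) else 0.

Lemma mi_termE p q1 q2 : mi_term p q1 q2 = kl_term p (q1 * q2).
Proof. by []. Qed.

Lemma kl_term_ge p q : 0 <= p -> 0 <= q -> (0 < p -> 0 < q) -> p - q <= kl_term p q.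
Proof.
move=> p0 q0 pq; rewrite /kl_term; case: ltP => [pp|pp]; last by lra.
have qp := pq pp.
have -> : ln (p / q) = - ln (q / p) by rewrite !ln_div ?posrE//; lra.
have : p * ln (q / p) <= p * (q / p - 1).
  by rewrite ler_pM2l// ln_le_subr1// divr_gt0.
have -> : p * (q / p - 1) = q - p by field; rewrite gt_eqF.
lra.
Qed.

(* via the Hellinger distance: |p - q| = |sqrt p - sqrt q| (sqrt p + sqrt q) *)
Lemma kl_term_dist l p q : 0 < l -> 0 <= p -> 0 <= q -> (0 < p -> 0 < q) ->
  2 * l * `|p - q| <= kl_term p q - p + q + 2 * l ^+ 2 * (p + q).
Proof.
move=> l0.
wlog: p q / exists s t, [/\ 0 <= s, 0 <= t, p = s ^+ 2 & q = t ^+ 2].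
  move=> h p0 q0; apply: h => //.
  by exists (Num.sqrt p), (Num.sqrt q); rewrite !sqr_sqrtr// !sqrtr_ge0.
move=> [s [t [s0 t0 -> ->]]] p0 q0 pq.
have hel : (s - t) ^+ 2 <= kl_term (s ^+ 2) (t ^+ 2) - s ^+ 2 + t ^+ 2.
  rewrite /kl_term; case: ltP => [pp|pp]; last first.
    have /eqP -> : s == 0 by rewrite -sqrf_eq0 eq_le pp p0.
    by rewrite sub0r sqrrN expr0n subr0 add0r.
  have qp := pq pp.
  have sp : 0 < s by rewrite lt0r s0 andbT -sqrf_eq0 gt_eqF.
  have tp : 0 < t by rewrite lt0r t0 andbT -sqrf_eq0 gt_eqF.
  have -> : ln (s ^+ 2 / t ^+ 2) = - 2 * ln (t / s).
    rewrite -exprVn -exprMn lnXn ?divr_gt0// -[t / s]invrK invf_div.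
    by rewrite [in RHS]lnV ?posrE ?divr_gt0// mulrNN mulr_natl.
  have : s ^+ 2 * ln (t / s) <= s ^+ 2 * (t / s - 1).
    by rewrite ler_pM2l// ln_le_subr1// divr_gt0.
  have -> : s ^+ 2 * (t / s - 1) = s * t - s ^+ 2 by field; rewrite gt_eqF.
  have -> : (s - t) ^+ 2 = s ^+ 2 - 2 * (s * t) + t ^+ 2 by ring.
  set X := ln _; lra.
have -> : `|s ^+ 2 - t ^+ 2| = `|s - t| * (s + t).
  by rewrite subr_sqr normrM (ger0_norm (addr_ge0 s0 t0)).
apply: le_trans (lerD hel (lexx _)).
rewrite -(@real_normK _ (s - t)) ?num_real//.
(* By 2 l z (s + t) <= z^2 + l^2 (s + t)^2 and (s + t)^2 <= 2 (s^2 + t^2). Keeping l free replaces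
   the square root of Pinsker's inequality. *)
set z := `|s - t|.
have := sqr_ge0 (z - l * (s + t)); have := sqr_ge0 (l * (s - t)).
have -> : (l * (s - t)) ^+ 2 = 2 * l ^+ 2 * (s ^+ 2 + t ^+ 2) - l ^+ 2 * (s + t) ^+ 2 by ring.
have -> : (z - l * (s + t)) ^+ 2 = z ^+ 2 - 2 * l * (z * (s + t)) + l ^+ 2 * (s + t) ^+ 2 by ring.
lra.
Qed.

End LogSum.

(** * Laws of i.i.d. letters and the probabilistic method *)

Section ProductPmf.
Context {R : realType}.

Definition fpmf (A : finType) (p : A -> R) := (forall a, 0 <= p a) /\ \sum_a p a = 1.

Definition ppow (I A : finType) (p : A -> R) (f : {ffun I -> A}) : R :=
  \prod_i p (f i).

Lemma sum_ffun_prod (I A : finType) (F : I -> A -> R) :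
  \sum_(f : {ffun I -> A}) \prod_i F i (f i) = \prod_i \sum_a F i a.
Proof. by rewrite bigA_distr_bigA. Qed.

Lemma ppow_pmf (I A : finType) (p : A -> R) : fpmf p -> fpmf (@ppow I A p).
Proof.
move=> [p0 p1]; split=> [f|]; first exact: prodr_ge0.
by rewrite (sum_ffun_prod (fun=> p)) big1.
Qed.

Lemma ppow_expect1 (I A : finType) (p : A -> R) (g : A -> R) (i0 : I) :
  fpmf p -> \sum_f ppow p f * g (f i0) = \sum_a p a * g a.
Proof.
move=> [p0 p1].
pose F i a := p a * (if i == i0 then g a else 1).
rewrite (eq_bigr (fun f : {ffun I -> A} => \prod_i F i (f i))); last first.
  move=> f _; rewrite /F big_split/=; congr (_ * _).
  rewrite (bigD1 i0)//= eqxx big1 ?mulr1// => i /negPf ->//.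
rewrite sum_ffun_prod (bigD1 i0)//= [X in _ * X]big1 ?mulr1.
  by apply: eq_bigr => a _; rewrite /F eqxx.
by move=> i /negPf ii; rewrite /F ii -[RHS]p1; apply: eq_bigr => a _; rewrite mulr1.
Qed.

Lemma ppow_expect2 (I A : finType) (p : A -> R) (g h : A -> R) (i0 i1 : I) :
  fpmf p -> i0 != i1 ->
  \sum_f ppow p f * (g (f i0) * h (f i1)) = (\sum_a p a * g a) * \sum_a p a * h a.
Proof.
move=> [p0 p1] ne; have ne' : (i1 == i0) = false by rewrite eq_sym (negPf ne).
pose F i a := p a * (if i == i0 then g a else if i == i1 then h a else 1).
rewrite (eq_bigr (fun f : {ffun I -> A} => \prod_i F i (f i))); last first.
  move=> f _; rewrite /F big_split/=; congr (_ * _).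
  rewrite (bigD1 i0)//= eqxx (bigD1 i1) ?ne'//=.
  rewrite eqxx big1 ?mulr1// => i /andP[/negPf -> /negPf ->]//.
rewrite sum_ffun_prod (bigD1 i0)//= (bigD1 i1) ?ne'//=.
rewrite [X in _ * (_ * X)]big1 ?mulr1.
  congr (_ * _); apply: eq_bigr => a _; rewrite /F ?ne' ?eqxx//.
move=> i /andP[/negPf i_0 /negPf i_1]; rewrite /F i_0 i_1 -[RHS]p1.
by apply: eq_bigr => a _; rewrite mulr1.
Qed.

(** Independent centred summands are uncorrelated. The function z may depend on the index: soft
    covering sets it to zero outside a set of codewords. *)
Lemma ppow_variance (I A : finType) (p : A -> R) (z : I -> A -> R) :
  fpmf p -> (forall i, \sum_a p a * z i a = 0) ->
  \sum_f ppow p f * (\sum_i z i (f i)) ^+ 2 = \sum_i \sum_a p a * z i a ^+ 2.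
Proof.
move=> pp z0.
transitivity (\sum_i \sum_j \sum_f ppow p f * (z i (f i) * z j (f j))).
  under [RHS]eq_bigr do rewrite exchange_big.
  rewrite [RHS]exchange_big; apply: eq_bigr => f _.
  rewrite expr2 mulr_suml mulr_sumr; apply: eq_bigr => i _.
  by rewrite !mulr_sumr.
apply: eq_bigr => i _; rewrite (bigD1 i)//= [X in _ + X]big1 ?addr0.
  rewrite -(ppow_expect1 (fun a => z i a ^+ 2) i pp).
  by apply: eq_bigr => f _; rewrite expr2.
move=> j ji; rewrite (ppow_expect2 (z i) (z j)) ?z0 ?mul0r// eq_sym//.
Qed.

Lemma exists_le_expect (A : finType) (p T : A -> R) :
  fpmf p -> exists a, T a <= \sum_a p a * T a.
Proof.
move=> [p0 p1]; apply: contrapT => /forallNP h.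
have {}h a : \sum_a p a * T a < T a by rewrite ltNge; apply/negP/h.
set m := \sum_a p a * T a in h.
suff : m < \sum_a p a * T a by rewrite -/m ltxx.
rewrite -[ltLHS]mul1r -p1 mulr_suml.
have [a pa] : exists a, p a != 0.
  apply: contrapT => /forallNP pn; move: p1; rewrite big1 => [/eqP|a _].
    by rewrite eq_sym oner_eq0.
  by apply/eqP; have /negP := pn a; rewrite negbK.
rewrite (bigD1 a)//= [ltRHS](bigD1 a)//= ltr_leD//.
  by rewrite ltr_pM2l// lt0r pa p0.
by apply: ler_sum => b _; rewrite ler_wpM2l// ltW.
Qed.

End ProductPmf.

Section SoftCovering.
Context {R : realType}.

Definition pout (U X : finType) (p : U -> R) (W : U -> X -> R) (x : X) : R :=
  \sum_u p u * W u x.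

(** The part W2 of W above tau times the output law q is cut off and paid for twice, once in the
    empirical average and once in q. For the rest W1 <= tau q, the average over S has variance at
    most tau q^2 / |S|. The set S is a parameter because one codebook must cover both with the seed
    fixed and with all pairs (seed, message). *)
Lemma soft_covering (U X M : finType) (p : U -> R) (W : U -> X -> R) (S : {set M})
    (tau eta : R) :
  fpmf p -> (forall u, fpmf (W u)) -> 0 < tau -> 0 < eta -> (0 < #|S|)%N ->
  \sum_(cb : {ffun M -> U}) ppow p cb *
     \sum_x `|#|S|%:R^-1 * (\sum_(m in S) W (cb m) x) - pout p W x| <=
  2 * (\sum_u p u * \sum_x (if tau * pout p W x < W u x then W u x else 0)) +
  eta + tau / (4 * eta * #|S|%:R).
Proof.
move=> pp WW tau0 eta0 S0; set q := pout p W.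
have [p0 p1] := pp.
pose W1 u x := if tau * q x < W u x then 0 else W u x.
pose W2 u x := if tau * q x < W u x then W u x else 0.
have W0 u x : 0 <= W u x by case: (WW u).
have W10 u x : 0 <= W1 u x by rewrite /W1; case: ifP.
have W20 u x : 0 <= W2 u x by rewrite /W2; case: ifP.
have WE u x : W u x = W1 u x + W2 u x.
  by rewrite /W1 /W2; case: ifP; rewrite ?addr0 ?add0r.
pose q1 x := \sum_u p u * W1 u x.
pose q2 x := \sum_u p u * W2 u x.
have qE x : q x = q1 x + q2 x.
  rewrite /q1 /q2 -big_split/=; apply: eq_bigr => u _.
  by rewrite -mulrDr -WE.
have q0 x : 0 <= q x by apply: sumr_ge0 => u _; rewrite mulr_ge0.
have q10 x : 0 <= q1 x by apply: sumr_ge0 => u _; rewrite mulr_ge0.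
have q20 x : 0 <= q2 x by apply: sumr_ge0 => u _; rewrite mulr_ge0.
have q1q x : q1 x <= q x by rewrite qE lerDl.
have qs : \sum_x q x = 1.
  rewrite /q exchange_big/= -p1; apply: eq_bigr => u _.
  by rewrite -mulr_sumr; case: (WW u) => _ ->; rewrite mulr1.
pose s : R := #|S|%:R.
have s0 : 0 < s by rewrite ltr0n.
pose B := \sum_u p u * \sum_x W2 u x.
have BE : \sum_x q2 x = B.
  by rewrite /q2 /B exchange_big/=; apply: eq_bigr => u _; rewrite mulr_sumr.
pose Z (cb : {ffun M -> U}) x := s^-1 * (\sum_(m in S) W1 (cb m) x) - q1 x.
pose Q2 (cb : {ffun M -> U}) x := s^-1 * (\sum_(m in S) W2 (cb m) x).
have Q20 cb x : 0 <= Q2 cb x.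
  by rewrite mulr_ge0 ?invr_ge0 ?(ltW s0)//; apply: sumr_ge0.
have [pc0 pc1] := @ppow_pmf R M U p pp.
have EQ2 x : \sum_cb ppow p cb * Q2 cb x = q2 x.
  rewrite /Q2; under eq_bigr do rewrite mulrCA mulr_sumr.
  rewrite -mulr_sumr exchange_big/=.
  under eq_bigr do rewrite (ppow_expect1 (fun u => W2 u x))//.
  by rewrite sumr_const -[_ *+ _]mulr_natl mulrA mulVf ?mul1r// gt_eqF.
have EZ2 x : \sum_cb ppow p cb * Z cb x ^+ 2 <= tau * q x ^+ 2 / s.
  pose z (m : M) u := if m \in S then s^-1 * (W1 u x - q1 x) else 0.
  have zE cb : Z cb x = \sum_m z m (cb m).
    rewrite /z -big_mkcond/= /Z -mulr_sumr sumrB sumr_const -[q1 x *+ _]mulr_natl.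
    by rewrite mulrBr mulrA mulVf ?gt_eqF// mul1r.
  under eq_bigr do rewrite zE.
  rewrite ppow_variance//; last first.
    move=> m; rewrite /z; case: (m \in S); last by rewrite big1// => u _; rewrite mulr0.
    under eq_bigr do rewrite mulrCA mulrBr.
    by rewrite -mulr_sumr sumrB -mulr_suml p1 mul1r subrr mulr0.
  have zb m : \sum_a p a * z m a ^+ 2 <= if m \in S then s ^- 2 * (tau * q x ^+ 2) else 0.
    rewrite /z; case: (m \in S); last by rewrite big1// => u _; rewrite expr0n mulr0.
    under eq_bigr do rewrite exprMn mulrCA exprVn.
    rewrite -mulr_sumr ler_wpM2l ?invr_ge0 ?sqr_ge0//.
    have -> : \sum_i p i * (W1 i x - q1 x) ^+ 2 =
              \sum_i p i * W1 i x ^+ 2 - q1 x ^+ 2.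
      transitivity (\sum_i (p i * W1 i x ^+ 2 - 2 * q1 x * (p i * W1 i x) + q1 x ^+ 2 * p i)).
        by apply: eq_bigr => u _; ring.
      rewrite big_split sumrB/= -!mulr_sumr p1 -/(q1 x); ring.
    rewrite lerBlDr (@le_trans _ _ (tau * q x * q1 x))//.
      rewrite [X in _ <= _ * X]/q1 mulr_sumr; apply: ler_sum => u _.
      rewrite [leRHS]mulrCA ler_wpM2l//.
      rewrite expr2 ler_wpM2r// /W1; case: ltP => // _.
      by rewrite mulr_ge0// ltW.
    have := ler_wpM2l (q0 x) (q1q x).
    move=> h; have := ler_wpM2l (ltW tau0) h.
    have := sqr_ge0 (q1 x); lra.
  rewrite (le_trans (ler_sum _ (fun m _ => zb m)))// -big_mkcond/=.
  rewrite sumr_const -[_ *+ _]mulr_natl -/s.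
  have -> : s * (s ^- 2 * (tau * q x ^+ 2)) = tau * q x ^+ 2 / s.
    by field; rewrite gt_eqF.
  by [].
have pt (cb : {ffun M -> U}) x : `|s^-1 * (\sum_(m in S) W (cb m) x) - q x| <=
   eta * q x + Z cb x ^+ 2 / (4 * eta * q x) + Q2 cb x + q2 x.
  have -> : s^-1 * (\sum_(m in S) W (cb m) x) - q x = Z cb x + (Q2 cb x - q2 x).
    rewrite qE /Z /Q2; under eq_bigr do rewrite WE.
    rewrite big_split/= mulrDr; ring.
  have h1 : `|Q2 cb x - q2 x| <= Q2 cb x + q2 x.
    by rewrite (le_trans (ler_normB _ _))// !ger0_norm.
  (* The inequality |z| <= c + z^2 / (4 c) with c = eta q replaces Cauchy-Schwarz; after summation
     over x the first term gives eta and the second tau / (4 eta |S|). Where q vanishes so does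
     Z. *)
  have h2 : `|Z cb x| <= eta * q x + Z cb x ^+ 2 / (4 * eta * q x).
    have [qx0|qx0] := eqVneq (q x) 0.
      have W1x u : W1 u x = 0.
        by rewrite /W1 qx0 mulr0; case: ltP => // h; apply/eqP; rewrite eq_le W0 h.
      have -> : Z cb x = 0.
        rewrite /Z /q1 !big1 ?mulr0 ?subr0// => u _; rewrite W1x//.
        by rewrite mulr0.
      by rewrite qx0 expr0n !mulr0 normr0 mul0r addr0.
    have qp : 0 < q x by rewrite lt0r qx0 q0.
    have c0 : 0 < eta * q x by rewrite mulr_gt0.
    rewrite -(@real_normK _ (Z cb x)) ?num_real//; set w := `|Z cb x|.
    rewrite -mulrA; set c := eta * q x in c0 *.
    have := sqr_ge0 (w - 2 * c).
    have -> : c + w ^+ 2 / (4 * c) = w + (w - 2 * c) ^+ 2 / (4 * c).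
      by field; rewrite gt_eqF.
    move=> h; rewrite lerDl divr_ge0// mulr_ge0// ltW//.
  rewrite (le_trans (ler_normD _ _))//; lra.
apply: (@le_trans _ _ (\sum_cb ppow p cb * \sum_x (eta * q x + Z cb x ^+ 2 / (4 * eta * q x) + Q2 cb x + q2 x))).
  by apply: ler_sum => cb _; rewrite ler_wpM2l//; apply: ler_sum => x _; exact: pt.
under eq_bigr do rewrite mulr_sumr.
rewrite exchange_big/=.
have -> : 2 * B + eta + tau / (4 * eta * s) =
   \sum_x (eta * q x + tau * q x / (4 * eta * s) + q2 x + q2 x).
  rewrite !big_split/= BE -!mulr_suml -!mulr_sumr qs; ring.
apply: ler_sum => x _.
under eq_bigr do rewrite !mulrDr.
rewrite !big_split/= EQ2 -!mulr_suml pc1 !mul1r !lerD2r lerD2l.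
under eq_bigr do rewrite mulrA.
rewrite -mulr_suml.
have [qx0|qx0] := eqVneq (q x) 0.
  by rewrite qx0 !mulr0 invr0 mulr0 mul0r.
have qp : 0 < q x by rewrite lt0r qx0 q0.
rewrite ler_pdivrMr ?mulr_gt0// (le_trans (EZ2 x))//.
by rewrite le_eqVlt; apply/orP; left; apply/eqP; field; rewrite !gt_eqF.
Qed.

End SoftCovering.

(** * Memoryless channels and their information density *)

Section BlockChannel.
Context {R : realType}.

Lemma pout_pmf (U X : finType) (p : U -> R) (W : U -> X -> R) :
  fpmf p -> (forall u, fpmf (W u)) -> fpmf (pout p W).
Proof.
move=> [p0 p1] WW; split=> [x|].
  by apply: sumr_ge0 => u _; rewrite mulr_ge0//; case: (WW u).
rewrite /pout exchange_big/= -p1; apply: eq_bigr => u _.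
by rewrite -mulr_sumr; case: (WW u) => _ ->; rewrite mulr1.
Qed.

Definition cpow (n : nat) (U X : finType) (W : U -> X -> R)
    (u : {ffun 'I_n -> U}) (x : {ffun 'I_n -> X}) : R := \prod_t W (u t) (x t).

Lemma cpow_pmf n (U X : finType) (W : U -> X -> R) (u : {ffun 'I_n -> U}) :
  (forall u, fpmf (W u)) -> fpmf (cpow W u).
Proof.
move=> WW; split=> [x|]; first by apply: prodr_ge0 => t _; case: (WW (u t)).
rewrite (sum_ffun_prod (fun t => W (u t))) big1// => t _.
by case: (WW (u t)).
Qed.

Lemma pout_pow n (U X : finType) (p : U -> R) (W : U -> X -> R) x :
  pout (@ppow R 'I_n U p) (cpow W) x = ppow (pout p W) x.
Proof.
rewrite /pout /ppow /cpow -(sum_ffun_prod (fun t u => p u * W u (x t))).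
by apply: eq_bigr => u _; rewrite big_split.
Qed.

Lemma sum_ffun_pair n (U X : finType) (G : {ffun 'I_n -> U} -> {ffun 'I_n -> X} -> R) :
  \sum_u \sum_x G u x =
  \sum_(f : {ffun 'I_n -> U * X}) G [ffun t => (f t).1] [ffun t => (f t).2].
Proof.
rewrite pair_bigA/=.
rewrite (reindex (fun f : {ffun 'I_n -> U * X} =>
   ([ffun t => (f t).1], [ffun t => (f t).2]) : _ * _))//=.
exists (fun ux : {ffun 'I_n -> U} * {ffun 'I_n -> X} => [ffun t => (ux.1 t, ux.2 t)]).
  by move=> f _; apply/ffunP => t; rewrite !ffunE; case: (f t).
by move=> [u x] _; congr pair; apply/ffunP => t; rewrite !ffunE.
Qed.

(** Mutual information of input and output, as the mean divergence of a row of the channel from the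
    output law. *)
Definition pinfo (U X : finType) (p : U -> R) (W : U -> X -> R) : R :=
  \sum_u p u * \sum_x kl_term (W u x) (pout p W x).

(* Chebyshev's inequality for the information density *)
Lemma atypical_mass (U X : finType) (p : U -> R) (W : U -> X -> R) :
  fpmf p -> (forall u, fpmf (W u)) -> exists C : R, 0 <= C /\
  forall n delta, (0 < n)%N -> 0 < delta ->
  \sum_(u : {ffun 'I_n -> U}) ppow p u * \sum_(x : {ffun 'I_n -> X})
     (if expR (n%:R * (pinfo p W + delta)) * pout (@ppow R 'I_n U p) (cpow W) x < cpow W u x
      then cpow W u x else 0) <= C / (n%:R * delta ^+ 2).
Proof.
move=> pp WW; have [p0 p1] := pp.
have W0 u x : 0 <= W u x by case: (WW u).
set q := pout p W; set I := pinfo p W.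
pose pj (v : U * X) := p v.1 * W v.1 v.2.
pose z (v : U * X) := ln (W v.1 v.2 / q v.2) - I.
have pjp : fpmf pj.
  split=> [v|]; first by rewrite mulr_ge0.
  rewrite -(pair_bigA _ (fun u x => p u * W u x))/= -p1; apply: eq_bigr => u _.
  by rewrite -mulr_sumr; case: (WW u) => _ ->; rewrite mulr1.
have zm : \sum_v pj v * z v = 0.
  rewrite /z; under eq_bigr do rewrite mulrBr.
  rewrite sumrB -mulr_suml; case: pjp => _ ->; rewrite mul1r.
  apply/eqP; rewrite subr_eq0; apply/eqP.
  rewrite -(pair_bigA _ (fun u x => p u * W u x * ln (W u x / q x)))/=.
  apply: eq_bigr => u _; rewrite mulr_sumr; apply: eq_bigr => x _.
  rewrite /kl_term; case: ltP => h; first by rewrite mulrA.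
  have -> : W u x = 0 by apply/eqP; rewrite eq_le h W0.
  by rewrite mulr0 mul0r.
(* Variance of the information density of a single letter; n letters have variance n C, against the
   squared threshold (n delta)^2. *)
pose C := \sum_v pj v * z v ^+ 2.
exists C; split.
  by apply: sumr_ge0 => v _; rewrite mulr_ge0 ?sqr_ge0//; case: pjp.
move=> n delta n0 d0.
under eq_bigr do rewrite mulr_sumr.
rewrite sum_ffun_pair.
have nd : 0 < n%:R * delta :> R by rewrite mulr_gt0// ltr0n.
apply: (@le_trans _ _ (\sum_(f : {ffun 'I_n -> U * X})
   ppow pj f * (\sum_t z (f t)) ^+ 2 / (n%:R * delta) ^+ 2)); last first.
  rewrite -mulr_suml (@ppow_variance _ _ _ pj (fun=> z))// sumr_const card_ord -/C -mulr_natl.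
  rewrite le_eqVlt; apply/orP; left; apply/eqP; field.
  by rewrite !gt_eqF// ltr0n.
apply: ler_sum => f _.
set u := [ffun t => (f t).1]; set x := [ffun t => (f t).2].
have pjE : ppow pj f = ppow p u * cpow W u x.
  by rewrite /ppow /cpow -big_split/=; apply: eq_bigr => t _; rewrite !ffunE.
have pj0 : 0 <= ppow pj f by apply: prodr_ge0 => t _; case: pjp.
case: ifP => [h|_]; last first.
  by rewrite mulr0 divr_ge0 ?sqr_ge0// mulr_ge0 ?sqr_ge0.
rewrite -pjE.
have [->|pjn] := eqVneq (ppow pj f) 0; first by rewrite !mul0r.
rewrite -mulrA ler_peMr// ler_pdivlMr ?exprn_gt0// mul1r.
have pjt t : 0 < pj (f t).
  rewrite lt0r; case: pjp => -> _; rewrite andbT; apply/eqP => pt0.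
  by move: pjn; rewrite /ppow (bigD1 t)//= pt0 mul0r eqxx.
have pt t : 0 < p (f t).1.
  by have := pjt t; rewrite /pj lt0r mulf_eq0 negb_or => /andP[/andP[pn _] _]; rewrite lt0r pn p0.
have Wt t : 0 < W (f t).1 (f t).2.
  by have := pjt t; rewrite /pj pmulr_rgt0.
have qt t : 0 < q (f t).2.
  apply: lt_le_trans (pjt t) _; rewrite /q /pout (bigD1 (f t).1)//= lerDl.
  by apply: sumr_ge0 => i _; rewrite mulr_ge0.
have zS : n%:R * delta < \sum_t z (f t).
  rewrite /z sumrB sumr_const card_ord -[I *+ n]mulr_natl ltrBrDl -mulrDr.
  rewrite -ltr_expR expR_sum.
  under eq_bigr do rewrite lnK ?posrE ?divr_gt0//.
  rewrite prodf_div ltr_pdivlMr ?prodr_gt0//.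
  move: h; rewrite pout_pow /ppow /cpow.
  by under eq_bigr do rewrite ffunE; under [ltRHS]eq_bigr do rewrite !ffunE.
by rewrite ler_pXn2r// ?nnegrE ?(ltW nd)// ltW// (lt_trans nd).
Qed.

End BlockChannel.

(** * From a codebook to a code with exact marginals *)

Section Codes.
Context {R : realType}.

Lemma sum_max0_eq0 (A : finType) (F : A -> R) :
  (forall a, 0 <= F a) -> \sum_a F a = 0 -> forall a, F a = 0.
Proof.
move=> F0 /eqP; rewrite psumr_eq0// => /allP h a.
by apply/eqP/(implyP (h a _)) => //; rewrite mem_index_enum.
Qed.

(** A maximal coupling read as a kernel: y is kept with probability min (p, q) / p and otherwise
    redrawn from the normalized deficit of p with respect to q. The function f is the probability of
    redrawing, and a redraw costs at most M. *)
Lemma correcting_kernel (Y : finType) (p q : Y -> R) : fpmf p -> fpmf q ->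
  exists (c : Y -> Y -> R) (f : Y -> R), [/\ (forall y, fpmf (c y)),
    (forall y', \sum_y p y * c y y' = q y'),
    (forall y, 0 <= f y),
    \sum_y p y * f y <= \sum_y `|p y - q y| &
    forall (g : Y -> R) (M : R), (forall y, 0 <= g y <= M) ->
      forall y, \sum_y' c y y' * g y' <= g y + M * f y].
Proof.
move=> [p0 p1] [q0 q1].
pose m y := Num.min (p y) (q y).
pose r y := q y - m y.
have mp y : m y <= p y by rewrite /m ge_min lexx.
have mq y : m y <= q y by rewrite /m ge_min lexx orbT.
have m0 y : 0 <= m y by rewrite /m le_min p0 q0.
have r0 y : 0 <= r y by rewrite subr_ge0.
pose Z := \sum_y r y.
have Zp : Z = \sum_y (p y - m y) by rewrite /Z !sumrB p1 q1.
have Z0 : 0 <= Z by apply: sumr_ge0.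
pose c0 y := if p y == 0 then 1 else m y / p y.
have c0p y : p y * c0 y = m y.
  rewrite /c0; case: eqP => [h|/eqP h]; last by rewrite mulrCA mulfV ?mulr1.
  by apply/eqP; rewrite mulr1 eq_le {1}h m0/= mp.
have c01 y : 0 <= c0 y <= 1.
  rewrite /c0; case: eqP => [h|/eqP h]; first by rewrite ler01 lexx.
  by rewrite divr_ge0//= ler_pdivrMr ?mul1r// lt0r h p0.
have Zc y : Z = 0 -> c0 y = 1.
  rewrite Zp => Z00.
  have h := sum_max0_eq0 (fun a => etrans (subr_ge0 _ _) (mp a)) Z00 y.
  rewrite /c0; case: eqP => // /eqP pn.
  have -> : m y = p y by move/eqP: h; rewrite subr_eq0 => /eqP.
  by rewrite mulfV.
exists (fun y y' => (if y' == y then c0 y else 0) + (1 - c0 y) * (r y' / Z)), (fun y => 1 - c0 y).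
have rZ (g : Y -> R) y : \sum_y' ((if y' == y then c0 y else 0) + (1 - c0 y) * (r y' / Z)) * g y'
    = c0 y * g y + (1 - c0 y) * (\sum_y' r y' * g y') / Z.
  under eq_bigr do rewrite mulrDl.
  rewrite big_split/=; congr (_ + _).
    rewrite (bigD1 y)//= eqxx big1 ?addr0// => i /negPf ->.
    by rewrite mul0r.
  rewrite mulr_sumr mulr_suml; apply: eq_bigr => i _; ring.
split.
- move=> y; split=> [y'|].
    have /andP[? ?] := c01 y; rewrite addr_ge0 ?mulr_ge0 ?invr_ge0 ?subr_ge0//.
    by case: ifP.
  have := rZ (fun=> 1) y; under eq_bigr do rewrite mulr1.
  move=> h; rewrite /= h; under eq_bigr do rewrite mulr1.
  rewrite -/Z mulr1; have [Zz|Zn] := eqVneq Z 0; first by rewrite (Zc _ Zz); ring.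
  by field.
- move=> y'; under eq_bigr do rewrite mulrDr.
  rewrite big_split/= (bigD1 y')//= eqxx big1 ?addr0; last first.
    by move=> i /negPf; rewrite eq_sym => ->; rewrite mulr0.
  rewrite c0p; under eq_bigr do rewrite mulrA mulrBr mulr1 c0p.
  rewrite -mulr_suml -Zp; have [Zz|Zn] := eqVneq Z 0; last by rewrite mulrCA mulfV// mulr1 /r subrKC.
  rewrite Zz mul0r addr0; have := sum_max0_eq0 r0 Zz y'.
  by rewrite /r => /eqP; rewrite subr_eq0 => /eqP.
- by move=> y; rewrite subr_ge0; case/andP: (c01 y).
- apply: ler_sum => y _; rewrite mulrBr mulr1 c0p /m.
  by have [h|h] := lerP (p y) (q y); rewrite ?subrr ?subr_ge0.
- move=> g M gM y; rewrite rZ.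
  have /andP[c00 c0l] := c01 y; have /andP[g0 gl] := gM y.
  apply: lerD; first by rewrite ler_piMl.
  have [Zz|Zn] := eqVneq Z 0; first by rewrite (Zc _ Zz) subrr !(mul0r, mulr0).
  have Zp0 : 0 < Z by rewrite lt0r Zn.
  rewrite ler_pdivrMr// [M * _]mulrC -mulrA ler_wpM2l ?subr_ge0//.
  rewrite /Z mulr_sumr; apply: ler_sum => i _; rewrite mulrC ler_wpM2r//.
  by case/andP: (gM i).
Qed.

(* The encoder samples the message from its posterior given the source block and
   the seed, so the joint law differs from that of the ideal codebook channel only
   through the source marginal. *)
Lemma code_of_codebook (X Y U K J : finType) (pX : X -> R) (pY : Y -> R)
    (a : U -> X -> R) (b : U -> Y -> R) (d : X -> Y -> R) (dmax : R)
    (cb : K -> J -> U) (j0 : J) :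
  fpmf pX -> fpmf pY -> (forall u, fpmf (a u)) -> (forall u, fpmf (b u)) ->
  (forall x y, 0 <= d x y <= dmax) -> (0 < #|K|)%N ->
  let k := #|K|%:R : R in let j := #|J|%:R : R in
  exists (enc : X -> K -> J -> R) (dec : K -> J -> Y -> R),
  [/\ (forall x k j, 0 <= enc x k j), (forall k j, fpmf (dec k j)),
      (forall x k0, \sum_j enc x k0 j = pX x / k),
      (forall y, \sum_x \sum_k \sum_j enc x k j * dec k j y = pY y) &
      \sum_x \sum_k \sum_j \sum_y enc x k j * dec k j y * d x y <=
      k^-1 * j^-1 * (\sum_k \sum_j \sum_x \sum_y a (cb k j) x * b (cb k j) y * d x y) +
      dmax * (2 * (k^-1 * \sum_k0 \sum_x `|j^-1 * (\sum_j0 a (cb k0 j0) x) - pX x|)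
              + \sum_y `|k^-1 * j^-1 * (\sum_k0 \sum_j0 b (cb k0 j0) y) - pY y|)].
Proof.
move=> [pX0 pX1] pYp aP bP dP K0 k j.
have kp : 0 < k by rewrite ltr0n.
have jp : 0 < j by rewrite ltr0n; apply/card_gt0P; exists j0.
have a0 u x : 0 <= a u x by case: (aP u).
have b0 u y : 0 <= b u y by case: (bP u).
pose A k x := \sum_j a (cb k j) x.
have A0 k1 x : 0 <= A k1 x by apply: sumr_ge0.
(* Posterior of the message given the source block and the seed; the message is j0 when no codeword
   of this seed can produce x. *)
pose e x k1 j1 := if A k1 x == 0 then (j1 == j0)%:R else a (cb k1 j1) x / A k1 x.
have e0 x k1 j1 : 0 <= e x k1 j1 by rewrite /e; case: ifP => _; rewrite ?ler0n ?divr_ge0.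
have e1 x k1 : \sum_j e x k1 j = 1.
  rewrite /e; case: (eqVneq (A k1 x) 0) => h; last by rewrite -mulr_suml -/(A k1 x) mulfV.
  by rewrite (bigD1 j0)//= eqxx big1 ?addr0// => i /negPf ->.
pose enc x k1 j1 := pX x / k * e x k1 j1.
have enc0 x k1 j1 : 0 <= enc x k1 j1 by rewrite mulr_ge0// divr_ge0// ltW.
have encs x k1 : \sum_j enc x k1 j = pX x / k by rewrite -mulr_sumr e1 mulr1.
(* The ideal law: seed and message uniform, x produced by the codeword. It has the same posterior as
   [enc], so the two differ by T1. *)
pose Q x k1 j1 := k^-1 * j^-1 * a (cb k1 j1) x.
pose T1 := k^-1 * \sum_k0 \sum_x `|j^-1 * (\sum_j0 a (cb k0 j0) x) - pX x|.
pose T2 := \sum_y `|k^-1 * j^-1 * (\sum_k0 \sum_j0 b (cb k0 j0) y) - pY y|.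
have encQ : \sum_x \sum_k1 \sum_j1 `|enc x k1 j1 - Q x k1 j1| = T1.
  rewrite exchange_big/= /T1 mulr_sumr; apply: eq_bigr => k1 _.
  rewrite mulr_sumr; apply: eq_bigr => x _.
  rewrite -[RHS]mulr1 -(e1 x k1) mulr_sumr; apply: eq_bigr => j1 _.
  rewrite -/(A k1 x).
  have aA : a (cb k1 j1) x = A k1 x * e x k1 j1.
    rewrite /e; case: eqP => [h|/eqP h]; last by rewrite mulrCA mulfV// mulr1.
    by rewrite h mul0r; apply: (sum_max0_eq0 _ h).
  have -> : enc x k1 j1 - Q x k1 j1 = - (k^-1 * (j^-1 * A k1 x - pX x) * e x k1 j1).
    by rewrite /enc /Q aA; ring.
  by rewrite normrN !normrM (ger0_norm (e0 _ _ _)) (@ger0_norm _ k^-1) ?invr_ge0 ?(ltW kp).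
pose p y := \sum_x \sum_k \sum_j enc x k j * b (cb k j) y.
have pp : fpmf p.
  split=> [y|]; first by do 3 (apply: sumr_ge0 => ? _); rewrite mulr_ge0.
  rewrite /p exchange_big/= -pX1; apply: eq_bigr => x _.
  rewrite exchange_big/=.
  transitivity (\sum_(k0 : K) pX x / k).
    apply: eq_bigr => k1 _; rewrite exchange_big/= -(encs x k1); apply: eq_bigr => j1 _.
    by rewrite -mulr_sumr; case: (bP (cb k1 j1)) => _ ->; rewrite mulr1.
  by rewrite sumr_const -[_ *+ _]mulr_natl mulrCA mulfV ?mulr1// gt_eqF.
have pq : \sum_y `|p y - pY y| <= T1 + T2.
  pose qy y := k^-1 * j^-1 * (\sum_k0 \sum_j0 b (cb k0 j0) y).
  apply: (@le_trans _ _ (\sum_y (`|p y - qy y| + `|qy y - pY y|))).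
    by apply: ler_sum => y _; apply: ler_distD.
  rewrite big_split/= lerD2r -encQ.
  have qyE y : qy y = \sum_x \sum_k \sum_j Q x k j * b (cb k j) y.
    rewrite /qy mulr_sumr [RHS]exchange_big/=; apply: eq_bigr => k1 _.
    rewrite mulr_sumr [RHS]exchange_big/=; apply: eq_bigr => j1 _.
    by rewrite -mulr_suml /Q -mulr_sumr; case: (aP (cb k1 j1)) => _ ->; rewrite mulr1.
  apply: (@le_trans _ _ (\sum_y \sum_x \sum_k \sum_j `|enc x k j - Q x k j| * b (cb k j) y)).
    apply: ler_sum => y _; rewrite qyE /p -sumrB.
    apply: le_trans (ler_norm_sum _ _ _) _; apply: ler_sum => x _; rewrite -sumrB.
    apply: le_trans (ler_norm_sum _ _ _) _; apply: ler_sum => k1 _; rewrite -sumrB.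
    apply: le_trans (ler_norm_sum _ _ _) _; apply: ler_sum => j1 _.
    by rewrite -mulrBl normrM (ger0_norm (b0 _ _)).
  rewrite exchange_big/=; apply: ler_sum => x _.
  rewrite exchange_big/=; apply: ler_sum => k1 _.
  rewrite exchange_big/=; apply: ler_sum => j1 _.
  by rewrite -mulr_sumr; case: (bP (cb k1 j1)) => _ ->; rewrite mulr1.
(* Before correction the output law p is at distance at most T1 + T2 from pY. The correction costs
   dmax (T1 + T2), and passing from [enc] to Q in the distortion costs another dmax T1; hence the
   factor 2 in front of T1. *)
have [c [f [cP cq f0 fT cg]]] := correcting_kernel pp pYp.
exists enc, (fun k1 j1 y' => \sum_y b (cb k1 j1) y * c y y'); split => //.
- move=> k1 j1; exact: (pout_pmf (bP _) cP).
- move=> y'; rewrite -cq /p; under [RHS]eq_bigr do rewrite mulr_suml.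
  rewrite [RHS]exchange_big/=; apply: eq_bigr => x _.
  under [RHS]eq_bigr do rewrite mulr_suml.
  rewrite [RHS]exchange_big/=; apply: eq_bigr => k1 _.
  under [RHS]eq_bigr do rewrite mulr_suml.
  rewrite [RHS]exchange_big/=; apply: eq_bigr => j1 _.
  by rewrite mulr_sumr; apply: eq_bigr => y _; rewrite mulrA.
rewrite -/T1 -/T2.
pose DP := \sum_x \sum_k \sum_j \sum_y enc x k j * b (cb k j) y * d x y.
pose DQ := \sum_x \sum_k \sum_j \sum_y Q x k j * b (cb k j) y * d x y.
have -> : k^-1 * j^-1 * (\sum_k \sum_j \sum_x \sum_y a (cb k j) x * b (cb k j) y * d x y) = DQ.
  rewrite mulr_sumr /DQ [RHS]exchange_big; apply: eq_bigr => k1 _.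
  rewrite mulr_sumr [RHS]exchange_big; apply: eq_bigr => j1 _.
  rewrite mulr_sumr; apply: eq_bigr => x _; rewrite mulr_sumr; apply: eq_bigr => y _.
  by rewrite /Q !mulrA.
have h1 : \sum_x \sum_k1 \sum_j1 \sum_y enc x k1 j1 * (\sum_y0 b (cb k1 j1) y0 * c y0 y) * d x y
   <= DP + dmax * (T1 + T2).
  apply: (@le_trans _ _ (DP + dmax * \sum_y p y * f y)).
    have -> : dmax * (\sum_y p y * f y) =
       \sum_x \sum_k \sum_j \sum_y enc x k j * b (cb k j) y * (dmax * f y).
      rewrite mulr_sumr; transitivity (\sum_y p y * (dmax * f y)).
        by apply: eq_bigr => y _; rewrite mulrCA.
      rewrite /p; under eq_bigr do rewrite mulr_suml.
      rewrite exchange_big/=; apply: eq_bigr => x _.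
      under eq_bigr do rewrite mulr_suml.
      rewrite exchange_big/=; apply: eq_bigr => k1 _.
      under eq_bigr do rewrite mulr_suml.
      by rewrite exchange_big/=.
    rewrite -big_split/=; apply: ler_sum => x _.
    rewrite -big_split/=; apply: ler_sum => k1 _.
    rewrite -big_split/=; apply: ler_sum => j1 _.
    rewrite -big_split/=.
    rewrite (_ : \sum_y _ = \sum_y0 enc x k1 j1 * b (cb k1 j1) y0 * \sum_y c y0 y * d x y); last first.
      under [RHS]eq_bigr do rewrite mulr_sumr.
      rewrite [RHS]exchange_big/=; apply: eq_bigr => y _.
      by rewrite mulr_sumr mulr_suml; apply: eq_bigr => y0 _; rewrite !mulrA.
    apply: ler_sum => y _; rewrite -mulrDr ler_wpM2l ?(mulr_ge0 (enc0 _ _ _) (b0 _ _))//.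
    exact: (cg (d x) dmax (dP x)).
  rewrite lerD2l.
  have [|/forallNP nx] := pselect (exists x : X, True).
    move=> [x _]; have [|/forallNP ny] := pselect (exists y : Y, True).
      move=> [y _]; rewrite ler_wpM2l ?(le_trans fT)//.
      by have /andP[l1 l2] := dP x y; apply: le_trans l2.
    by case: pYp => _ /eqP; rewrite big1 ?(eq_sym 0) ?oner_eq0// => y; case: (ny y).
  by move/eqP: pX1; rewrite big1 ?(eq_sym 0) ?oner_eq0// => x; case: (nx x).
apply: (le_trans h1).
have h2 : DP <= DQ + dmax * T1; last by lra.
rewrite -encQ /DP /DQ mulr_sumr -big_split/=; apply: ler_sum => x _.
rewrite mulr_sumr -big_split/=; apply: ler_sum => k1 _.
rewrite mulr_sumr -big_split/=; apply: ler_sum => j1 _.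
rewrite -lerBlDl -sumrB.
apply: (@le_trans _ _ (\sum_y b (cb k1 j1) y * (dmax * `|enc x k1 j1 - Q x k1 j1|))); last first.
  by rewrite -mulr_suml; case: (bP (cb k1 j1)) => _ ->; rewrite mul1r.
apply: ler_sum => y _.
have -> : enc x k1 j1 * b (cb k1 j1) y * d x y - Q x k1 j1 * b (cb k1 j1) y * d x y =
   b (cb k1 j1) y * (d x y * (enc x k1 j1 - Q x k1 j1)) by ring.
rewrite ler_wpM2l//; have /andP[l1 l2] := dP x y.
apply: (@le_trans _ _ (d x y * `|enc x k1 j1 - Q x k1 j1|)).
  by rewrite ler_wpM2l// ler_norm.
by rewrite ler_wpM2r.
Qed.

End Codes.

(** * Codes over finite alphabets *)

Section FiniteCodes.
Context {R : realType}.

Lemma sum_fst_eq (K J : finType) (k : K) (f : K * J -> R) :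
  \sum_(m in [set m : K * J | m.1 == k]) f m = \sum_j f (k, j).
Proof.
rewrite (reindex_onto (fun j => (k, j)) snd) => [|[k' j']]; last first.
  by rewrite inE /= => /eqP ->.
by apply: eq_bigl => j; rewrite inE !eqxx.
Qed.

Lemma card_fst_eq (K J : finType) (k : K) : #|[set m : K * J | m.1 == k]| = #|J|.
Proof.
rewrite -(card_imset J (f := pair k)); last by move=> i j [].
apply: eq_card => -[k' j]; rewrite inE /=; apply/eqP/imsetP => [->|[j' _ [-> _]]//].
by exists j.
Qed.

(** Soft covering is applied twice to the same random codebook: with each seed fixed, to jn
    codewords and the source channel a, and with all kn * jn codewords to the output channel b. *)
Lemma soft_code (X Y U : finType) (p : U -> R)
    (a : U -> X -> R) (b : U -> Y -> R) (d : X -> Y -> R) (dmax : R) (kn jn : nat)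
    (tau1 tau2 eta : R) :
  fpmf p -> (forall u, fpmf (a u)) -> (forall u, fpmf (b u)) ->
  (forall x y, 0 <= d x y <= dmax) -> 0 <= dmax -> (0 < kn)%N -> (0 < jn)%N ->
  0 < tau1 -> 0 < tau2 -> 0 < eta ->
  exists (enc : X -> 'I_kn -> 'I_jn -> R) (dec : 'I_kn -> 'I_jn -> Y -> R),
  [/\ (forall x k j, 0 <= enc x k j), (forall k j, fpmf (dec k j)),
      (forall x k, \sum_j enc x k j = pout p a x / kn%:R),
      (forall y, \sum_x \sum_k \sum_j enc x k j * dec k j y = pout p b y) &
      \sum_x \sum_k \sum_j \sum_y enc x k j * dec k j y * d x y <=
      \sum_u p u * (\sum_x \sum_y a u x * b u y * d x y) +
      dmax * (2 * (2 * (\sum_u p u * \sum_x (if tau1 * pout p a x < a u x then a u x else 0)) +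
                eta + tau1 / (4 * eta * jn%:R))
              + (2 * (\sum_u p u * \sum_y (if tau2 * pout p b y < b u y then b u y else 0)) +
                eta + tau2 / (4 * eta * (kn * jn)%:R)))].
Proof.
move=> pp aP bP dP dmax0 kn0 jn0 tau10 tau20 eta0.
pose M := ('I_kn * 'I_jn)%type.
pose Dx u := \sum_x \sum_y a u x * b u y * d x y.
pose TD (cb : {ffun M -> U}) := kn%:R^-1 * jn%:R^-1 * (\sum_k \sum_j Dx (cb (k, j))).
pose T1 (cb : {ffun M -> U}) := kn%:R^-1 * \sum_k0 \sum_x `|jn%:R^-1 * (\sum_j0 a (cb (k0, j0)) x) - pout p a x|.
pose T2 (cb : {ffun M -> U}) := \sum_y `|kn%:R^-1 * jn%:R^-1 * (\sum_k0 \sum_j0 b (cb (k0, j0)) y) - pout p b y|.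
(* The codebook is selected for the weighted sum of its three errors, since separate selections
   could give different codebooks. *)
have [cb hcb] := exists_le_expect (fun cb => TD cb + dmax * (2 * T1 cb + T2 cb)) (@ppow_pmf R M U p pp).
have kp : (0 : R) < kn%:R by rewrite ltr0n.
have jp : (0 : R) < jn%:R by rewrite ltr0n.
have [] := @code_of_codebook R X Y U 'I_kn 'I_jn (pout p a) (pout p b) a b d dmax
   (fun k j => cb (k, j)) (Ordinal jn0); rewrite ?card_ord//; try exact: pout_pmf.
move=> enc [dec [enc0 decP encs encdec dist]].
exists enc, dec; split => //.
apply: le_trans dist _; apply: le_trans hcb _.
have -> : \sum_a0 ppow p a0 * (TD a0 + dmax * (2 * T1 a0 + T2 a0)) =
  \sum_a0 ppow p a0 * TD a0 + dmax * (2 * (\sum_a0 ppow p a0 * T1 a0) + \sum_a0 ppow p a0 * T2 a0).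
  rewrite !mulr_sumr -!big_split/= mulr_sumr -big_split/=; apply: eq_bigr => i _; ring.
apply: lerD.
  rewrite /TD; under eq_bigr do rewrite mulrCA mulr_sumr.
  rewrite -mulr_sumr exchange_big/=.
  under eq_bigr do under eq_bigr do rewrite mulr_sumr.
  under eq_bigr do rewrite exchange_big/=.
  under eq_bigr do under eq_bigr do rewrite (ppow_expect1 Dx)//.
  rewrite !sumr_const !card_ord -[_ *+ kn]mulr_natl -[_ *+ jn]mulr_natl.
  rewrite /Dx le_eqVlt; apply/orP; left; apply/eqP; field.
  by rewrite !gt_eqF.
rewrite ler_wpM2l// lerD//.
  rewrite ler_pM2l// /T1; under eq_bigr do rewrite mulrCA mulr_sumr.
  rewrite -mulr_sumr exchange_big/= ler_pdivrMl//.
  set B := (X in _ <= _ * X).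
  apply: (@le_trans _ _ (\sum_(k < kn) B)); last by rewrite sumr_const card_ord mulr_natl.
  apply: ler_sum => k _.
  have := @soft_covering R U X M p a [set m : M | m.1 == k] tau1 eta pp aP tau10 eta0.
  rewrite card_fst_eq card_ord => /(_ jn0).
  apply: le_trans; rewrite le_eqVlt; apply/orP; left; apply/eqP.
  apply: eq_bigr => cb' _; congr (_ * _); apply: eq_bigr => x _; congr `|_ * _ - _|.
  exact/esym/(@sum_fst_eq 'I_kn 'I_jn k (fun m => a (cb' m) x)).
have := @soft_covering R U Y M p b [set: M] tau2 eta pp bP tau20 eta0.
rewrite cardsT card_prod !card_ord muln_gt0 kn0 jn0 => /(_ isT).
apply: le_trans; rewrite le_eqVlt; apply/orP; left; apply/eqP.
apply: eq_bigr => cb' _; congr (_ * _); apply: eq_bigr => y _; congr `|_ - _|.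
rewrite natrM invfM; congr (_ * _).
under [RHS]eq_bigl do rewrite inE.
by rewrite (pair_bigA _ (fun k j => b (cb' (k, j)) y))/=; apply: eq_bigr => -[].
Qed.

(** The integer part m of exp x satisfies the rate constraint, and exp x < m + 1 <= 2 m, so rounding
    costs a factor 2 only. *)
Lemma exp_floor (x : R) : 0 <= x ->
  exists m : nat, [/\ (0 < m)%N, ln (m%:R : R) <= x & expR x <= 2 * m%:R].
Proof.
move=> x0; have e1 : 1 <= expR x by rewrite (le_trans _ (expR_ge1Dx x))// lerDl.
have /andP[h1 h2] := truncn_itv (expR_ge0 x).
set m := Num.truncn (expR x) in h1 h2 *.
have m0 : (0 < m)%N by rewrite /m truncn_gt0.
exists m; split=> //.
  by rewrite -ler_expR lnK ?posrE ?ltr0n.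
apply: (le_trans (ltW h2)); rewrite -addn1 natrD mulr_natl mulr2n lerD2l.
by rewrite ler1n.
Qed.

Lemma block_codes (X Y U : finType) (p : U -> R)
    (a : U -> X -> R) (b : U -> Y -> R) (d : X -> Y -> R) (dmax Rt Rc eps : R) :
  fpmf p -> (forall u, fpmf (a u)) -> (forall u, fpmf (b u)) ->
  (forall x y, 0 <= d x y <= dmax) -> 0 <= Rt -> 0 <= Rc ->
  pinfo p a < Rt -> pinfo p b < Rt + Rc -> 0 < eps ->
  exists (n kn jn : nat), [/\ (0 < n)%N, (0 < kn)%N & (0 < jn)%N] /\
  ln (jn%:R : R) <= n%:R * Rt /\ ln (kn%:R : R) <= n%:R * Rc /\
  exists (enc : {ffun 'I_n -> X} -> 'I_kn -> 'I_jn -> R)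
         (dec : 'I_kn -> 'I_jn -> {ffun 'I_n -> Y} -> R),
  [/\ (forall x k j, 0 <= enc x k j), (forall k j, fpmf (dec k j)),
      (forall x k, \sum_j enc x k j = ppow (pout p a) x / kn%:R),
      (forall y, \sum_x \sum_k \sum_j enc x k j * dec k j y = ppow (pout p b) y) &
      \sum_x \sum_k \sum_j \sum_y enc x k j * dec k j y *
        (n%:R^-1 * \sum_t d (x t) (y t)) <=
      \sum_u p u * (\sum_x \sum_y a u x * b u y * d x y) + eps].
Proof.
move=> pp aP bP dP Rt0 Rc0 Ia Ib eps0.
have exU (A : finType) (g : A -> R) : fpmf g -> exists x : A, True.
  move=> [_ g1]; apply: contrapT => /forallNP nx; move/eqP: g1.
  by rewrite big1 ?(eq_sym 0) ?oner_eq0// => x; case: (nx x).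
have [u0 _] := exU _ _ pp; have [x0 _] := exU _ _ (aP u0); have [y0 _] := exU _ _ (bP u0).
have dmax0 : 0 <= dmax by have /andP[l1 l2] := dP x0 y0; apply: le_trans l2.
(* Half of the smaller margin: one delta goes into the typicality threshold, the other makes the
   covering error decay. *)
pose delta := Num.min (Rt - pinfo p a) (Rt + Rc - pinfo p b) / 2.
have delta0 : 0 < delta by rewrite divr_gt0// lt_min !subr_gt0 Ia.
have da : pinfo p a + delta + delta <= Rt.
  have : delta * 2 <= Rt - pinfo p a by rewrite /delta mulfVK// ge_min lexx.
  lra.
have db : pinfo p b + delta + delta <= Rt + Rc.
  have : delta * 2 <= Rt + Rc - pinfo p b by rewrite /delta mulfVK// ge_min lexx orbT.
  lra.
have [Ca [Ca0 hCa]] := atypical_mass pp aP.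
have [Cb [Cb0 hCb]] := atypical_mass pp bP.
pose eta := eps / (6 * (dmax + 1)).
have dmax1 : 0 < dmax + 1 by rewrite ltr_wpDl.
have eta0 : 0 < eta by rewrite divr_gt0// mulr_gt0.
(* The total error is dmax (3 eta + Kc / n): eta is chosen so that the first part is at most eps /
   2, and n so that the second is. The three terms of Kc collect the two atypical masses and the two
   covering errors. *)
pose Kc := 4 * Ca / delta ^+ 2 + 2 * Cb / delta ^+ 2 + 2 / (eta * delta).
have Kc0 : 0 <= Kc.
  have ed : 0 <= eta * delta by rewrite mulr_ge0// ltW.
  by rewrite !addr_ge0// divr_ge0 ?sqr_ge0// mulr_ge0.
pose n := (Num.truncn (2 * dmax * Kc / eps)).+1.
have nb : 2 * dmax * Kc / eps <= n%:R.
  have h : 0 <= 2 * dmax * Kc / eps by rewrite divr_ge0 ?mulr_ge0// ltW.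
  by apply: ltW; have /andP[_] := truncn_itv h.
have n0 : (0 < n)%N by [].
have np : (0 : R) < n%:R by rewrite ltr0n.
have [jn [jn0 jnl jnu]] := @exp_floor (n%:R * Rt) (mulr_ge0 (ltW np) Rt0).
have [kn [kn0 knl knu]] := @exp_floor (n%:R * Rc) (mulr_ge0 (ltW np) Rc0).
exists n, kn, jn; split => //; split => //; split => //.
pose tau1 := expR (n%:R * (pinfo p a + delta)).
pose tau2 := expR (n%:R * (pinfo p b + delta)).
pose dn (x : {ffun 'I_n -> X}) (y : {ffun 'I_n -> Y}) := n%:R^-1 * \sum_t d (x t) (y t).
have dnP x y : 0 <= dn x y <= dmax.
  rewrite /dn mulr_ge0 ?invr_ge0 ?(ltW np)//=; last first.
    by apply: sumr_ge0 => t _; case/andP: (dP (x t) (y t)).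
  rewrite ler_pdivrMl//.
  apply: (@le_trans _ _ (\sum_(t < n) dmax)); last by rewrite sumr_const card_ord mulr_natl.
  by apply: ler_sum => t _; case/andP: (dP (x t) (y t)).
have [] := @soft_code _ _ _ (@ppow R 'I_n U p) (cpow a) (cpow b) dn dmax kn jn tau1 tau2 eta
  (ppow_pmf _ pp) (fun u => cpow_pmf u aP) (fun u => cpow_pmf u bP) dnP dmax0 kn0 jn0
  (expR_gt0 _) (expR_gt0 _) eta0.
move=> enc [dec [enc0 decP encs encdec dist]].
exists enc, dec; split => //.
- by move=> x k; rewrite encs pout_pow.
- by move=> y; rewrite encdec pout_pow.
apply: le_trans dist _; apply: lerD.
  rewrite le_eqVlt; apply/orP; left; apply/eqP.
  pose Dx u := \sum_x \sum_y a u x * b u y * d x y.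
  transitivity (n%:R^-1 * \sum_(t < n) \sum_u ppow p u * Dx (u t)).
    rewrite [X in _ = _ * X]exchange_big/= mulr_sumr; apply: eq_bigr => u _.
    rewrite -mulr_sumr mulrCA; congr (_ * _).
    rewrite /dn; under eq_bigr do under eq_bigr do rewrite mulrCA mulr_sumr.
    under eq_bigr do rewrite -mulr_sumr exchange_big/=.
    rewrite -mulr_sumr exchange_big/=; congr (_ * _); apply: eq_bigr => t _.
    under eq_bigr do under eq_bigr do rewrite -mulrA.
    under eq_bigr do rewrite -mulr_sumr.
    rewrite /Dx.
    transitivity (\sum_(x : {ffun 'I_n -> X}) cpow a u x * \sum_y b (u t) y * d (x t) y).
      apply: eq_bigr => x _; congr (_ * _).
      pose F s y := b (u s) y * (if s == t then d (x t) y else 1).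
      transitivity (\sum_(y : {ffun 'I_n -> Y}) \prod_s F s (y s)).
        apply: eq_bigr => y _; rewrite /F big_split/=; congr (_ * _).
        by rewrite (bigD1 t)//= eqxx big1 ?mulr1// => i /negPf ->.
      rewrite sum_ffun_prod (bigD1 t)//= [X in _ * X]big1 ?mulr1.
        by apply: eq_bigr => y _; rewrite /F eqxx.
      move=> s /negPf st; rewrite /F st; have [_ e1] := bP (u s); rewrite -[RHS]e1.
      by apply: eq_bigr => y _; rewrite mulr1.
    pose F s x := a (u s) x * (if s == t then \sum_y b (u t) y * d x y else 1).
    transitivity (\sum_(x : {ffun 'I_n -> X}) \prod_s F s (x s)).
      apply: eq_bigr => x _; rewrite /F big_split/=; congr (_ * _).
      by rewrite (bigD1 t)//= eqxx [X in _ * X]big1 ?mulr1// => i /negPf ->.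
    rewrite sum_ffun_prod (bigD1 t)//= [X in _ * X]big1 ?mulr1.
      apply: eq_bigr => x _; rewrite /F eqxx mulr_sumr.
      by apply: eq_bigr => y _; rewrite mulrA.
    move=> s /negPf st; rewrite /F st; have [_ e1] := aP (u s); rewrite -[RHS]e1.
    by apply: eq_bigr => x _; rewrite mulr1.
  under eq_bigr do rewrite (ppow_expect1 Dx)//.
  by rewrite sumr_const card_ord mulrnAr -mulrnAl -[X in X * _]mulr_natr mulVf ?mul1r// gt_eqF.
have h1 := hCa _ _ n0 delta0; have h2 := hCb _ _ n0 delta0.
have jp : (0 : R) < jn%:R by rewrite ltr0n.
have kp : (0 : R) < kn%:R by rewrite ltr0n.
have nd : 0 < n%:R * delta by rewrite mulr_gt0.
(* Exponential decay is weakened to 1 / (n delta), the order in n of Chebyshev's bound. *)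
have edn : expR (- (n%:R * delta)) <= (n%:R * delta)^-1.
  rewrite expRN lef_pV2 ?posrE ?expR_gt0//.
  by apply: le_trans (expR_ge1Dx _); rewrite lerDr.
have t1 : tau1 / jn%:R <= 2 / (n%:R * delta).
  rewrite ler_pdivrMr//.
  apply: (@le_trans _ _ (expR (n%:R * Rt) * expR (- (n%:R * delta)))).
    rewrite -expRD ler_expR -mulrN -mulrDr ler_pM2l//; lra.
  have -> : 2 / (n%:R * delta) * jn%:R = (2 * jn%:R) * (n%:R * delta)^-1 by ring.
  by rewrite ler_pM ?expR_ge0.
have t2 : tau2 / (kn * jn)%:R <= 4 / (n%:R * delta).
  rewrite ler_pdivrMr ?ltr0n ?muln_gt0 ?kn0//.
  apply: (@le_trans _ _ (expR (n%:R * Rc) * expR (n%:R * Rt) * expR (- (n%:R * delta)))).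
    rewrite -!expRD ler_expR -mulrN -!mulrDr ler_pM2l//; lra.
  have -> : 4 / (n%:R * delta) * (kn * jn)%:R = (2 * kn%:R) * (2 * jn%:R) * (n%:R * delta)^-1.
    by rewrite natrM; ring.
  by rewrite ler_pM ?mulr_ge0 ?expR_ge0// ler_pM ?expR_ge0.
have e4 : 0 <= (4 * eta)^-1 by rewrite invr_ge0 mulr_ge0// ltW.
have t1' : tau1 / (4 * eta * jn%:R) <= (4 * eta)^-1 * (2 / (n%:R * delta)).
  by rewrite invfM mulrCA ler_wpM2l.
have t2' : tau2 / (4 * eta * (kn * jn)%:R) <= (4 * eta)^-1 * (4 / (n%:R * delta)).
  by rewrite invfM mulrCA ler_wpM2l.
apply: (@le_trans _ _ (dmax * (3 * eta + Kc / n%:R))).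
  rewrite ler_wpM2l//.
  have -> : 3 * eta + Kc / n%:R = 2 * (2 * (Ca / (n%:R * delta ^+ 2)) + eta + (4 * eta)^-1 * (2 / (n%:R * delta)))
    + (2 * (Cb / (n%:R * delta ^+ 2)) + eta + (4 * eta)^-1 * (4 / (n%:R * delta))).
    by rewrite /Kc; field; rewrite !gt_eqF.
  by rewrite lerD// ?ler_pM2l// ?lerD// ?ler_pM2l.
have e1 : dmax * (3 * eta) <= eps / 2.
  have -> : dmax * (3 * eta) = (dmax / (dmax + 1)) * (eps / 2).
    by rewrite /eta; field; rewrite gt_eqF.
  rewrite ler_piMl ?divr_ge0 ?(ltW eps0)// ler_pdivrMr// mul1r; lra.
have e2 : dmax * (Kc / n%:R) <= eps / 2.
  rewrite mulrA ler_pdivrMr//; move: nb; rewrite ler_pdivrMr//; lra.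
rewrite mulrDr; lra.
Qed.

End FiniteCodes.

(** * Non-strict rate constraints *)

Section ClosedRates.
Context {R : realType}.

(** Equality case of the nonnegativity of divergence. Each summand, completed by - W + q, is
    nonnegative and so vanishes; then [kl_term_dist] with l tending to 0 gives W = q on the support
    of p. *)
Lemma pinfo_le0 (U X : finType) (p : U -> R) (W : U -> X -> R) :
  fpmf p -> (forall u, fpmf (W u)) -> pinfo p W <= 0 ->
  forall u x, p u * W u x = p u * pout p W x.
Proof.
move=> pp WW I0; have [p0 p1] := pp.
have [q0 q1] := pout_pmf pp WW.
have W0 u x : 0 <= W u x by case: (WW u).
pose t u x := p u * (kl_term (W u x) (pout p W x) - W u x + pout p W x).
have ac u x : 0 < p u -> 0 < W u x -> 0 < pout p W x.
  move=> pu Wx; rewrite /pout (bigD1 u)//= ltr_pwDl ?mulr_gt0//.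
  by apply: sumr_ge0 => i _; rewrite mulr_ge0.
have t0 u x : 0 <= t u x.
  rewrite /t; have [->|pn] := eqVneq (p u) 0; first by rewrite mul0r.
  have pu : 0 < p u by rewrite lt0r pn p0.
  have := kl_term_ge (W0 u x) (q0 x) (ac _ _ pu).
  by move=> h; rewrite mulr_ge0//; lra.
have ts : \sum_(v : U * X) t v.1 v.2 = 0.
  apply/eqP; rewrite eq_le sumr_ge0 ?andbT//.
  rewrite -(pair_bigA _ t)/= /t.
  have -> : \sum_u \sum_x p u * (kl_term (W u x) (pout p W x) - W u x + pout p W x) = pinfo p W.
    rewrite /pinfo; apply: eq_bigr => u _; rewrite -mulr_sumr big_split/= sumrB.
    by rewrite q1; case: (WW u) => _ ->; rewrite subrK.
  by [].
move=> u x; have [->|pn] := eqVneq (p u) 0; first by rewrite !mul0r.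
have pu : 0 < p u by rewrite lt0r pn p0.
congr (_ * _).
have /eqP : t u x = 0 := sum_max0_eq0 (fun v => t0 v.1 v.2) ts (u, x).
rewrite mulf_eq0 (negPf pn) /= => /eqP kl0.
have h l : 0 < l -> `|W u x - pout p W x| <= l * (W u x + pout p W x).
  move=> l0; have := kl_term_dist l0 (W0 u x) (q0 x) (ac _ _ pu).
  rewrite kl0 add0r => h; rewrite -(ler_pM2l (_ : 0 < 2 * l)) ?mulr_gt0//.
  apply: le_trans h _; rewrite le_eqVlt; apply/orP; left; apply/eqP; ring.
apply/eqP; rewrite -subr_eq0 -normr_le0; apply/ler_addgt0Pr => e e0; rewrite add0r.
set s := W u x + pout p W x in h *.
have s1 : 0 < s + 1 by rewrite ltr_wpDl// addr_ge0.
apply: le_trans (h (e / (s + 1)) _) _; first by rewrite divr_gt0.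
by rewrite mulrAC ler_pdivrMr// ler_pM2l//; lra.
Qed.

Lemma kl_termxx (q : R) : kl_term q q = 0.
Proof. by rewrite /kl_term; case: ltP => // q0; rewrite divff ?gt_eqF// ln1 mulr0. Qed.

(** A new input [None] of weight theta, at which the channel emits its own output law. The output
    law is unchanged and the information is multiplied by 1 - theta. *)
Definition mixp (U : finType) (theta : R) (p : U -> R) (o : option U) : R :=
  if o is Some u then (1 - theta) * p u else theta.

Definition mixc (U X : finType) (p : U -> R) (W : U -> X -> R) (o : option U) : X -> R :=
  if o is Some u then W u else pout p W.

Lemma sum_option (U : finType) (F : option U -> R) :
  \sum_o F o = F None + \sum_u F (Some u).
Proof.
rewrite (bigD1 None)//=; congr (_ + _).
rewrite (reindex_omap Some id) => [|[u|]]//=.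
by apply: eq_bigl => u; rewrite eqxx.
Qed.

Lemma pout_mix (U X : finType) theta (p : U -> R) (W : U -> X -> R) :
  pout (mixp theta p) (mixc p W) = pout p W.
Proof.
apply/funext => x; rewrite {1}/pout sum_option /=.
under eq_bigr do rewrite -mulrA.
by rewrite -mulr_sumr -/(pout p W x); ring.
Qed.

Lemma pinfo_mix (U X : finType) theta (p : U -> R) (W : U -> X -> R) :
  pinfo (mixp theta p) (mixc p W) = (1 - theta) * pinfo p W.
Proof.
rewrite /pinfo pout_mix sum_option /= big1 ?mulr0 ?add0r => [|x _]; last exact: kl_termxx.
by rewrite mulr_sumr; apply: eq_bigr => u _; rewrite mulrA.
Qed.

Lemma block_codes_closed (X Y U : finType) (p : U -> R)
    (a : U -> X -> R) (b : U -> Y -> R) (d : X -> Y -> R) (dmax Rt Rc eps : R) :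
  fpmf p -> (forall u, fpmf (a u)) -> (forall u, fpmf (b u)) ->
  (forall x y, 0 <= d x y <= dmax) -> 0 <= Rt -> 0 <= Rc ->
  pinfo p a <= Rt -> pinfo p b <= Rt + Rc -> 0 < eps ->
  exists (n kn jn : nat), [/\ (0 < n)%N, (0 < kn)%N & (0 < jn)%N] /\
  ln (jn%:R : R) <= n%:R * Rt /\ ln (kn%:R : R) <= n%:R * Rc /\
  exists (enc : {ffun 'I_n -> X} -> 'I_kn -> 'I_jn -> R)
         (dec : 'I_kn -> 'I_jn -> {ffun 'I_n -> Y} -> R),
  [/\ (forall x k j, 0 <= enc x k j), (forall k j, fpmf (dec k j)),
      (forall x k, \sum_j enc x k j = ppow (pout p a) x / kn%:R),
      (forall y, \sum_x \sum_k \sum_j enc x k j * dec k j y = ppow (pout p b) y) &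
      \sum_x \sum_k \sum_j \sum_y enc x k j * dec k j y *
        (n%:R^-1 * \sum_t d (x t) (y t)) <=
      \sum_u p u * (\sum_x \sum_y a u x * b u y * d x y) + eps].
Proof.
move=> pp aP bP dP Rt0 Rc0 Ia Ib eps0.
have [p0 p1] := pp.
have paP := pout_pmf pp aP; have pbP := pout_pmf pp bP.
set D := \sum_u _.
(* At Rt = 0 mixing creates no margin. But zero information makes the source letter independent of
   U, hence of the output letter, and a one-letter code with a single message and a single seed has
   distortion D. *)
have [Rt00|Rtn] := eqVneq Rt 0.
  exists 1%N, 1%N, 1%N; split => //; rewrite ln1 Rt00 mulr0 mul1r; split => //; split => //.
  exists (fun x _ _ => ppow (pout p a) x), (fun _ _ y => ppow (pout p b) y).
  have [xa0 xa1] := @ppow_pmf R 'I_1 X _ paP.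
  have [yb0 yb1] := @ppow_pmf R 'I_1 Y _ pbP.
  split.
  - by move=> *; exact: xa0.
  - by move=> k j; split.
  - by move=> x k; rewrite big_ord1 divr1.
  - move=> y; under eq_bigr do rewrite !big_ord1.
    by rewrite -mulr_suml xa1 mul1r.
  rewrite -[leLHS]addr0 lerD ?(ltW eps0)//.
  under eq_bigr do rewrite !big_ord1.
  under eq_bigr do under eq_bigr do rewrite big_ord1 invr1 mul1r.
  rewrite le_eqVlt; apply/orP; left; apply/eqP.
  transitivity (\sum_x pout p a x * \sum_y pout p b y * d x y).
    rewrite -(@ppow_expect1 R 'I_1 X _ _ ord0 paP); apply: eq_bigr => x _.
    rewrite -(@ppow_expect1 R 'I_1 Y _ (d (x ord0)) ord0 pbP) mulr_sumr; apply: eq_bigr => y _.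
    by rewrite mulrA.
  have hI := pinfo_le0 pp aP; rewrite -{1}Rt00 in hI; have {}hI := hI Ia.
  rewrite /D; under [RHS]eq_bigr do rewrite mulr_sumr.
  rewrite [RHS]exchange_big/=; apply: eq_bigr => x _.
  under [RHS]eq_bigr do rewrite mulr_sumr.
  rewrite [RHS]exchange_big/= mulr_sumr; apply: eq_bigr => y _.
  rewrite mulrA {2}/pout mulr_sumr mulr_suml; apply: eq_bigr => u _.
  by rewrite !mulrA hI; ring.
have Rtp : 0 < Rt by rewrite lt0r Rtn.
have exU (A : finType) (g : A -> R) : fpmf g -> exists x : A, True.
  move=> [_ g1]; apply: contrapT => /forallNP nx; move/eqP: g1.
  by rewrite big1 ?(eq_sym 0) ?oner_eq0// => x; case: (nx x).
have [x0 _] := exU _ _ paP; have [y0 _] := exU _ _ pbP.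
have dmax0 : 0 <= dmax by have /andP[l1 l2] := dP x0 y0; apply: le_trans l2.
(* Chosen so that theta < 1 and theta * dmax <= eps / 2; the remaining eps / 2 is left to the block
   code. *)
pose theta := eps / (2 * (dmax + 1) + eps).
have den : 0 < 2 * (dmax + 1) + eps by lra.
have th0 : 0 < theta by rewrite divr_gt0.
have th1 : theta < 1 by rewrite ltr_pdivrMr// mul1r; lra.
have thd : theta * dmax <= eps / 2.
  rewrite /theta mulrAC ler_pdivrMr//.
  have -> : eps / 2 * (2 * (dmax + 1) + eps) = eps * (dmax + 1 + eps / 2) by field.
  by rewrite ler_pM2l//; lra.
have mp : fpmf (mixp theta p).
  split=> [[u|]|] /=; [by rewrite mulr_ge0// subr_ge0 ltW|exact: ltW|].
  by rewrite sum_option /= -mulr_sumr p1; ring.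
have ma u : fpmf (mixc p a u) by case: u => [u|] /=.
have mb u : fpmf (mixc p b u) by case: u => [u|] /=.
have lt1 r s : 0 < s -> r <= s -> (1 - theta) * r < s.
  move=> s0 rs; apply: (@le_lt_trans _ _ ((1 - theta) * s)).
    by rewrite ler_wpM2l// subr_ge0 ltW.
  by rewrite mulrBl mul1r ltrBlDr ltrDl mulr_gt0.
have := @block_codes R X Y (option U) (mixp theta p) (mixc p a) (mixc p b) d dmax Rt Rc (eps / 2)
  mp ma mb dP Rt0 Rc0.
rewrite !pinfo_mix !pout_mix => /(_ (lt1 _ _ Rtp Ia)).
have RR : 0 < Rt + Rc by rewrite ltr_pwDl.
have e2 : 0 < eps / 2 by rewrite divr_gt0.
move=> /(_ (lt1 _ _ RR Ib) e2) [n [kn [jn [n0 [l1 [l2 [enc [dec [h1 h2 h3 h4 h5]]]]]]]]].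
exists n, kn, jn; split => //; split => //; split => //.
exists enc, dec; split => //; apply: (le_trans h5).
rewrite sum_option /=.
have [pa0 pa1] := paP; have [pb0 pb1] := pbP.
have hind : \sum_x \sum_y pout p a x * pout p b y * d x y <= dmax.
  apply: (@le_trans _ _ (\sum_x \sum_y pout p a x * pout p b y * dmax)).
    apply: ler_sum => x _; apply: ler_sum => y _; rewrite ler_wpM2l ?mulr_ge0//.
    by case/andP: (dP x y).
  under eq_bigr do rewrite -mulr_suml -mulr_sumr pb1 mulr1.
  by rewrite -mulr_suml pa1 mul1r.
have D0 : 0 <= D.
  apply: sumr_ge0 => u _; rewrite mulr_ge0//; apply: sumr_ge0 => x _; apply: sumr_ge0 => y _.
  rewrite !mulr_ge0//; [by case: (aP u)|by case: (bP u)|by case/andP: (dP x y)].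
have -> : \sum_u (1 - theta) * p u * (\sum_x \sum_y a u x * b u y * d x y) = (1 - theta) * D.
  by rewrite mulr_sumr; apply: eq_bigr => u _; rewrite mulrA.
have : theta * (\sum_x \sum_y pout p a x * pout p b y * d x y) <= theta * dmax.
  by rewrite ler_pM2l.
have : 0 <= theta * D by rewrite mulr_ge0// ltW.
rewrite mulrBl mul1r; lra.
Qed.

End ClosedRates.

(** * Information inequalities on finite alphabets *)

Section FiniteInformation.
Context {R : realType}.

Lemma sum_gt0 (A : finType) (S : pred A) (p : A -> R) :
  (forall a, 0 <= p a) -> 0 < \sum_(a | S a) p a -> exists2 a, S a & 0 < p a.
Proof.
move=> p0 s; apply: contrapT => h; move: s; rewrite big1 ?ltxx// => a Sa.
apply/eqP; rewrite eq_le p0 andbT leNgt; apply/negP => pa; apply: h; by exists a.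
Qed.

(** After rescaling q by P / Q both families have the same total, and the difference of the two
    sides is a divergence between families of equal mass. This is the data processing inequality
    behind all coarsening steps. *)
Lemma log_sum (A : finType) (S : pred A) (p q : A -> R) :
  (forall a, 0 <= p a) -> (forall a, 0 <= q a) -> (forall a, 0 < p a -> 0 < q a) ->
  kl_term (\sum_(a | S a) p a) (\sum_(a | S a) q a) <= \sum_(a | S a) kl_term (p a) (q a).
Proof.
move=> p0 q0 pq; set P := \sum_(a | S a) p a; set Q := \sum_(a | S a) q a.
rewrite {1}/kl_term; case: ltP => [Pp|Pz]; last first.
  rewrite big1// => a Sa; rewrite /kl_term; case: ltP => // pa.
  suff : p a <= P by move=> h; have := lt_le_trans pa (le_trans h Pz); rewrite ltxx.
  by rewrite /P (bigD1 a)//= lerDl sumr_ge0.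
have Qp : 0 < Q.
  have [a Sa pa] := sum_gt0 p0 Pp.
  by rewrite /Q (bigD1 a)//= ltr_pwDl ?pq// sumr_ge0.
rewrite -subr_ge0.
have -> : \sum_(a | S a) kl_term (p a) (q a) - P * ln (P / Q) =
   \sum_(a | S a) kl_term (p a) (q a * (P / Q)).
  rewrite /P mulr_suml -sumrB; apply: eq_bigr => a _.
  rewrite -/P /kl_term; case: ltP => [pa|pa].
    have qa := pq _ pa.
    by rewrite -mulrBr -ln_div ?posrE ?divr_gt0// -!mulrA -invfM.
  have -> : p a = 0 by apply/eqP; rewrite eq_le p0 pa.
  by rewrite mul0r subr0.
have : \sum_(a | S a) (p a - q a * (P / Q)) = 0.
  by rewrite sumrB -mulr_suml -/P -/Q mulrCA divff ?gt_eqF// mulr1 subrr.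
move=> h0; rewrite -[leLHS]h0; apply: ler_sum => a _; apply: kl_term_ge => //.
- by rewrite mulr_ge0// divr_ge0// ltW.
- by move=> pa; rewrite mulr_gt0 ?divr_gt0 ?pq.
Qed.

(** Single-letterization without entropies. The left side is the mean of ln G, where G is the
    product of the single-letter densities, and ln (G / c) <= G / c - 1. Since P <= kappa times the
    product law, the mean of G / c is at most the average over z of products of conditional laws,
    each of mass at most 1. *)
Lemma block_info_bound (X Z : finType) n (P : {ffun 'I_n -> X} -> Z -> R) (p : X -> R)
    (kappa : R) :
  (forall x z, 0 <= P x z) -> \sum_x \sum_z P x z = 1 -> fpmf p -> 0 < kappa ->
  (forall x z, P x z <= kappa * ppow p x) ->
  \sum_(t < n) \sum_i \sum_z kl_term (\sum_(x : {ffun 'I_n -> X} | x t == i) P x z) (p i * \sum_x P x z) <=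
  ln (kappa * #|Z|%:R).
Proof.
move=> P0 P1 [p0 p1] k0 Pk.
pose Pz z := \sum_x P x z.
pose Pt t i z := \sum_(x : {ffun 'I_n -> X} | x t == i) P x z.
have Pz0 z : 0 <= Pz z by apply: sumr_ge0.
have Pt0 t i z : 0 <= Pt t i z by apply: sumr_ge0.
have PtP t (x : {ffun 'I_n -> X}) z : P x z <= Pt t (x t) z.
  by rewrite /Pt (bigD1 x)//= lerDl sumr_ge0.
have PPz (x : {ffun 'I_n -> X}) z : P x z <= Pz z.
  by rewrite /Pz (bigD1 x)//= lerDl sumr_ge0.
have Pts t z : \sum_i Pt t i z = Pz z.
  by rewrite /Pz (partition_big (fun x : {ffun 'I_n -> X} => x t) predT).
have Pp (x : {ffun 'I_n -> X}) z t : 0 < P x z -> 0 < p (x t).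
  move=> h; rewrite lt0r p0 andbT; apply/eqP => pt0.
  by have := lt_le_trans h (Pk x z); rewrite /ppow (bigD1 t)//= pt0 mul0r mulr0 ltxx.
have Z0 : (0 : R) < #|Z|%:R.
  rewrite ltr0n; apply/card_gt0P.
  have : (0 : R) < 1 by []; rewrite -P1 => /sum_gt0[|x _].
    by move=> x; apply: sumr_ge0.
  by move=> /sum_gt0[//|z _ _]; exists z.
have r0 (x : {ffun 'I_n -> X}) z t : 0 < P x z -> 0 < Pt t (x t) z / (p (x t) * Pz z).
  move=> h; apply: divr_gt0; first exact: lt_le_trans h (PtP _ _ _).
  by apply: mulr_gt0; [exact: (Pp _ _ _ h)|exact: lt_le_trans h (PPz _ _)].
pose c := kappa * #|Z|%:R.
have c0 : 0 < c by rewrite mulr_gt0.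
pose G x z := \prod_t (Pt t (x t) z / (p (x t) * Pz z)).
have -> : \sum_(t < n) \sum_i \sum_z kl_term (\sum_(x : {ffun 'I_n -> X} | x t == i) P x z) (p i * \sum_x P x z) =
   \sum_x \sum_z P x z * ln (G x z).
  transitivity (\sum_t \sum_x \sum_z P x z * ln (Pt t (x t) z / (p (x t) * Pz z))).
    apply: eq_bigr => t _.
    rewrite [RHS](partition_big (fun x : {ffun 'I_n -> X} => x t) predT)//=.
    apply: eq_bigr => i _; rewrite [RHS]exchange_big/=; apply: eq_bigr => z _.
    transitivity (Pt t i z * ln (Pt t i z / (p i * Pz z))).
      rewrite /kl_term -/(Pt t i z) -/(Pz z); case: ltP => // h.
      have -> : Pt t i z = 0 by apply/eqP; rewrite eq_le h Pt0.
      by rewrite mul0r.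
    by rewrite mulr_suml; apply: eq_bigr => x /eqP ->.
  rewrite exchange_big/=; apply: eq_bigr => x _.
  rewrite exchange_big/=; apply: eq_bigr => z _.
  rewrite -mulr_sumr; have [->|Pn] := eqVneq (P x z) 0; first by rewrite !mul0r.
  have Pxz : 0 < P x z by rewrite lt0r Pn P0.
  congr (_ * _); apply: expR_inj.
  have g0 t : 0 < Pt t (x t) z / (p (x t) * Pz z).
    exact: r0.
  rewrite lnK ?posrE ?prodr_gt0// expR_sum; apply: eq_bigr => t _.
  by rewrite lnK ?posrE.
have -> : ln c = \sum_x \sum_z P x z * ln c.
  by under eq_bigr do rewrite -mulr_suml; rewrite -mulr_suml P1 mul1r.
rewrite -subr_le0 -sumrB.
under eq_bigr do rewrite -sumrB.
apply: (@le_trans _ _ (\sum_x \sum_z (P x z * (G x z / c) - P x z))).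
  apply: ler_sum => x _; apply: ler_sum => z _.
  have [->|Pn] := eqVneq (P x z) 0; first by rewrite !mul0r !subr0.
  have Pxz : 0 < P x z by rewrite lt0r Pn P0.
  have g0 : 0 < G x z.
    apply: prodr_gt0 => t _.
    exact: r0.
  rewrite -mulrBr -ln_div ?posrE// -[X in _ <= _ - X]mulr1 -mulrBr ler_pM2l//.
  by rewrite ln_le_subr1// divr_gt0.
under eq_bigr do rewrite sumrB.
rewrite sumrB P1 subr_le0.
apply: (@le_trans _ _ (\sum_z \sum_(x : {ffun 'I_n -> X}) #|Z|%:R^-1 * \prod_t (Pt t (x t) z / Pz z))).
  rewrite [leRHS]exchange_big/=; apply: ler_sum => x _; apply: ler_sum => z _.
  rewrite /c invfM.
  have -> : P x z * (G x z * (kappa^-1 * #|Z|%:R^-1)) = #|Z|%:R^-1 * (kappa^-1 * P x z * G x z).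
    by ring.
  rewrite ler_wpM2l ?invr_ge0 ?(ltW Z0)//.
  have G0 : 0 <= G x z.
    by apply: prodr_ge0 => t _; rewrite divr_ge0// mulr_ge0.
  apply: (@le_trans _ _ (ppow p x * G x z)).
    by rewrite ler_wpM2r// ler_pdivrMl.
  rewrite /ppow /G -big_split/=; apply: ler_prod => t _.
  rewrite mulr_ge0 ?divr_ge0 ?mulr_ge0//=.
  have [pz|pn] := eqVneq (p (x t)) 0; first by rewrite pz mul0r divr_ge0.
  by rewrite invfM mulrCA (mulrA (p _)) divff// mul1r.
under eq_bigr do rewrite -mulr_sumr.
rewrite -mulr_sumr mulrC ler_pdivrMr// mul1r.
rewrite -[leRHS]mulr_natl mulr1 -sum1_card natr_sum; apply: ler_sum => z _.
rewrite (sum_ffun_prod (fun t i => Pt t i z / Pz z)).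
rewrite -[leRHS](expr1n _ #|'I_n|) -prodr_const; apply: ler_prod => t _.
rewrite -mulr_suml Pts divr_ge0//=.
by have [->|Pn] := eqVneq (Pz z) 0; rewrite ?mul0r ?divff.
Qed.

(* Refining the cells of a step approximation changes the divergence by the
   increase of mutual information. *)
Lemma kl_step (I V I' V' : finType) (al : I' -> I) (ga : V' -> V) (P : I' -> V' -> R) :
  (forall i v, 0 <= P i v) ->
  let PI i := \sum_v P i v in let PV v := \sum_i P i v in
  let Q i v := \sum_(i' | al i' == i) \sum_(v' | ga v' == v) P i' v' in
  let QI i := \sum_(i' | al i' == i) PI i' in let QV v := \sum_(v' | ga v' == v) PV v' in
  \sum_i \sum_v kl_term (P i v) (Q (al i) (ga v) * (PI i * PV v) / (QI (al i) * QV (ga v))) =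
  \sum_i \sum_v kl_term (P i v) (PI i * PV v) - \sum_i \sum_v kl_term (Q i v) (QI i * QV v).
Proof.
move=> P0 PI PV Q QI QV.
have PI0 i : 0 <= PI i by apply: sumr_ge0.
have PV0 v : 0 <= PV v by apply: sumr_ge0.
have PPI i v : P i v <= PI i by rewrite /PI (bigD1 v)//= lerDl sumr_ge0.
have PPV i v : P i v <= PV v by rewrite /PV (bigD1 i)//= lerDl sumr_ge0.
have PIQ i : PI i <= QI (al i) by rewrite /QI (bigD1 i)//= lerDl sumr_ge0.
have PVQ v : PV v <= QV (ga v) by rewrite /QV (bigD1 v)//= lerDl sumr_ge0.
have Q0 i v : 0 <= Q i v by do 2 (apply: sumr_ge0 => ? _).
have PQ i v : P i v <= Q (al i) (ga v).
  rewrite /Q (bigD1 i)//= (bigD1 v)//= -addrA lerDl addr_ge0 ?sumr_ge0// => i' _.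
  exact: sumr_ge0.
transitivity (\sum_i \sum_v (kl_term (P i v) (PI i * PV v) -
   P i v * ln (Q (al i) (ga v) / (QI (al i) * QV (ga v))))).
  apply: eq_bigr => i _; apply: eq_bigr => v _.
  rewrite /kl_term; case: ltP => [p|p]; last first.
    have -> : P i v = 0 by apply/eqP; rewrite eq_le p P0.
    by rewrite mul0r subr0.
  have h1 := lt_le_trans p (PPI i v); have h2 := lt_le_trans p (PPV i v).
  have h3 := lt_le_trans h1 (PIQ i); have h4 := lt_le_trans h2 (PVQ v).
  have h5 := lt_le_trans p (PQ i v).
  rewrite -mulrBr -ln_div ?posrE ?divr_gt0 ?mulr_gt0//; congr (_ * ln _).
  by field; rewrite !gt_eqF.
under eq_bigr do rewrite sumrB.
rewrite sumrB; congr (_ - _).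
rewrite (partition_big al predT)//=; apply: eq_bigr => i0 _.
rewrite exchange_big/= (partition_big ga predT)//=; apply: eq_bigr => v0 _.
transitivity (Q i0 v0 * ln (Q i0 v0 / (QI i0 * QV v0))); last first.
  rewrite /kl_term; case: ltP => // h.
  have -> : Q i0 v0 = 0 by apply/eqP; rewrite eq_le h Q0.
  by rewrite mul0r.
rewrite {2}/Q [X in _ = X * _]exchange_big/= mulr_suml; apply: eq_bigr => v /eqP ->.
by rewrite mulr_suml; apply: eq_bigr => i /eqP ->.
Qed.

End FiniteInformation.

Local Open Scope classical_set_scope.
Local Open Scope ring_scope.

(** * Finite cells, mixtures and mutual information *)

Section ProbabilityConstructions.
Context {R : realType}.

Lemma pushforward_probability d1 d2 (T1 : measurableType d1) (T2 : measurableType d2)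
    (P : probability T1 R) (f : T1 -> T2) : measurable_fun setT f ->
  exists Q : probability T2 R, (forall A, Q A = P (f @^-1` A)) /\
  forall g : T2 -> \bar R, measurable_fun setT g -> (forall y, 0 <= g y)%E ->
    (\int[Q]_y g y = \int[P]_x g (f x))%E.
Proof.
move=> mf; pose f_mixin := isMeasurableFun.Build _ _ _ _ _ mf.
pose F : {mfun T1 >-> T2} := HB.pack f f_mixin.
exists (distribution P F); split=> // g mg g0.
by rewrite ge0_integral_distribution.
Qed.

Lemma mixture_probability d (T : measurableType d) (I : finType) (w : I -> R)
    (mu : I -> probability T R) : fpmf w ->
  exists Q : probability T R, (forall A, Q A = (\sum_i (w i)%:E * mu i A)%E) /\
  forall g : T -> \bar R, measurable_fun setT g -> (forall y, 0 <= g y)%E ->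
    (\int[Q]_y g y)%E = (\sum_i (w i)%:E * \int[mu i]_y g y)%E.
Proof.
move=> [w0 w1].
pose I0 : I -> 'I_#|I| := @enum_rank I.
have [i0 _] : exists i : I, True.
  apply: contrapT => /forallNP h; move/eqP: w1.
  by rewrite big1 ?(eq_sym 0) ?oner_eq0// => i; case: (h i).
(* [msum] runs over an initial segment of the naturals, so I is enumerated; i0 is a dummy value past
   the end. The total mass being 1, [mnormalize] below only repackages the sum as a probability. *)
pose it (n : nat) : I := if insub n is Some k then enum_val (k : 'I_#|I|) else i0.
have itE (k : 'I_#|I|) : it k = enum_val k by rewrite /it valK.
pose m (n : nat) : {measure set T -> \bar R} := mscale (NngNum (w0 (it n))) (mu (it n)).
have sE (F : I -> \bar R) : (\sum_(k < #|I|) F (it k) = \sum_i F i)%E.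
  rewrite (reindex (@enum_val I predT)); last first.
    by apply: onW_bij; exact: enum_val_bij.
  by apply: eq_bigr => k _; rewrite itE.
pose S : {measure set T -> \bar R} := msum m #|I|.
have SE A : S A = (\sum_i (w i)%:E * mu i A)%E.
  by rewrite -[RHS]sE.
have ST : S setT = 1%E.
  rewrite SE -[RHS]/(1%:E) -w1 -sumEFin; apply: eq_bigr => i _.
  by rewrite probability_setT mule1.
have nE A : mnormalize S (mu i0) A = S A.
  by rewrite /mnormalize ST onee_eq0/= invr1 mule1.
exists (mnormalize S (mu i0)); split => [A|g mg g0]; first exact: etrans (nE A) (SE A).
rewrite (eq_measure_integral S) => [|A mA _]; last exact: nE.
rewrite ge0_integral_measure_sum// -[RHS]sE.
by apply: eq_bigr => k _; rewrite ge0_integral_mscale.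
Qed.

End ProbabilityConstructions.

Section FiniteCells.
Context {R : realType}.

(** A finite measurable partition is presented by its labelling map: pairing two labellings is their
    common refinement, and composing with a map of labels is a coarsening. *)
Definition fcell d (T : measurableType d) (I : finType) (f : T -> I) :=
  forall i, measurable (f @^-1` [set i]).

Section Cells.
Context d (T : measurableType d).

Lemma fcell_pred (I : finType) (f : T -> I) (S : pred I) :
  fcell f -> measurable [set x | S (f x)].
Proof.
move=> mf.
have -> : [set x | S (f x)] = \bigcup_(i in [set i | S i]) (f @^-1` [set i]).
  by apply/seteqP; split=> [x Sx|x [i Si /= ->]//]; exists (f x).
by apply: fin_bigcup_measurable => [|i _]; [exact: finite_finset|exact: mf].
Qed.

Lemma fcell_comp (I J : finType) (f : T -> I) (g : I -> J) :
  fcell f -> fcell (fun x => g (f x)).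
Proof.
move=> mf j; have := fcell_pred (fun i => g i == j) mf.
by congr (measurable _); apply/seteqP; split=> x /= /eqP.
Qed.

Lemma fcell_pair (I J : finType) (f : T -> I) (g : T -> J) :
  fcell f -> fcell g -> fcell (fun x => (f x, g x)).
Proof.
move=> mf mg [i j].
have -> : (fun x => (f x, g x)) @^-1` [set (i, j)] = f @^-1` [set i] `&` g @^-1` [set j].
  by apply/seteqP; split=> x /= => [[-> ->]|[-> ->]].
by apply: measurableI.
Qed.

Lemma fcell_cst (I : finType) (i : I) : fcell (fun _ : T => i).
Proof.
move=> j; have [->|ij] := eqVneq i j.
  by rewrite (_ : _ @^-1` _ = setT)//; apply/seteqP; split.
rewrite (_ : _ @^-1` _ = set0)//; apply/seteqP; split => //= x /= h.
by move: ij; rewrite h eqxx.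
Qed.

End Cells.

Lemma fcell_precomp d1 d2 (T1 : measurableType d1) (T2 : measurableType d2)
    (I : finType) (f : T1 -> T2) (g : T2 -> I) :
  measurable_fun setT f -> fcell g -> fcell (fun x => g (f x)).
Proof.
by move=> mf mg i; rewrite -[X in measurable X]setTI; exact: (mf measurableT _ (mg i)).
Qed.

Section Pr.
Context d (T : measurableType d) (P : probability T R).
Implicit Types A B : set T.

Definition pr A : R := fine (P A).

Lemma prE A : measurable A -> P A = (pr A)%:E.
Proof. by move=> mA; rewrite /pr fineK// fin_num_measure. Qed.

Lemma pr_ge0 A : 0 <= pr A.
Proof. by rewrite /pr fine_ge0. Qed.

Lemma pr_setT : pr setT = 1.
Proof. by rewrite /pr probability_setT. Qed.

Lemma le_pr A B : measurable A -> measurable B -> A `<=` B -> pr A <= pr B.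
Proof. by move=> mA mB AB; rewrite -lee_fin -!prE// le_measure// inE. Qed.

Lemma pr_le1 A : measurable A -> pr A <= 1.
Proof. by move=> mA; rewrite -pr_setT le_pr. Qed.

Lemma measure_cells (I : finType) (f : T -> I) A :
  fcell f -> measurable A -> P A = (\sum_i P (A `&` f @^-1` [set i]))%E.
Proof.
move=> mf mA.
have {1}-> : A = \bigcup_(i in [set: I]) (A `&` f @^-1` [set i]).
  by apply/seteqP; split=> [x Ax|x [i _ []//]]; exists (f x).
rewrite measure_fin_bigcup//; last 3 first.
- exact: finite_finset.
- by apply/trivIsetP => i j _ _ ij; apply/seteqP; split=> x // -[[_ /= ->] [_ /= e]]; move: ij; rewrite e eqxx.
- by move=> i _; apply: measurableI.
rewrite fsbig_finite/=; last exact: finite_finset.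
apply: perm_big; apply: uniq_perm => [||i]; [exact: finmap.fset_uniq|exact: index_enum_uniq|].
rewrite mem_index_enum in_fset_set; last exact: finite_finset.
by rewrite mem_set.
Qed.

Lemma pr_cells (I : finType) (f : T -> I) A :
  fcell f -> measurable A -> pr A = \sum_i pr (A `&` f @^-1` [set i]).
Proof.
move=> mf mA; apply: EFin_inj; rewrite -prE// (measure_cells mf mA) -sumEFin.
by apply: eq_bigr => i _; rewrite prE//; apply: measurableI.
Qed.

Definition pr2 (I J : finType) (f : T -> I) (g : T -> J) (i : I) (j : J) : R :=
  pr (f @^-1` [set i] `&` g @^-1` [set j]).

Definition pr1 (I : finType) (f : T -> I) (i : I) : R := pr (f @^-1` [set i]).

Lemma pr1_pmf (I : finType) (f : T -> I) : fcell f -> fpmf (pr1 f).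
Proof.
move=> mf; split=> [i|]; first exact: pr_ge0.
rewrite -pr_setT (pr_cells mf measurableT); apply: eq_bigr => i _.
by rewrite setTI.
Qed.

Lemma pr2_sumr (I J : finType) (f : T -> I) (g : T -> J) i :
  fcell f -> fcell g -> \sum_j pr2 f g i j = pr1 f i.
Proof. by move=> mf mg; rewrite /pr1 (pr_cells mg (mf i)). Qed.

Lemma pr2_suml (I J : finType) (f : T -> I) (g : T -> J) j :
  fcell f -> fcell g -> \sum_i pr2 f g i j = pr1 g j.
Proof.
move=> mf mg; rewrite /pr1 (pr_cells mf (mg j)); apply: eq_bigr => i _.
by rewrite setIC.
Qed.

Definition fmi (I J : finType) (f : T -> I) (g : T -> J) : R :=
  \sum_i \sum_j kl_term (pr2 f g i j) (pr1 f i * pr1 g j).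

Lemma pr_pred (I : finType) (f : T -> I) (S : pred I) A :
  fcell f -> measurable A ->
  pr (A `&` [set x | S (f x)]) = \sum_(i | S i) pr (A `&` f @^-1` [set i]).
Proof.
move=> mf mA; rewrite (pr_cells mf); last by apply: measurableI => //; exact: fcell_pred.
rewrite [RHS]big_mkcond/=; apply: eq_bigr => i _; case: ifPn => Si.
  congr pr; by apply/seteqP; split=> x /=; [move=> [[]]|move=> [? e]; rewrite e].
rewrite /pr (_ : _ `&` _ = set0) ?measure0//.
by apply/seteqP; split=> x //= [[_ h] e]; move: Si; rewrite -e h.
Qed.

End Pr.
End FiniteCells.

(** * Mutual information as a supremum over labellings *)

Section MutualInfo.
Context {R : realType} d (Om : measurableType d) (P : probability Om R).

Lemma pr1_coarsen (I I' : finType) (f : Om -> I) (a : I -> I') i' : fcell f ->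
  pr1 P (fun x => a (f x)) i' = \sum_(i | a i == i') pr1 P f i.
Proof.
move=> mf; rewrite /pr1; have := pr_pred P (fun i => a i == i') mf measurableT.
under eq_bigr do rewrite setTI.
by move=> <-; rewrite setTI; congr pr; apply/seteqP; split=> x /= /eqP.
Qed.

Lemma pr2_coarsen (I J I' J' : finType) (f : Om -> I) (g : Om -> J)
    (a : I -> I') (b : J -> J') i' j' : fcell f -> fcell g ->
  pr2 P (fun x => a (f x)) (fun x => b (g x)) i' j' =
  \sum_(i | a i == i') \sum_(j | b j == j') pr2 P f g i j.
Proof.
move=> mf mg.
have m1 : measurable ((fun x => a (f x)) @^-1` [set i']) by exact: (fcell_comp a mf).
have := pr_pred P (fun j => b j == j') mg m1.
have -> : [set x | b (g x) == j'] = (fun x => b (g x)) @^-1` [set j'].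
  by apply/seteqP; split=> x /= /eqP.
rewrite -/(pr2 _ _ _ i' j') => ->; rewrite [RHS]exchange_big/=; apply: eq_bigr => j _.
have := pr_pred P (fun i => a i == i') mf (mg j).
have -> : [set x | a (f x) == i'] = (fun x => a (f x)) @^-1` [set i'].
  by apply/seteqP; split=> x /= /eqP.
by rewrite setIC => ->; apply: eq_bigr => i _; rewrite /pr2 setIC.
Qed.

(** The log-sum inequality on every block of merged cells. *)
Lemma fmi_coarsen (I J I' J' : finType) (f : Om -> I) (g : Om -> J)
    (a : I -> I') (b : J -> J') : fcell f -> fcell g ->
  fmi P (fun x => a (f x)) (fun x => b (g x)) <= fmi P f g.
Proof.
move=> mf mg; rewrite /fmi.
rewrite [leRHS](partition_big a predT)//=; apply: ler_sum => i' _.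
rewrite [leRHS]exchange_big/= [leRHS](partition_big b predT)//=; apply: ler_sum => j' _.
rewrite [leRHS]exchange_big/= pair_big/=.
have -> : pr1 P (fun x => a (f x)) i' * pr1 P (fun x => b (g x)) j' =
    \sum_(v | (a v.1 == i') && (b v.2 == j')) pr1 P f v.1 * pr1 P g v.2.
  rewrite !pr1_coarsen// mulr_suml; under eq_bigr do rewrite mulr_sumr.
  by rewrite pair_big.
rewrite pr2_coarsen// pair_big/=.
apply: log_sum => [v|v|v]; rewrite /pr1 /pr2.
- exact: pr_ge0.
- by rewrite mulr_ge0 ?pr_ge0.
- move=> h; rewrite mulr_gt0// (lt_le_trans h)//; apply: le_pr => //; first exact: measurableI.
  exact: measurableI.
Qed.

Context d1 (T1 : measurableType d1) d2 (T2 : measurableType d2).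
Variables (f : Om -> T1) (g : Om -> T2).
Hypotheses (mf : measurable_fun setT f) (mg : measurable_fun setT g).

Lemma mpartition_fcell d0 (T0 : measurableType d0) m (A : 'I_m -> set T0) :
  fin_mpartition A -> exists al : T0 -> 'I_m, fcell al /\ forall i, al @^-1` [set i] = A i.
Proof.
move=> [mA [/trivIsetP tA cA]].
have ex x : exists i, A i x.
  have : (\bigcup_i A i) x by rewrite cA.
  by move=> [i _ Ax]; exists i.
have [al hal] := choice ex.
have alE i : al @^-1` [set i] = A i.
  apply/seteqP; split=> [x /= <-//|x Ax /=]; apply: contrapT => /eqP ne.
  have : (A (al x) `&` A i) x by split.
  by rewrite tA.
by exists al; split=> // i; rewrite alE.
Qed.

Lemma fcell_mpartition d0 (T0 : measurableType d0) (I : finType) (al : T0 -> I) :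
  fcell al -> fin_mpartition (fun i : 'I_#|I| => al @^-1` [set enum_val i]).
Proof.
move=> ma; split=> [i|]; first exact: ma.
split.
  apply/trivIsetP => i j _ _ ij; apply/seteqP; split=> x //= [/= e1 e2].
  by move: ij; rewrite (enum_val_inj (etrans (esym e1) e2)) eqxx.
apply/seteqP; split=> // x _; exists (enum_rank (al x)) => //=.
by rewrite enum_rankK.
Qed.

Lemma mutual_info_le c :
  (forall (I J : finType) (al : T1 -> I) (be : T2 -> J), fcell al -> fcell be ->
     fmi P (fun x => al (f x)) (fun x => be (g x)) <= c) ->
  (mutual_info P f g <= c%:E)%E.
Proof.
move=> h; apply: ge_ereal_sup => _ [m [k [A [B [pA [pB ->]]]]]].
have [al [mal alE]] := mpartition_fcell pA.
have [be [mbe beE]] := mpartition_fcell pB.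
rewrite lee_fin (le_trans _ (h _ _ _ _ mal mbe))//.
rewrite /fmi le_eqVlt; apply/orP; left; apply/eqP.
apply: eq_bigr => i _; apply: eq_bigr => j _.
by rewrite mi_termE -alE -beE.
Qed.

Lemma fmi_le_mutual_info (I J : finType) (al : T1 -> I) (be : T2 -> J) :
  fcell al -> fcell be ->
  ((fmi P (fun x => al (f x)) (fun x => be (g x)))%:E <= mutual_info P f g)%E.
Proof.
move=> mal mbe; apply: ereal_sup_ubound.
exists #|I|, #|J|, (fun i => al @^-1` [set enum_val i]), (fun i => be @^-1` [set enum_val i]).
split; first exact: fcell_mpartition.
split; first exact: fcell_mpartition.
congr EFin; rewrite /fmi (reindex (@enum_val I predT)); last first.
  by apply: onW_bij; exact: enum_val_bij.
apply: eq_bigr => i _; rewrite (reindex (@enum_val J predT)); last first.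
  by apply: onW_bij; exact: enum_val_bij.
by apply: eq_bigr => j _.
Qed.

(** Near-optimality in the form used later: no other pair of labellings, in particular no
    refinement, gains more than eta. Finiteness of the supremum comes from the bound c. *)
Lemma mutual_info_approx c eta : (mutual_info P f g <= c%:E)%E -> 0 < eta ->
  exists (I J : finType) (al : T1 -> I) (be : T2 -> J), [/\ fcell al, fcell be &
   forall (I' J' : finType) (al' : T1 -> I') (be' : T2 -> J'), fcell al' -> fcell be' ->
     fmi P (fun x => al' (f x)) (fun x => be' (g x)) <=
     fmi P (fun x => al (f x)) (fun x => be (g x)) + eta].
Proof.
move=> mc eta0.
have mfin : mutual_info P f g \is a fin_num.
  rewrite fin_numElt (le_lt_trans mc (ltry _)) andbT.
  have := @fmi_le_mutual_info unit unit (fun _ => tt) (fun _ => tt) (fcell_cst _ _) (fcell_cst _ _).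
  by apply: lt_le_trans; rewrite ltNyr.
have [_ [m [k [A [B [pA [pB ->]]]]]] h] := ub_ereal_sup_adherent eta0 mfin.
have [al [mal alE]] := mpartition_fcell pA.
have [be [mbe beE]] := mpartition_fcell pB.
exists 'I_m, 'I_k, al, be; split => // I' J' al' be' mal' mbe'.
rewrite -lerBlDr -lee_fin; apply: (@le_trans _ _ (mutual_info P f g - eta%:E)%E).
  by rewrite EFinB leeD2r// fmi_le_mutual_info.
apply: (le_trans (ltW h)); rewrite lee_fin le_eqVlt; apply/orP; left; apply/eqP.
apply: eq_bigr => i _; apply: eq_bigr => j _.
by rewrite mi_termE -alE -beE.
Qed.

End MutualInfo.

(** * Converse *)

Lemma big_pairE (S : Type) (idx : S) (op : Monoid.com_law idx) (A B : finType)
    (F : A * B -> S) :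
  \big[op/idx]_v F v = \big[op/idx]_a \big[op/idx]_b F (a, b).
Proof. by rewrite pair_bigA; apply: eq_bigr => -[]. Qed.

Section Conditioning.
Context {R : realType} d (T : measurableType d).
Implicit Types P Q : probability T R.

Lemma kl_termM (c p q : R) : 0 < c -> kl_term (c * p) (c * q) = c * kl_term p q.
Proof.
move=> c0; rewrite /kl_term pmulr_rgt0//; case: ltP => p0; last by rewrite mulr0.
by rewrite -mulf_div divff ?gt_eqF// mul1r mulrA.
Qed.

(** The product form makes events of probability zero harmless: there any law will do. *)
Lemma conditional_law P C : measurable C ->
  exists Q, forall A, measurable A -> pr P (A `&` C) = pr P C * pr Q A.
Proof.
move=> mC; exists (mnormalize (mrestr P mC) P) => A mA.
have mAC : measurable (A `&` C) by exact: measurableI.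
have [P0|Pn] := eqVneq (pr P C) 0.
  rewrite P0 mul0r; apply/eqP; rewrite eq_le pr_ge0 andbT -P0.
  by apply: le_pr => //; exact: subIsetr.
have PC : P C = (pr P C)%:E by rewrite prE.
have E : mnormalize (mrestr P mC) P A = (P (A `&` C) * (pr P C)^-1%:E)%E.
  by rewrite /mnormalize /= /mrestr setTI PC eqe (negPf Pn).
transitivity (pr P C * fine (P (A `&` C) * (pr P C)^-1%:E)%E); last by rewrite -E.
rewrite prE//=.
by rewrite mulrC mulfVK.
Qed.

Lemma integral_total_law (I : finType) (Z : T -> I) P (Q : I -> probability T R)
    (g : T -> \bar R) :
  fcell Z ->
  (forall i A, measurable A -> pr P (A `&` Z @^-1` [set i]) = pr1 P Z i * pr (Q i) A) ->
  measurable_fun setT g -> (forall x, 0 <= g x)%E ->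
  (\int[P]_x g x = \sum_i (pr1 P Z i)%:E * \int[Q i]_x g x)%E.
Proof.
move=> mZ hQ mg g0.
have [M [ME Mint]] := mixture_probability Q (pr1_pmf P mZ).
have MP A : measurable A -> P A = M A.
  move=> mA; rewrite ME prE// (pr_cells P mZ mA) -sumEFin; apply: eq_bigr => i _.
  by rewrite hQ// EFinM prE.
by rewrite -[RHS]Mint//; apply: eq_measure_integral => A mA _; exact: MP.
Qed.

End Conditioning.

Section FiniteChannel.
Context {R : realType} d (T : measurableType d).

(** Information between the index v, of law w, and the label of a letter of law mu v, written joint
    law against product of marginals. *)
Definition vinfo (V I : finType) (w : V -> R) (mu : V -> probability T R) (al : T -> I) : R :=
  \sum_v \sum_i kl_term (w v * pr1 (mu v) al i) ((\sum_u w u * pr1 (mu u) al i) * w v).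

(** The independence of the two letters given v is encoded by the iterated integral; no joint law
    has to be built before one of the two right-hand sides is addressed. *)
Definition fin_channel (pX pXh : probability T R) (Delta : T -> T -> R) (Rt Rc : R)
    (D : \bar R) : Prop :=
  exists (V : finType) (w : V -> R) (mu nu : V -> probability T R), fpmf w /\
  [/\ (forall A, measurable A -> pr pX A = \sum_v w v * pr (mu v) A),
      (forall A, measurable A -> pr pXh A = \sum_v w v * pr (nu v) A),
      (forall (I : finType) (al : T -> I), fcell al -> vinfo w mu al <= Rt),
      (forall (I : finType) (al : T -> I), fcell al -> vinfo w nu al <= Rt + Rc) &
      (\sum_v (w v)%:E * \int[mu v]_x \int[nu v]_y (Delta x y)%:E <= D)%E].

End FiniteChannel.

Section Converse.
Context {R : realType} d (T : measurableType d) dO (Om : measurableType dO)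
  (P : probability Om R).

Lemma bigcap_ord_measurable n (A : 'I_n -> set Om) :
  (forall t, measurable (A t)) -> measurable (\bigcap_t A t).
Proof.
move=> mA; rewrite -[X in measurable X]setCK setC_bigcap; apply: measurableC.
apply: fin_bigcup_measurable => [|i _]; first exact: finite_finset.
exact: measurableC.
Qed.

(** The constant kappa separates the two uses with Z = (J, K). The source block is independent of
    the seed, so kappa = 1 / kn and the bound is ln jn; for the output block kappa = 1 and the bound
    is ln (jn * kn). *)
Lemma iid_info_bound n (Y : 'I_n -> Om -> T) (pY : probability T R) (Zt : finType)
    (Z : Om -> Zt) (kappa : R) :
  (forall t, measurable_fun setT (Y t)) -> fcell Z -> 0 < kappa ->
  (forall (A : 'I_n -> set T), (forall t, measurable (A t)) -> forall z,
    pr P ((\bigcap_t (Y t @^-1` A t)) `&` Z @^-1` [set z]) <= kappa * \prod_t pr pY (A t)) ->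
  forall (I : finType) (al : T -> I), fcell al ->
  \sum_(t < n) \sum_i \sum_z
    kl_term (pr P (Y t @^-1` (al @^-1` [set i]) `&` Z @^-1` [set z])) (pr1 pY al i * pr1 P Z z)
  <= ln (kappa * #|Zt|%:R).
Proof.
move=> mY mZ k0 hk I al mal.
pose F w : {ffun 'I_n -> I} := [ffun t => al (Y t w)].
have FE x : F @^-1` [set x] = \bigcap_t (Y t @^-1` (al @^-1` [set x t])).
  apply/seteqP; split=> [w /= <- t _ /=|w h]; first by rewrite ffunE.
  by apply/ffunP => t; rewrite ffunE; exact: h.
have mYal t i : measurable (Y t @^-1` (al @^-1` [set i])).
  by rewrite -[X in measurable X]setTI; apply: mY.
have mF : fcell F.
  by move=> x; rewrite FE; apply: bigcap_ord_measurable => t.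
have := @block_info_bound R I Zt n (pr2 P F Z) (pr1 pY al) kappa.
rewrite (eq_bigr (fun i => pr1 P F i)); last by move=> x _; exact: pr2_sumr.
have -> : \sum_i pr1 P F i = 1 by case: (pr1_pmf P mF).
have le1 x z : pr2 P F Z x z <= kappa * ppow (pr1 pY al) x.
  by rewrite /pr2 FE; exact: hk.
move=> /(_ (fun x z => pr_ge0 _ _) erefl (pr1_pmf pY mal) k0 le1).
apply: le_trans; rewrite le_eqVlt; apply/orP; left; apply/eqP.
apply: eq_bigr => t _; apply: eq_bigr => i _; apply: eq_bigr => z _.
rewrite pr2_suml//; congr kl_term.
have := pr_pred P (fun x : {ffun 'I_n -> I} => x t == i) mF (mZ z).
have -> : [set x | F x t == i] = Y t @^-1` (al @^-1` [set i]).
  by apply/seteqP; split=> w /=; rewrite ffunE => /eqP.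
by rewrite setIC => ->; apply: eq_bigr => x _; rewrite /pr2 setIC.
Qed.

(** The rectangle that constrains coordinate t0 alone; it extracts single-letter statements from the
    block conditions of [achievable]. *)
Definition only n (t0 : 'I_n) (A : set T) (t : 'I_n) : set T := if t == t0 then A else setT.

Lemma only_measurable n (t0 : 'I_n) A : measurable A -> forall t, measurable (only t0 A t).
Proof. by move=> mA t; rewrite /only; case: ifP. Qed.

Lemma bigcap_only n (Y : 'I_n -> Om -> T) (t0 : 'I_n) A :
  \bigcap_t (Y t @^-1` only t0 A t) = Y t0 @^-1` A.
Proof.
apply/seteqP; split=> w /=; first by move=> /(_ t0 Logic.I); rewrite /only /= eqxx.
by move=> h t _; rewrite /only /=; case: eqP => [->|].
Qed.

Lemma prod_only n (t0 : 'I_n) A (pY : probability T R) :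
  \prod_t pr pY (only t0 A t) = pr pY A.
Proof.
rewrite (bigD1 t0)//= {1}/only eqxx big1 ?mulr1// => t /negPf tn.
by rewrite /only tn pr_setT.
Qed.

End Converse.

(** * From a code to a finite test channel *)

Section ConverseTheorem.
Context {R : realType} d (T : measurableType d).

Lemma converse (pX pXh : probability T R) (Delta : T -> T -> R) (Rt Rc D : R) :
  measurable_fun setT (fun z : T * T => Delta z.1 z.2) -> (forall x y, 0 <= Delta x y) ->
  achievable pX pXh Delta Rt Rc D -> fin_channel pX pXh Delta Rt Rc D%:E.
Proof.
move=> mD D0 [n [jn [kn [n0 [jn0 [kn0 [lj [lk [dO [Om [P [X [K [J [Xh]]]]]]]]]]]]]]].
move=> [mX [mXh [mK [mJ [hXK [hM [hXh hD]]]]]]].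
have np : (0 : R) < n%:R by rewrite ltr0n.
have jp : (0 : R) < jn%:R by rewrite ltr0n.
have kp : (0 : R) < kn%:R by rewrite ltr0n.
pose Z w := (J w, K w).
have mZ : fcell Z by apply: fcell_pair.
have ZE j k : Z @^-1` [set (j, k)] = J @^-1` [set j] `&` K @^-1` [set k].
  by apply/seteqP; split=> w; rewrite /Z /= => -[-> ->].
have [Q hQ] := choice (fun z => conditional_law P (mZ z)).
have mXA t A : measurable A -> measurable (X t @^-1` A).
  by move=> mA; rewrite -[X in measurable X]setTI; apply: mX.
have mXhA t A : measurable A -> measurable (Xh t @^-1` A).
  by move=> mA; rewrite -[X in measurable X]setTI; apply: mXh.
have mEA A : (forall t, measurable (A t)) -> measurable (\bigcap_t (X t @^-1` A t)).
  by move=> mA; apply: bigcap_ord_measurable => t; exact: mXA.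
have mFB A : (forall t, measurable (A t)) -> measurable (\bigcap_t (Xh t @^-1` A t)).
  by move=> mA; apply: bigcap_ord_measurable => t; exact: mXhA.
have [mu hmu] := choice (fun v : 'I_n * ('I_jn * 'I_kn) => pushforward_probability (Q v.2) (mX v.1)).
have [nu hnu] := choice (fun v : 'I_n * ('I_jn * 'I_kn) => pushforward_probability (Q v.2) (mXh v.1)).
pose w (v : 'I_n * ('I_jn * 'I_kn)) : R := n%:R^-1 * pr1 P Z v.2.
have muE t z A : pr (mu (t, z)) A = pr (Q z) (X t @^-1` A).
  by rewrite /pr; have [-> _] := hmu (t, z).
have nuE t z A : pr (nu (t, z)) A = pr (Q z) (Xh t @^-1` A).
  by rewrite /pr; have [-> _] := hnu (t, z).
have prX A : (forall t, measurable (A t)) -> pr P (\bigcap_t (X t @^-1` A t)) = \prod_t pr pX (A t).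
  move=> mA; rewrite (pr_cells P mK (mEA _ mA)).
  transitivity (\sum_(k < kn) (\prod_t pr pX (A t)) / kn%:R).
    by apply: eq_bigr => k _; rewrite {1}/pr hXK.
  by rewrite sumr_const card_ord -[_ *+ kn]mulr_natr mulfVK// gt_eqF.
have prXh A : (forall t, measurable (A t)) -> pr P (\bigcap_t (Xh t @^-1` A t)) = \prod_t pr pXh (A t).
  by move=> mA; rewrite {1}/pr hXh.
have wX t z A : measurable A -> w (t, z) * pr (mu (t, z)) A = n%:R^-1 * pr P (X t @^-1` A `&` Z @^-1` [set z]).
  by move=> mA; rewrite muE /w -mulrA hQ//; exact: mXA.
have wXh t z A : measurable A -> w (t, z) * pr (nu (t, z)) A = n%:R^-1 * pr P (Xh t @^-1` A `&` Z @^-1` [set z]).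
  by move=> mA; rewrite nuE /w -mulrA hQ//; exact: mXhA.
have sX A : measurable A -> pr pX A = \sum_v w v * pr (mu v) A.
  move=> mA; rewrite big_pairE/=.
  transitivity (\sum_(t < n) n%:R^-1 * pr pX A).
    by rewrite sumr_const card_ord -[RHS]mulr_natl mulrA mulfV ?mul1r// gt_eqF.
  apply: eq_bigr.
  move=> t _; under eq_bigr do rewrite wX//.
  rewrite -mulr_sumr -(pr_cells P mZ (mXA _ _ mA)) -(bigcap_only X t) prX ?prod_only//.
  exact: only_measurable.
have sXh A : measurable A -> pr pXh A = \sum_v w v * pr (nu v) A.
  move=> mA; rewrite big_pairE/=.
  transitivity (\sum_(t < n) n%:R^-1 * pr pXh A).
    by rewrite sumr_const card_ord -[RHS]mulr_natl mulrA mulfV ?mul1r// gt_eqF.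
  apply: eq_bigr.
  move=> t _; under eq_bigr do rewrite wXh//.
  rewrite -mulr_sumr -(pr_cells P mZ (mXhA _ _ mA)) -(bigcap_only Xh t) prXh ?prod_only//.
  exact: only_measurable.
exists ('I_n * ('I_jn * 'I_kn))%type, w, mu, nu; split.
  split=> [v|]; first by rewrite mulr_ge0 ?invr_ge0 ?pr_ge0.
  rewrite big_pairE/= /w/=.
  under eq_bigr do rewrite -mulr_sumr.
  have [_ ->] := pr1_pmf P mZ.
  by rewrite sumr_const card_ord mulr1 -[LHS]mulr_natl mulfV// gt_eqF.
split => //.
- move=> I al mal; rewrite /vinfo.
  have := @iid_info_bound _ _ T _ Om P n X pX _ Z kn%:R^-1 mX mZ.
  rewrite invr_gt0 kp => /(_ isT) h.
  have {}h : \sum_t \sum_i \sum_z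
    kl_term (pr P (X t @^-1` (al @^-1` [set i]) `&` Z @^-1` [set z])) (pr1 pX al i * pr1 P Z z) <= n%:R * Rt.
    apply: le_trans (h _ I al mal) _.
      (* Forgetting J leaves the event that X^n lies in A and K = k, whose probability is the
         product divided by kn. *)
      move=> A mA [j k]; rewrite mulrC; apply: (@le_trans _ _ (pr P (\bigcap_t (X t @^-1` A t) `&` K @^-1` [set k]))).
        apply: le_pr; [by apply: measurableI => //; exact: mEA|by apply: measurableI => //; exact: mEA|].
        by rewrite ZE => x [? []].
      by rewrite {1}/pr hXK.
    by rewrite card_prod !card_ord natrM mulrCA mulVf ?mulr1// gt_eqF.
  rewrite big_pairE/=.
  rewrite -(ler_pM2l np) (le_trans _ h)// mulr_sumr; apply: ler_sum => t _.
  rewrite mulr_sumr [leRHS]exchange_big/=; apply: ler_sum => z _.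
  rewrite mulr_sumr; apply: ler_sum => i _.
  rewrite {1}/pr1 wX// -sX// -/(pr1 pX al i) /w mulrCA kl_termM ?invr_gt0//.
  by rewrite mulrA mulfV ?mul1r// gt_eqF.
- move=> I al mal; rewrite /vinfo.
  have := @iid_info_bound _ _ T _ Om P n Xh pXh _ Z 1 mXh mZ ltr01 => h.
  have {}h : \sum_t \sum_i \sum_z
    kl_term (pr P (Xh t @^-1` (al @^-1` [set i]) `&` Z @^-1` [set z])) (pr1 pXh al i * pr1 P Z z) <= n%:R * (Rt + Rc).
    apply: le_trans (h _ I al mal) _.
      move=> A mA z; rewrite mul1r -prXh//.
      by apply: le_pr; [by apply: measurableI => //; exact: mFB|exact: mFB|exact: subIsetl].
    by rewrite card_prod !card_ord natrM mul1r lnM ?posrE// mulrDr lerD.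
  rewrite big_pairE/=.
  rewrite -(ler_pM2l np) (le_trans _ h)// mulr_sumr; apply: ler_sum => t _.
  rewrite mulr_sumr [leRHS]exchange_big/=; apply: ler_sum => z _.
  rewrite mulr_sumr; apply: ler_sum => i _.
  rewrite {1}/pr1 wXh// -sXh// -/(pr1 pXh al i) /w mulrCA kl_termM ?invr_gt0//.
  by rewrite mulrA mulfV ?mul1r// gt_eqF.
apply: le_trans hD.
have mDe : measurable_fun setT (fun z : T * T => (Delta z.1 z.2)%:E).
  exact/measurable_EFinP.
have mXX t : measurable_fun setT (fun o => (X t o, Xh t o)).
  exact: measurable_fun_pair.
rewrite big_pairE/=.
rewrite ge0_sume_distrr; last first.
  by move=> t _; apply: integral_ge0 => o _; rewrite lee_fin.
apply: lee_sum => t _.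
have mg : measurable_fun setT (fun o => (Delta (X t o) (Xh t o))%:E).
  by apply: (measurableT_comp mDe (mXX t)).
rewrite (integral_total_law mZ hQ mg); last by move=> o; rewrite lee_fin.
rewrite ge0_sume_distrr; last first.
  move=> z _; rewrite mule_ge0 ?lee_fin ?pr_ge0//.
  by apply: integral_ge0 => o _; rewrite lee_fin.
apply: lee_sum => z _; rewrite /w EFinM -muleA.
rewrite lee_pmul2l ?lte_fin ?invr_gt0//.
have [->|pzn] := eqVneq (pr1 P Z z) 0; first by rewrite !mul0e.
have pz : 0 < pr1 P Z z by rewrite lt0r pzn pr_ge0.
rewrite lee_pmul2l ?lte_fin//.
have [joint [jE jint]] := pushforward_probability (Q z) (mXX t).
rewrite -(jint (fun p => (Delta p.1 p.2)%:E))//; last by move=> p; rewrite lee_fin.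
rewrite -(@fubini_tonelli1 _ _ _ _ _ (mu (t, z)) (nu (t, z)) (fun p => (Delta p.1 p.2)%:E))//;
  last by move=> p; rewrite lee_fin.
rewrite le_eqVlt; apply/orP; left; apply/eqP.
apply: eq_measure_integral => A mA _.
apply: product_measure_unique => // A0 B0 mA0 mB0.
have mEF : measurable (X t @^-1` A0 `&` Xh t @^-1` B0).
  by apply: measurableI; [exact: mXA|exact: mXhA].
have j1 : joint (A0 `*` B0) = (pr (Q z) (X t @^-1` A0 `&` Xh t @^-1` B0))%:E.
  by rewrite jE -prE//; congr (Q z _).
have j2 : mu (t, z) A0 = (pr (Q z) (X t @^-1` A0))%:E by rewrite -muE prE.
have j3 : nu (t, z) B0 = (pr (Q z) (Xh t @^-1` B0))%:E by rewrite -nuE prE.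
apply: etrans j1 _; apply: esym; apply: etrans (congr2 mule j2 j3) _.
rewrite -EFinM; congr EFin; apply: esym.
(* The Markov condition of the code, restricted to letter t of each block, is independence given z
   in product form; it remains to divide by the square of the probability of z, positive here. *)
have := hM _ _ (only_measurable t mA0) (only_measurable t mB0) z.1 z.2.
rewrite /= !bigcap_only -ZE -surjective_pairing.
rewrite !prE//; try (by apply: measurableI => //; first [exact: mXA|exact: mXhA]).
rewrite !hQ//; [|exact: mXhA|exact: mXA].
rewrite -!EFinM => -[] h.
have pz2 : pr1 P Z z * pr1 P Z z != 0 by rewrite mulf_neq0.
apply: (mulfI pz2); rewrite /pr1.
rewrite [LHS]mulrAC h; ring.
Qed.

End ConverseTheorem.

(** * From a finite test channel to the right-hand side of (i) *)

Section ChannelLaw.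
Context {R : realType} d (T : measurableType d).

Lemma probability_integral_cst d' (T' : measurableType d') (Q : probability T' R) (c : R) :
  (\int[Q]_x c%:E = c%:E)%E.
Proof.
rewrite integral_cst//; apply: etrans (mule1 c%:E).
by congr (_ * _)%E; exact: probability_setT.
Qed.

Lemma natfun_measurable d' (T' : measurableType d') (f : nat -> T') : measurable_fun setT f.
Proof. by move=> _ Y _; rewrite setTI. Qed.

(** The alphabet of U must be a measurable type. The index v is stored in [nat], where every set is
    measurable, so functions of the code raise no measurability question. *)
Definition vcode (V : finType) (v : V) : nat := enum_rank v.

Definition vdecode (V : finType) (S : Type) (s0 : S) (f : V -> S) (k : nat) : S :=
  if insub k is Some i then f (enum_val (i : 'I_#|V|)) else s0.

Lemma vcodeK (V : finType) (S : Type) (s0 : S) (f : V -> S) v : vdecode s0 f (vcode v) = f v.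
Proof. by rewrite /vdecode /vcode valK enum_rankK. Qed.

Lemma channel_law (V : finType) (w : V -> R) (mu nu : V -> probability T R) : fpmf w ->
  exists p : probability ((T * nat) * T)%type R,
    (forall A B (C : set nat), measurable A -> measurable B ->
       pr p ((A `*` C) `*` B) = \sum_v w v * ((vcode v \in C)%:R * (pr (mu v) A * pr (nu v) B))) /\
    (forall F : (T * nat) * T -> \bar R, measurable_fun setT F -> (forall z, 0 <= F z)%E ->
       (\int[p]_z F z)%E = (\sum_v (w v)%:E * \int[mu v]_x \int[nu v]_y F ((x, vcode v), y))%E).
Proof.
move=> wp.
pose phi (v : V) (z : T * T) : (T * nat) * T := ((z.1, vcode v), z.2).
have mphi v : measurable_fun setT (phi v).
  apply: measurable_fun_pair; last exact: measurable_snd.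
  by apply: measurable_fun_pair; [exact: measurable_fst|exact: measurable_cst].
have [q hq] := choice (fun v => pushforward_probability ((mu v \x nu v)%E : probability _ R) (mphi v)).
have [p [pE pint]] := mixture_probability q wp.
exists p; split=> [A B C mA mB|F mF F0].
  have qE v : q v ((A `*` C) `*` B) = ((vcode v \in C)%:R * (pr (mu v) A * pr (nu v) B))%:E.
    have [-> _] := hq v.
    have [vC|vC] := boolP (vcode v \in C).
      have -> : phi v @^-1` ((A `*` C) `*` B) = A `*` B.
        by apply/seteqP; split=> [[x y] [[/= ? ?] ?]|[x y] [/= ? ?]]; split=> //=; split=> //; rewrite inE in vC.
      have e1 : mu v A = (pr (mu v) A)%:E by rewrite prE.
      have e2 : nu v B = (pr (nu v) B)%:E by rewrite prE.
      rewrite mul1r EFinM; apply: etrans (product_measure1E _ _ mA mB) _.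
      exact: (congr2 mule e1 e2).
    have -> : phi v @^-1` ((A `*` C) `*` B) = set0.
      by apply/seteqP; split=> [[x y] [[/= _ h] _]|//]; case/negP: vC; rewrite inE.
    by rewrite measure0 mul0r.
  rewrite /pr pE; under eq_bigr do rewrite qE -EFinM.
  by rewrite sumEFin.
rewrite pint//; apply: eq_bigr => v _; congr (_ * _)%E.
have [_ ->//] := hq v.
rewrite -(@fubini_tonelli1 _ _ _ _ _ (mu v) (nu v) (fun z => F (phi v z)))//.
exact: measurableT_comp.
Qed.

(** Labels of c v are a coarsening of v itself, so the log-sum inequality applies. The map c is the
    numeric code of v for (i), and the conditional mean of the letter for (ii). *)
Lemma mixture_fmi_le d0 (Om : measurableType d0) d' (S : measurableType d')
    (p : probability Om R) (V : finType) (w : V -> R) (lam : V -> probability T R)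
    (c : V -> S) (f : Om -> T) (g : Om -> S) : fpmf w ->
  (forall A C, measurable A -> measurable C -> pr p (f @^-1` A `&` g @^-1` C) =
    \sum_v w v * ((c v \in C)%:R * pr (lam v) A)) ->
  forall (I J : finType) (al : T -> I) (be : S -> J), fcell al -> fcell be ->
  fmi p (fun z => al (f z)) (fun z => be (g z)) <= vinfo w lam al.
Proof.
move=> [w0 w1] hf I J al be mal mbe.
have p2 i j : pr2 p (fun z => al (f z)) (fun z => be (g z)) i j =
    \sum_(v | be (c v) == j) w v * pr1 (lam v) al i.
  rewrite /pr2 (hf (al @^-1` [set i]) (be @^-1` [set j]))// [RHS]big_mkcond/=.
  apply: eq_bigr => v _; have -> : (c v \in be @^-1` [set j]) = (be (c v) == j).
    by apply/idP/eqP; rewrite inE.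
  by case: ifP => _; rewrite ?mul1r ?mul0r ?mulr0.
have p1 i : pr1 p (fun z => al (f z)) i = \sum_v w v * pr1 (lam v) al i.
  rewrite /pr1 -[X in pr p X]setIT (hf (al @^-1` [set i]) setT)//.
  by apply: eq_bigr => v _; rewrite in_setT mul1r.
have p1' j : pr1 p (fun z => be (g z)) j = \sum_(v | be (c v) == j) w v.
  rewrite /pr1 -[X in pr p X]setTI (hf setT (be @^-1` [set j]))// [RHS]big_mkcond/=.
  apply: eq_bigr => v _; have -> : (c v \in be @^-1` [set j]) = (be (c v) == j).
    by apply/idP/eqP; rewrite inE.
  by case: ifP => _; rewrite pr_setT ?mulr1 ?mulr0.
rewrite /vinfo exchange_big/=; apply: ler_sum => i _.
rewrite [leRHS](partition_big (fun v => be (c v)) predT)//=; apply: ler_sum => j _.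
rewrite p2 p1 p1' mulr_sumr.
apply: log_sum => [v|v|v h].
- by rewrite mulr_ge0 ?pr_ge0.
- by rewrite mulr_ge0// sumr_ge0// => u _; rewrite mulr_ge0 ?pr_ge0.
have wv : 0 < w v.
  by rewrite lt0r w0 andbT; apply/eqP => wv0; move: h; rewrite wv0 mul0r ltxx.
rewrite mulr_gt0// (lt_le_trans h)// (bigD1 v)//= lerDl sumr_ge0// => u _.
by rewrite mulr_ge0 ?pr_ge0.
Qed.

Lemma fin_channel_rhs_i (pX pXh : probability T R) (Delta : T -> T -> R) (Rt Rc : R)
    (D : \bar R) :
  measurable_fun setT (fun z : T * T => Delta z.1 z.2) -> (forall x y, 0 <= Delta x y) ->
  fin_channel pX pXh Delta Rt Rc D -> (rhs_i pX pXh Delta Rt Rc <= D)%E.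
Proof.
move=> mD D0 [V [w [mu [nu [wp [hX hXh hR hRc hD]]]]]].
have [p [pE pint]] := channel_law mu nu wp.
apply: le_trans hD; apply: ereal_inf_lbound.
have [w0 w1] := wp.
have prT (Q : probability T R) : pr Q setT = 1 by exact: pr_setT.
have mdec d' (T' : measurableType d') (s0 : T') (f : V -> T') : measurable_fun setT (vdecode s0 f).
  exact: natfun_measurable.
exists default_measure_display, nat, p; split.
  move=> A mA; rewrite prE; last by do 2 apply: measurableX => //.
  rewrite pE// prE// hX//; congr EFin; apply: eq_bigr => v _.
  by rewrite prT mulr1 in_setT mul1r.
split.
  move=> B mB; rewrite prE; last by do 2 apply: measurableX => //.
  rewrite pE// prE// hXh//; congr EFin; apply: eq_bigr => v _.
  by rewrite prT mul1r in_setT mul1r.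
have mC (C : set nat) : measurable C by [].
have fE A C B : (fun z : T * nat * T => z.1.1) @^-1` A `&` (fun z => z.2) @^-1` B
    `&` (fun z => z.1.2) @^-1` C = (A `*` C) `*` B.
  by apply/seteqP; split=> [[[x u] y] [[? ?] ?]|[[x u] y] [[? ?] ?]]; split.
have fEl A C : (fun z : T * nat * T => z.1.1) @^-1` A `&` (fun z => z.1.2) @^-1` C = (A `*` C) `*` setT.
  by apply/seteqP; split=> [[[x u] y] [? ?]|[[x u] y] [[? ?] ?]]; split.
have fEr C B : (fun z : T * nat * T => z.2) @^-1` B `&` (fun z => z.1.2) @^-1` C = (setT `*` C) `*` B.
  by apply/seteqP; split=> [[[x u] y] [? ?]|[[x u] y] [[? ?] ?]]; split.
have cint (h : nat -> R) (C : set nat) : (forall u, 0 <= h u) ->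
    (\int[p]_(z in (fun z => z.1.2) @^-1` C) (h z.1.2)%:E)%E =
    (\sum_v w v * ((vcode v \in C)%:R * h (vcode v)))%:E.
  move=> h0; rewrite integral_mkcond.
  pose hC u := (u \in C)%:R * h u.
  rewrite (eq_integral (fun z => (hC z.1.2)%:E)); last first.
    move=> z _; rewrite patchE /hC.
    have -> : (z \in (fun z0 => z0.1.2) @^-1` C) = (z.1.2 \in C).
      by apply/idP/idP; rewrite !inE.
    by case: ifP => _; rewrite ?mul1r ?mul0r.
  rewrite pint; last 2 first.
  - apply/measurable_EFinP; apply: (measurableT_comp (natfun_measurable hC)).
    exact: (measurableT_comp measurable_snd measurable_fst).
  - by move=> z; rewrite lee_fin /hC mulr_ge0.
  rewrite -sumEFin; apply: eq_bigr => v _; rewrite EFinM; congr (_ * _)%E.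
  rewrite (eq_integral (fun=> (hC (vcode v))%:E)); last first.
    by move=> x _ /=; rewrite probability_integral_cst.
  by rewrite probability_integral_cst.
split.
  move=> A B mA mB.
  (* Given v, the conditional probabilities of the two events are mu v A and nu v B. *)
  exists (vdecode 0 (fun v => pr (mu v) A)), (vdecode 0 (fun v => pr (nu v) B)).
  split; first exact: natfun_measurable.
  split; first exact: natfun_measurable.
  have d01 (V' : finType) (f : V' -> R) u : (forall v, 0 <= f v <= 1) -> 0 <= vdecode 0 f u <= 1.
    by move=> hf; rewrite /vdecode; case: insub => [i|]//; rewrite lexx ler01.
  have a01 u : 0 <= vdecode 0 (fun v => pr (mu v) A) u <= 1.
    by apply: d01 => v; rewrite pr_ge0 pr_le1.
  have b01 u : 0 <= vdecode 0 (fun v => pr (nu v) B) u <= 1.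
    by apply: d01 => v; rewrite pr_ge0 pr_le1.
  split; first exact: a01.
  split; first exact: b01.
  move=> C _; split.
    rewrite fEl prE; last by do 2 apply: measurableX => //.
    rewrite pE// cint; last by move=> u; case/andP: (a01 u).
    by congr EFin; apply: eq_bigr => v _; rewrite vcodeK prT mulr1.
  split.
    rewrite fEr prE; last by do 2 apply: measurableX => //.
    rewrite pE// cint; last by move=> u; case/andP: (b01 u).
    by congr EFin; apply: eq_bigr => v _; rewrite vcodeK prT mul1r.
  rewrite fE prE; last by do 2 apply: measurableX => //.
  rewrite pE// (cint (fun u => vdecode 0 (fun v => pr (mu v) A) u * vdecode 0 (fun v => pr (nu v) B) u)).
    by congr EFin; apply: eq_bigr => v _; rewrite !vcodeK.
  by move=> u; rewrite mulr_ge0//; [case/andP: (a01 u)|case/andP: (b01 u)].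
have info (f : T * nat * T -> T) (lam : V -> probability T R) :
    (forall A C, measurable A -> pr p (f @^-1` A `&` (fun z => z.1.2) @^-1` C) =
      \sum_v w v * ((vcode v \in C)%:R * pr (lam v) A)) ->
    forall (I J : finType) (al : T -> I) (be : nat -> J), fcell al -> fcell be ->
    fmi p (fun z => al (f z)) (fun z => be z.1.2) <= vinfo w lam al.
  move=> hf I J al be mal mbe.
  exact: (mixture_fmi_le (g := fun z => z.1.2) wp (fun A C mA _ => hf A C mA) mal mbe).
split.
  apply: mutual_info_le => I J al be mal mbe.
  apply: le_trans (hR _ _ mal); apply: info => // A C mA.
  by rewrite fEl pE//; apply: eq_bigr => v _; rewrite prT mulr1.
split.
  apply: mutual_info_le => I J al be mal mbe.
  apply: le_trans (hRc _ _ mal); apply: info => // A C mA.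
  by rewrite fEr pE//; apply: eq_bigr => v _; rewrite prT mul1r.
rewrite pint//; last by move=> z; rewrite lee_fin.
apply/measurable_EFinP.
have m12 : measurable_fun setT (fun z : T * nat * T => (z.1.1, z.2)).
  apply: measurable_fun_pair; last exact: measurable_snd.
  exact: (measurableT_comp measurable_fst measurable_fst).
exact: (measurableT_comp mD m12).
Qed.

End ChannelLaw.

(** * Realizing block codes *)

Section Realization.
Context {R : realType} d (T : measurableType d).

Lemma pr_product d1 d2 (T1 : measurableType d1) (T2 : measurableType d2)
    (P : probability T1 R) (Q : probability T2 R) A B : measurable A -> measurable B ->
  pr ((P \x Q)%E : probability _ R) (A `*` B) = pr P A * pr Q B.
Proof.
move=> mA mB.
have e1 : P A = (pr P A)%:E by rewrite prE.
have e2 : Q B = (pr Q B)%:E by rewrite prE.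
rewrite /pr -[RHS]/(fine (pr P A * pr Q B)%:E) EFinM; congr fine.
by apply: etrans (product_measure1E _ _ mA mB) _; exact: (congr2 mule e1 e2).
Qed.

(** The space and the coordinates are chosen before the marginals. One set of coordinates thus
    serves every finite block, and the product laws can be mixed over blocks. *)
Lemma independent_coordinates n : exists (dO : measure_display) (Om : measurableType dO)
    (X : 'I_n -> Om -> T), (forall t, measurable_fun setT (X t)) /\
  forall mu : 'I_n -> probability T R, exists P : probability Om R,
    forall A : 'I_n -> set T, (forall t, measurable (A t)) ->
      pr P (\bigcap_t (X t @^-1` A t)) = \prod_t pr (mu t) (A t).
Proof.
elim: n => [|n [dO [Om [X [mX hX]]]]].
  exists _, unit, (fun _ _ => point); split=> [[]//|mu].
  exists (dirac tt : probability _ R) => A mA.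
  rewrite big_ord0 (_ : \bigcap_t _ = setT) ?pr_setT//.
  by apply/seteqP; split=> // x _ [].
pose X' (t : 'I_n.+1) (o : T * Om) : T := if unlift ord0 t is Some s then X s o.2 else o.1.
exists _, (T * Om)%type, X'; split=> [t|mu].
  rewrite /X'; case: unliftP => [s _|_]; last exact: measurable_fst.
  exact: measurableT_comp measurable_snd.
have [P hP] := hX (fun s => mu (lift ord0 s)).
exists ((mu ord0 \x P)%E : probability _ R) => A mA.
have -> : \bigcap_t (X' t @^-1` A t) = A ord0 `*` \bigcap_s (X s @^-1` A (lift ord0 s)).
  apply/seteqP; split=> [[x o] h|[x o] [hx ho] t _] /=.
    split; first by have := h ord0 Logic.I; rewrite /X' /= unlift_none.
    by move=> s _; have := h (lift ord0 s) Logic.I; rewrite /X' /= liftK.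
  rewrite /X' /=; case: unliftP => [s ->|->]//; exact: ho.
rewrite pr_product//; last first.
  apply: bigcap_ord_measurable => s; rewrite -[X in measurable X]setTI; exact: mX.
by rewrite hP// big_ord_recl.
Qed.

Lemma prod_only1 n (t0 : 'I_n) A (mu : 'I_n -> probability T R) :
  \prod_t pr (mu t) (only t0 A t) = pr (mu t0) A.
Proof.
rewrite (bigD1 t0)//= {1}/only eqxx big1 ?mulr1// => t /negPf tn.
by rewrite /only tn pr_setT.
Qed.

Lemma big_pair4E (S : Type) (idx : S) (op : Monoid.com_law idx) (A B C D : finType)
    (F : A * B * C * D -> S) :
  \big[op/idx]_v F v =
  \big[op/idx]_a \big[op/idx]_b \big[op/idx]_c \big[op/idx]_e F (a, b, c, e).
Proof.
rewrite big_pairE big_pairE big_pairE.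
by [].
Qed.

(** The finite data (x, k, j, y) are drawn first, from enc * dec, and kept in a natural number. Then
    the true source and output letters are drawn independently, from the cell laws kap and lam
    selected by x and y. *)
Lemma realize_code (I L : finType) (pI : I -> R) (pL : L -> R)
    (kap : I -> probability T R) (lam : L -> probability T R)
    (pX pXh : probability T R) (Delta : T -> T -> R) (n kn jn : nat) (Rt Rc D : R)
    (enc : {ffun 'I_n -> I} -> 'I_kn -> 'I_jn -> R)
    (dec : 'I_kn -> 'I_jn -> {ffun 'I_n -> L} -> R) :
  measurable_fun setT (fun z : T * T => Delta z.1 z.2) -> (forall x y, 0 <= Delta x y) ->
  (forall A, measurable A -> pr pX A = \sum_i pI i * pr (kap i) A) ->
  (forall A, measurable A -> pr pXh A = \sum_l pL l * pr (lam l) A) ->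
  (0 < n)%N -> (0 < kn)%N -> (0 < jn)%N ->
  ln (jn%:R : R) <= n%:R * Rt -> ln (kn%:R : R) <= n%:R * Rc ->
  fpmf pI ->
  (forall x k j, 0 <= enc x k j) -> (forall k j, fpmf (dec k j)) ->
  (forall x k, \sum_j enc x k j = ppow pI x / kn%:R) ->
  (forall y, \sum_x \sum_k \sum_j enc x k j * dec k j y = ppow pL y) ->
  ((n%:R^-1)%:E * \sum_(t < n) \sum_x \sum_k \sum_j \sum_y (enc x k j * dec k j y)%:E *
     \int[kap (x t)]_a \int[lam (y t)]_b (Delta a b)%:E <= D%:E)%E ->
  achievable pX pXh Delta Rt Rc D.
Proof.
move=> mD D0 hX hXh n0 kn0 jn0 lj lk pIp enc0 decP encs encdec hDist.
have [dO [Om [X [mX hPX]]]] := independent_coordinates n.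
pose W := ({ffun 'I_n -> I} * 'I_kn * 'I_jn * {ffun 'I_n -> L})%type.
have [PX hX1] := choice (fun v : W => hPX (fun t => kap (v.1.1.1 t))).
have [PY hY1] := choice (fun v : W => hPX (fun t => lam (v.2 t))).
pose q (v : W) := enc v.1.1.1 v.1.1.2 v.1.2 * dec v.1.1.2 v.1.2 v.2.
have qp : fpmf q.
  split=> [[[[x k] j] y]|]; first by rewrite /q mulr_ge0//; case: (decP k j).
  rewrite big_pair4E /q/=.
  transitivity (\sum_(x : {ffun 'I_n -> I}) ppow pI x); last by case: (@ppow_pmf _ 'I_n _ _ pIp).
  apply: eq_bigr => x _.
  transitivity (\sum_(k < kn) ppow pI x / kn%:R).
    apply: eq_bigr => k _; rewrite -(encs x k); apply: eq_bigr => j _.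
    by rewrite -mulr_sumr; case: (decP k j) => _ ->; rewrite mulr1.
  by rewrite sumr_const card_ord -[LHS]mulr_natr mulfVK// pnatr_eq0 -lt0n.
pose OO := (nat * (Om * Om))%type.
pose phi (v : W) (o : Om * Om) : OO := (vcode v, o).
have mphi v : measurable_fun setT (phi v).
  by apply: measurable_fun_pair; [exact: measurable_cst|exact: measurable_id].
have [Q hQ] := choice (fun v => pushforward_probability ((PX v \x PY v)%E : probability _ R) (mphi v)).
have [P [PE Pint]] := mixture_probability Q qp.
have mXA t A : measurable A -> measurable (X t @^-1` A).
  by move=> mA; rewrite -[X in measurable X]setTI; apply: mX.
pose XX t (o : OO) := X t o.2.1.
pose YY t (o : OO) := X t o.2.2.
pose EA (A : 'I_n -> set T) := \bigcap_t (XX t @^-1` A t).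
pose FB (B : 'I_n -> set T) := \bigcap_t (YY t @^-1` B t).
pose GC (C : set nat) := (fun o : OO => o.1) @^-1` C.
have mXX t : measurable_fun setT (XX t).
  apply: (measurableT_comp (mX t)).
  exact: (measurableT_comp measurable_fst measurable_snd).
have mYY t : measurable_fun setT (YY t).
  apply: (measurableT_comp (mX t)).
  exact: (measurableT_comp measurable_snd measurable_snd).
have mGC C : measurable (GC C).
  rewrite -[X in measurable X]setTI; exact: (measurable_fst measurableT).
have mEA A : (forall t, measurable (A t)) -> measurable (EA A).
  move=> mA; apply: bigcap_ord_measurable => t.
  by rewrite -[X in measurable X]setTI; apply: mXX.
have mFB A : (forall t, measurable (A t)) -> measurable (FB A).
  move=> mA; apply: bigcap_ord_measurable => t.
  by rewrite -[X in measurable X]setTI; apply: mYY.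
have EAT : EA (fun=> setT) = setT by apply/seteqP; split.
have FBT : FB (fun=> setT) = setT by apply/seteqP; split.
pose kA (x : {ffun 'I_n -> I}) (A : 'I_n -> set T) := \prod_t pr (kap (x t)) (A t).
pose lB (y : {ffun 'I_n -> L}) (B : 'I_n -> set T) := \prod_t pr (lam (y t)) (B t).
have kAT x : kA x (fun=> setT) = 1 by rewrite /kA big1// => t _; rewrite pr_setT.
have lBT y : lB y (fun=> setT) = 1 by rewrite /lB big1// => t _; rewrite pr_setT.
have mT : forall t : 'I_n, measurable ((fun=> setT) t : set T) by [].
have RF A B C : (forall t, measurable (A t)) -> (forall t, measurable (B t)) ->
    pr P (EA A `&` FB B `&` GC C) =
    \sum_v q v * ((vcode v \in C)%:R * (kA v.1.1.1 A * lB v.2 B)).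
  move=> mA mB.
  have QE v : Q v (EA A `&` FB B `&` GC C) =
      ((vcode v \in C)%:R * (kA v.1.1.1 A * lB v.2 B))%:E.
    have [-> _] := hQ v.
    have [vC|vC] := boolP (vcode v \in C).
      have -> : phi v @^-1` (EA A `&` FB B `&` GC C) =
         (\bigcap_t (X t @^-1` A t)) `*` (\bigcap_t (X t @^-1` B t)).
        by apply/seteqP; split=> [[w1 w2] [[/= ? ?] ?]|[w1 w2] [/= ? ?]]; split=> //=; rewrite inE in vC.
      rewrite mul1r /kA /lB -hX1// -hY1// -pr_product; first last.
      - by apply: bigcap_ord_measurable => t; exact: mXA.
      - by apply: bigcap_ord_measurable => t; exact: mXA.
      rewrite prE//; apply: measurableX; by apply: bigcap_ord_measurable => t; exact: mXA.
    have -> : phi v @^-1` (EA A `&` FB B `&` GC C) = set0.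
      by apply/seteqP; split=> [w0 [_ /= h]|//]; case/negP: vC; rewrite inE.
    by rewrite measure0 mul0r.
  rewrite {1}/pr PE; under eq_bigr do rewrite QE -EFinM.
  by rewrite sumEFin.
pose k0 := Ordinal kn0; pose j0 := Ordinal jn0.
pose K (o : OO) := vdecode k0 (fun v : W => v.1.1.2) o.1.
pose J (o : OO) := vdecode j0 (fun v : W => v.1.2) o.1.
pose CK k : set nat := [set u | vdecode k0 (fun v : W => v.1.1.2) u = k].
pose CJ j : set nat := [set u | vdecode j0 (fun v : W => v.1.2) u = j].
have KE k : K @^-1` [set k] = GC (CK k) by [].
have JE j : J @^-1` [set j] = GC (CJ j) by [].
have JKE j k : J @^-1` [set j] `&` K @^-1` [set k] = GC (CJ j `&` CK k) by [].
have inCK (v : W) k : (vcode v \in CK k) = (v.1.1.2 == k).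
  by rewrite -[in RHS](vcodeK k0 (fun v : W => v.1.1.2) v); apply/idP/eqP; rewrite inE.
have inCJK (v : W) j k : (vcode v \in CJ j `&` CK k) = (v.1.2 == j) && (v.1.1.2 == k).
  rewrite in_setI inCK; congr andb.
  by rewrite -[in RHS](vcodeK j0 (fun v : W => v.1.2) v); apply/idP/eqP; rewrite inE.
exists n, jn, kn; do 5 split => //.
exists _, OO, P, XX, K, J, YY.
split; first exact: mXX.
split; first exact: mYY.
split; first by move=> k; rewrite KE; exact: mGC.
split; first by move=> j; rewrite JE; exact: mGC.
split.
  move=> A mA k; rewrite -/(EA A) KE -[EA A]setIT -FBT.
  rewrite prE; last by do ?apply: measurableI => //; [exact: mEA|exact: mFB].
  rewrite RF//; congr EFin; rewrite big_pair4E.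
  under eq_bigr do under eq_bigr do under eq_bigr do under eq_bigr do rewrite inCK/= lBT mulr1 /q/=.
  transitivity (\sum_(x : {ffun 'I_n -> I}) ppow pI x / kn%:R * kA x A).
    apply: eq_bigr => x _; rewrite (bigD1 k)//= [X in _ + X]big1 ?addr0; last first.
      move=> k' /negPf k'k; rewrite big1// => j _; rewrite big1// => y _.
      by rewrite k'k mul0r mulr0.
    rewrite -(encs x k) mulr_suml; apply: eq_bigr => j _.
    under eq_bigr do rewrite eqxx mul1r mulrAC.
    by rewrite -mulr_sumr; case: (decP k j) => _ ->; rewrite mulr1.
  under eq_bigr do rewrite mulrAC.
  rewrite -mulr_suml; congr (_ / _).
  transitivity (\prod_t \sum_i pI i * pr (kap i) (A t)).
    rewrite -sum_ffun_prod; apply: eq_bigr => x _.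
    by rewrite /ppow /kA -big_split.
  by apply: eq_bigr => t _; rewrite -hX.
split.
  move=> A B mA mB j k /=; rewrite -/(EA A) -/(FB B) JKE.
  (* On the event J = j, K = k the probability of a pair of block events is the product a A * b B;
     conditional independence follows by comparing four such products. *)
  pose a A := \sum_(x : {ffun 'I_n -> I}) enc x k j * kA x A.
  pose b B := \sum_(y : {ffun 'I_n -> L}) dec k j y * lB y B.
  have RG A0 B0 : (forall t, measurable (A0 t)) -> (forall t, measurable (B0 t)) ->
      P (EA A0 `&` FB B0 `&` GC (CJ j `&` CK k)) = (a A0 * b B0)%:E.
    move=> mA0 mB0; rewrite prE; last first.
      by do ?apply: measurableI => //; [exact: mEA|exact: mFB].
    rewrite RF//; congr EFin; rewrite big_pair4E /a mulr_suml; apply: eq_bigr => x _.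
    rewrite (bigD1 k)//= [X in _ + X]big1 ?addr0; last first.
      move=> k' /negPf k'k; rewrite big1// => j' _; rewrite big1// => y _.
      by rewrite inCJK/= k'k andbF mul0r mulr0.
    rewrite (bigD1 j)//= [X in _ + X]big1 ?addr0; last first.
      move=> j' /negPf j'j; rewrite big1// => y _.
      by rewrite inCJK/= j'j mul0r mulr0.
    rewrite /b mulr_sumr; apply: eq_bigr => y _.
    by rewrite inCJK/= !eqxx mul1r /q/=; ring.
  have e0 := RG _ _ mA mB.
  have e1 := RG _ _ mT mT; rewrite EAT FBT !setTI in e1.
  have e2 := RG _ _ mA mT; rewrite FBT setIT in e2.
  have e3 := RG _ _ mT mB; rewrite EAT setTI in e3.
  rewrite e0 e1 e2 e3 -!EFinM; congr EFin; ring.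
split.
  move=> B mB; rewrite -/(FB B).
  have -> : FB B = EA (fun=> setT) `&` FB B `&` GC setT by rewrite EAT setTI setIT.
  rewrite prE; last by do ?apply: measurableI => //; [exact: mEA|exact: mFB].
  rewrite RF//; congr EFin; rewrite big_pair4E.
  under eq_bigr do under eq_bigr do under eq_bigr do under eq_bigr do rewrite in_setT kAT !mul1r /q/=.
  transitivity (\sum_(y : {ffun 'I_n -> L}) ppow pL y * lB y B).
    under [RHS]eq_bigr do rewrite -encdec mulr_suml.
    rewrite [RHS]exchange_big; apply: eq_bigr => x _.
    under [RHS]eq_bigr do rewrite mulr_suml.
    rewrite [RHS]exchange_big; apply: eq_bigr => k _.
    under [RHS]eq_bigr do rewrite mulr_suml.
    by rewrite [RHS]exchange_big.
  transitivity (\prod_t \sum_i pL i * pr (lam i) (B t)).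
    rewrite -sum_ffun_prod; apply: eq_bigr => x _.
    by rewrite /ppow /lB -big_split.
  by apply: eq_bigr => t _; rewrite -hXh.
apply: le_trans hDist; rewrite lee_pmul2l ?lte_fin ?invr_gt0 ?ltr0n//.
apply: lee_sum => t _.
have mDe : measurable_fun setT (fun z : T * T => (Delta z.1 z.2)%:E).
  exact/measurable_EFinP.
have mXY : measurable_fun setT (fun o : OO => (XX t o, YY t o)).
  exact: measurable_fun_pair.
have De0 (z : T * T) : (0 <= (Delta z.1 z.2)%:E)%E by rewrite lee_fin.
rewrite (Pint (fun o => (Delta (XX t o) (YY t o))%:E)); last 2 first.
- exact: (measurableT_comp mDe mXY).
- by move=> o; rewrite lee_fin.
rewrite big_pair4E; apply: lee_sum => x _; apply: lee_sum => k _; apply: lee_sum => j _.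
apply: lee_sum => y _; rewrite /q/=.
rewrite lee_wpmul2l//; first by rewrite lee_fin mulr_ge0//; case: (decP k j).
set v : W := (x, k, j, y).
have [_ Qint] := hQ v.
rewrite (Qint (fun o => (Delta (XX t o) (YY t o))%:E)); last 2 first.
- exact: (measurableT_comp mDe mXY).
- by move=> o; rewrite lee_fin.
have mX2 : measurable_fun setT (fun o : Om * Om => (X t o.1, X t o.2)).
  by apply: measurable_fun_pair; [exact: (measurableT_comp (mX t) measurable_fst)|exact: (measurableT_comp (mX t) measurable_snd)].
have [joint [jE jint]] := pushforward_probability ((PX v \x PY v)%E : probability _ R) mX2.
have := jint (fun z => (Delta z.1 z.2)%:E) mDe De0 => /= <-.
rewrite -(@fubini_tonelli1 _ _ _ _ _ (kap (x t)) (lam (y t)) (fun p => (Delta p.1 p.2)%:E))//.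
rewrite le_eqVlt; apply/orP; left; apply/eqP; apply/esym.
apply: eq_measure_integral => A mA _.
apply: product_measure_unique => // A0 B0 mA0 mB0.
have e1 : kap (x t) A0 = (pr (kap (x t)) A0)%:E by rewrite prE.
have e2 : lam (y t) B0 = (pr (lam (y t)) B0)%:E by rewrite prE.
have e3 : joint (A0 `*` B0) = (pr (kap (x t)) A0 * pr (lam (y t)) B0)%:E.
  rewrite prE; last exact: measurableX.
  rewrite {1}/pr jE -[fine _]/(pr ((PX v \x PY v)%E : probability _ R) ((X t @^-1` A0) `*` (X t @^-1` B0))).
  rewrite pr_product; [|exact: mXA|exact: mXA].
  congr (_ * _)%:E.
    by rewrite -(bigcap_only X t) hX1 ?(prod_only1 t)//; exact: only_measurable.
  by rewrite -(bigcap_only X t) hY1 ?(prod_only1 t)//; exact: only_measurable.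
apply: etrans e3 _; apply: esym; apply: etrans (congr2 mule e1 e2) _.
by rewrite -EFinM.
Qed.

End Realization.

Section StepAchievable.
Context {R : realType} d (T : measurableType d).

(** Delta may be unbounded, but its cell averages dd are finitely many; their sum serves as the
    bound dmax of the finite coding theorem. *)
Lemma step_achievable (V I L : finType) (w : V -> R) (a : V -> I -> R) (b : V -> L -> R)
    (kap : I -> probability T R) (lam : L -> probability T R)
    (pX pXh : probability T R) (Delta : T -> T -> R) (dd : I -> L -> R) (Rt Rc eps : R) :
  measurable_fun setT (fun z : T * T => Delta z.1 z.2) -> (forall x y, 0 <= Delta x y) ->
  fpmf w -> (forall v, fpmf (a v)) -> (forall v, fpmf (b v)) ->
  (forall A, measurable A -> pr pX A = \sum_i pout w a i * pr (kap i) A) ->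
  (forall A, measurable A -> pr pXh A = \sum_l pout w b l * pr (lam l) A) ->
  0 <= Rt -> 0 <= Rc -> pinfo w a <= Rt -> pinfo w b <= Rt + Rc -> 0 < eps ->
  (forall i l, (\int[kap i]_x \int[lam l]_y (Delta x y)%:E = (dd i l)%:E)%E) ->
  achievable pX pXh Delta Rt Rc (\sum_v w v * (\sum_i \sum_l a v i * b v l * dd i l) + eps).
Proof.
move=> mD D0 wp aP bP hX hXh Rt0 Rc0 Ia Ib eps0 hdd.
have dd0 i l : 0 <= dd i l.
  rewrite -lee_fin -hdd; apply: integral_ge0 => x _; apply: integral_ge0 => y _.
  by rewrite lee_fin.
pose dmax := \sum_i \sum_l dd i l.
have ddm i l : 0 <= dd i l <= dmax.
  rewrite dd0 /dmax (bigD1 i)//= (bigD1 l)//= -addrA lerDl addr_ge0 ?sumr_ge0// => i' _.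
  exact: sumr_ge0.
have [n [kn [jn [[n0 kn0 jn0] [lj [lk [enc [dec [enc0 decP encs encdec hd]]]]]]]]] :=
  block_codes_closed wp aP bP ddm Rt0 Rc0 Ia Ib eps0.
apply: (@realize_code R d T I L (pout w a) (pout w b) kap lam pX pXh Delta n kn jn Rt Rc _ enc dec)
  => //; first exact: pout_pmf.
apply: le_trans (_ : (_ <= (\sum_x \sum_k \sum_j \sum_y enc x k j * dec k j y *
        (n%:R^-1 * \sum_t dd (x t) (y t)))%:E)%E) _; last by rewrite lee_fin.
rewrite le_eqVlt; apply/orP; left; apply/eqP.
under eq_bigr do under eq_bigr do under eq_bigr do under eq_bigr do under eq_bigr do
  rewrite hdd -EFinM.
under eq_bigr do under eq_bigr do under eq_bigr do under eq_bigr do rewrite sumEFin.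
under eq_bigr do under eq_bigr do under eq_bigr do rewrite sumEFin.
under eq_bigr do under eq_bigr do rewrite sumEFin.
under eq_bigr do rewrite sumEFin.
rewrite sumEFin -EFinM; congr EFin.
rewrite mulr_sumr; under eq_bigr do rewrite mulr_sumr.
rewrite exchange_big; apply: eq_bigr => x _.
under eq_bigr do rewrite mulr_sumr.
rewrite exchange_big; apply: eq_bigr => k _.
under eq_bigr do rewrite mulr_sumr.
rewrite exchange_big; apply: eq_bigr => j _.
under eq_bigr do rewrite mulr_sumr.
rewrite exchange_big; apply: eq_bigr => y _.
rewrite -mulr_sumr mulrCA; congr (_ * _).
by rewrite -mulr_sumr.
Qed.

End StepAchievable.

(** * Approximation by step couplings *)

Section Approximation.
Context {R : realType}.

Section PrLemmas.
Context d (T : measurableType d) (P : probability T R).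

Lemma pr_setU_le A B : measurable A -> measurable B -> pr P (A `|` B) <= pr P A + pr P B.
Proof.
move=> mA mB; rewrite -lee_fin EFinD -!prE//; last exact: measurableU.
exact: measureU2.
Qed.

Lemma pr_setC A : measurable A -> pr P (~` A) = 1 - pr P A.
Proof.
move=> mA; apply: EFin_inj; rewrite -prE; last exact: measurableC.
by rewrite probability_setC// prE.
Qed.

Lemma pr_setD A B : measurable A -> measurable B -> B `<=` A ->
  pr P (A `\` B) = pr P A - pr P B.
Proof.
move=> mA mB BA; apply: EFin_inj; rewrite -prE; last exact: measurableD.
apply: etrans (measureD mA mB _) _; first by apply: le_lt_trans (probability_le1 P mA) (ltry _).
by rewrite (setIidr BA) EFinB; congr (_ - _)%E; exact: prE.
Qed.

Lemma pr_bigcup_approx (A : nat -> set T) eta : (forall n, measurable (A n)) ->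
  nondecreasing_seq A -> 0 < eta -> exists n, pr P (\bigcup_n A n) <= pr P (A n) + eta.
Proof.
move=> mA ndA eta0; apply: contrapT => /forallNP h.
have mU : measurable (\bigcup_n A n) by exact: bigcupT_measurable.
have : (P (\bigcup_n A n) <= (pr P (\bigcup_n A n) - eta)%:E)%E.
  have cv : (P \o A) n @[n --> \oo] --> P (\bigcup_n A n) by exact: nondecreasing_cvg_mu.
  rewrite -(cvg_lim _ cv)//; apply: lime_le; first by apply/cvg_ex; eexists; exact: cv.
  apply: nearW => n; rewrite /= prE// lee_fin.
  by have /negP := h n; rewrite -ltNge => h1; lra.
by rewrite prE// lee_fin => h1; lra.
Qed.

Definition symdiff (A B : set T) : set T := (A `\` B) `|` (B `\` A).

Lemma symdiffC A B : symdiff A B = symdiff B A.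
Proof. exact: setUC. Qed.

Lemma symdiff_measurable A B : measurable A -> measurable B -> measurable (symdiff A B).
Proof. by move=> mA mB; apply: measurableU; apply: measurableD. Qed.

Lemma pr_symdiffr A B : measurable A -> measurable B ->
  pr P A <= pr P B + pr P (symdiff A B).
Proof.
move=> mA mB; have mS := symdiff_measurable mA mB.
apply: le_trans (pr_setU_le mB mS); apply: le_pr => //; first exact: measurableU.
by move=> x Ax; have [Bx|nBx] := pselect (B x); [left|right; left].
Qed.

End PrLemmas.

(** Sets decided by finitely many labels of each coordinate: the algebra generated by the measurable
    rectangles. *)
Definition rect_alg d (T : measurableType d) (F : set (T * T)) : Prop :=
  exists (I L : finType) (al : T -> I) (be : T -> L) (S : pred (I * L)),
    [/\ fcell al, fcell be & F = [set z | S (al z.1, be z.2)]].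

Section RectAlg.
Context d (T : measurableType d).

Lemma rect_alg_measurable (F : set (T * T)) : rect_alg F -> measurable F.
Proof.
move=> [I [L [al [be [S [mal mbe ->]]]]]].
apply: (@fcell_pred _ _ _ (fun z : T * T => (al z.1, be z.2)) S).
apply: fcell_pair; [exact: (fcell_precomp measurable_fst mal)|exact: (fcell_precomp measurable_snd mbe)].
Qed.

Lemma rect_alg0 : rect_alg (set0 : set (T * T)).
Proof.
exists unit, unit, (fun _ => tt), (fun _ => tt), (fun _ => false).
by split; [exact: fcell_cst|exact: fcell_cst|apply/seteqP; split].
Qed.

Lemma rect_algC (F : set (T * T)) : rect_alg F -> rect_alg (~` F).
Proof.
move=> [I [L [al [be [S [mal mbe ->]]]]]].
exists I, L, al, be, (fun v => ~~ S v); split => //.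
by apply/seteqP; split=> z /= /negP.
Qed.

Lemma rect_algU (F G : set (T * T)) : rect_alg F -> rect_alg G -> rect_alg (F `|` G).
Proof.
move=> [I [L [al [be [S [mal mbe ->]]]]]] [I' [L' [al' [be' [S' [mal' mbe' ->]]]]]].
exists (I * I')%type, (L * L')%type, (fun x => (al x, al' x)), (fun x => (be x, be' x)).
exists (fun v => S (v.1.1, v.2.1) || S' (v.1.2, v.2.2)); split.
- exact: fcell_pair.
- exact: fcell_pair.
- by apply/seteqP; split=> z /= /orP.
Qed.

Lemma fcell_asbool (A : set T) : measurable A -> fcell (fun x => `[< A x >]).
Proof.
move=> mA [].
  rewrite (_ : _ @^-1` _ = A)//; apply/seteqP; split=> x /= /asboolP//.
rewrite (_ : _ @^-1` _ = ~` A); first exact: measurableC.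
by apply/seteqP; split=> x /= => [h /asboolP|/asboolF //]; rewrite h.
Qed.

Lemma rect_algX (A B : set T) : measurable A -> measurable B -> rect_alg (A `*` B).
Proof.
move=> mA mB; exists bool, bool, (fun x => `[< A x >]), (fun x => `[< B x >]).
exists (fun v => v.1 && v.2); split; [exact: fcell_asbool|exact: fcell_asbool|].
by apply/seteqP; split=> z /=; [move=> [? ?]; apply/andP; split; apply/asboolP|move=> /andP[/asboolP ? /asboolP ?]].
Qed.

(** The sets approximable in measure by the algebra form a sigma-algebra containing the rectangles.
    Countable unions are first cut to finite ones by continuity from below. *)
Lemma rect_alg_approx (P : probability (T * T)%type R) (E : set (T * T)) eta :
  measurable E -> 0 < eta -> exists2 F, rect_alg F & pr P (symdiff E F) <= eta.
Proof.
move=> mE; move: eta.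
pose G := [set E : set (T * T) | measurable E /\
   forall eta, 0 < eta -> exists2 F, rect_alg F & pr P (symdiff E F) <= eta].
suff : G E by case.
have symdiffxx (A : set (T * T)) : symdiff A A = set0 by rewrite /symdiff setDv setU0.
have Galg F : rect_alg F -> G F.
  move=> aF; split; first exact: rect_alg_measurable.
  by move=> eta eta0; exists F => //; rewrite symdiffxx /pr measure0 ltW.
have GU A B : G A -> G B -> G (A `|` B).
  move=> [mA hA] [mB hB]; split; first exact: measurableU.
  move=> eta eta0; have e2 : 0 < eta / 2 by rewrite divr_gt0.
  have [F aF hF] := hA _ e2; have [F' aF' hF'] := hB _ e2.
  have mF := rect_alg_measurable aF; have mF' := rect_alg_measurable aF'.
  exists (F `|` F'); first exact: rect_algU.
  have s1 := symdiff_measurable mA mF; have s2 := symdiff_measurable mB mF'.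
  apply: (@le_trans _ _ (pr P (symdiff A F `|` symdiff B F'))).
    apply: le_pr; [by apply: symdiff_measurable; exact: measurableU|exact: measurableU|].
    move=> x [[[Ax|Bx] nF]|[[Fx|Fx] nA]].
    - by left; left; split=> // Fx; apply: nF; left.
    - by right; left; split=> // Fx; apply: nF; right.
    - by left; right; split=> // Ax; apply: nA; left.
    - by right; right; split=> // Ax; apply: nA; right.
  by apply: le_trans (pr_setU_le P s1 s2) _; lra.
suff sG : sigma_algebra setT G.
  move: mE; rewrite measurable_prod_measurableType.
  apply: smallest_sub => // _ [A mA [B mB <-]]; apply: Galg; exact: rect_algX.
split.
- exact/Galg/rect_alg0.
- move=> A [mA hA]; rewrite setTD; split; first exact: measurableC.
  move=> eta eta0; have [F aF hF] := hA _ eta0; exists (~` F); first exact: rect_algC.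
  suff -> : symdiff (~` A) (~` F) = symdiff A F by [].
  by rewrite /symdiff !setDE !setCK setUC (setIC F) (setIC A).
move=> A hA.
pose B n := \big[setU/set0]_(k < n.+1) A k.
have GB n : G (B n).
  elim: n => [|n ih]; rewrite /B big_ord_recr/=.
    by rewrite big_ord0 set0U; exact: hA.
  by apply: GU => //; exact: hA.
have BA : \bigcup_n B n = \bigcup_n A n by exact: bigcup_bigsetU_bigcup.
have mUA : measurable (\bigcup_k A k) by apply: bigcupT_measurable => k; case: (hA k).
split=> // eta eta0; have e2 : 0 < eta / 2 by rewrite divr_gt0.
have ndB : nondecreasing_seq B by move=> m n mn; exact/subsetPset/subset_bigsetU.
have mB n : measurable (B n) by case: (GB n).
have [n hn] := pr_bigcup_approx P mB ndB e2.
have [_ hBn] := GB n; have [F aF hF] := hBn _ e2.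
have mF := rect_alg_measurable aF.
exists F => //.
have BnA : B n `<=` \bigcup_k A k by rewrite -BA => x Bx; exists n.
have mD : measurable (\bigcup_k A k `\` B n) by exact: measurableD.
have ms := symdiff_measurable (mB n) mF.
have hD : pr P (\bigcup_k A k `\` B n) <= eta / 2.
  rewrite pr_setD//; rewrite BA in hn; lra.
apply: (@le_trans _ _ (pr P ((\bigcup_k A k `\` B n) `|` symdiff (B n) F))).
  apply: le_pr; [exact: symdiff_measurable|exact: measurableU|].
  move=> x [[Ax nF]|[Fx nA]].
    by have [Bx|nB] := pselect (B n x); [right; left|left].
  by right; right; split=> // /BnA.
by apply: le_trans (pr_setU_le P mD ms) _; lra.
Qed.

(** The approximating set must be the same for P and Q, so it is taken for their half-half mixture
    M; an error e / 4 under M bounds the sum of the two errors by e / 2. *)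
Lemma rect_alg_dominates (P Q : probability (T * T)%type R) eps : 
  (forall F, rect_alg F -> pr P F <= pr Q F + eps) ->
  forall E, measurable E -> pr P E <= pr Q E + eps.
Proof.
move=> h E mE.
pose w (b : bool) : R := 2^-1.
have wp : fpmf w.
  split=> [b|]; first by rewrite /w invr_ge0.
  by rewrite big_bool /w/=; lra.
have [M [ME _]] := mixture_probability (fun b => if b then P else Q) wp.
have prM A : measurable A -> pr M A = 2^-1 * pr P A + 2^-1 * pr Q A.
  move=> mA; rewrite {1}/pr ME big_bool/=.
  by rewrite !prE// -!EFinM -EFinD.
apply/ler_addgt0Pr => e e0.
have e4 : 0 < e / 4 by rewrite divr_gt0.
have [F aF hF] := rect_alg_approx M mE e4.
have mF := rect_alg_measurable aF.
have ms := symdiff_measurable mE mF.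
move: hF; rewrite prM// => hF.
have h1 := pr_symdiffr P mE mF.
have := pr_symdiffr Q mF mE; rewrite symdiffC => h2.
have h3 := h _ aF.
have p0 := pr_ge0 P (symdiff E F); have q0 := pr_ge0 Q (symdiff E F).
lra.
Qed.

End RectAlg.

(** Below the level N h, Delta is within h of a step function whose integral is a sum of N tail
    probabilities, and so grows by at most N h e0 when pi is replaced by pi'. Above that level
    uniform integrability bounds the integral under pi' by h. The three errors add up to eps = 3 h;
    only a one-sided comparison of pi' with pi enters. *)
Lemma ui_transfer d (T : measurableType d) (pX pXh : probability T R) (Delta : T -> T -> R)
    (pi : probability (T * T)%type R) eps :
  measurable_fun setT (fun z : T * T => Delta z.1 z.2) -> (forall x y, 0 <= Delta x y) ->
  unif_integrable pX pXh Delta -> 0 < eps ->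
  exists2 e0, 0 < e0 & forall pi' : probability (T * T)%type R,
    (forall A, measurable A -> pi' (A `*` setT) = pX A) ->
    (forall B, measurable B -> pi' (setT `*` B) = pXh B) ->
    (forall E, measurable E -> pr pi' E <= pr pi E + e0) ->
    (\int[pi']_z (Delta z.1 z.2)%:E <= \int[pi]_z (Delta z.1 z.2)%:E + eps%:E)%E.
Proof.
move=> mD D0 ui eps0.
pose h := eps / 3; have h0 : 0 < h by rewrite divr_gt0.
have [delta [delta0 hdelta]] := ui _ h0.
pose f (z : T * T) := Delta z.1 z.2.
pose A n := [set z | f z < n%:R * h].
have mA n : measurable (A n).
  rewrite (_ : A n = setT `&` f @^-1` `]-oo, n%:R * h[).
    by apply: mD => //.
  by rewrite setTI; apply/seteqP; split=> z /=; rewrite in_itv.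
have ndA : nondecreasing_seq A.
  move=> m n mn; apply/subsetPset => z /= fz; apply: lt_le_trans fz _.
  by rewrite ler_pM2r// ler_nat.
have AT : \bigcup_n A n = setT.
  apply/seteqP; split=> // z _; exists (Num.truncn (f z / h)).+1 => //; rewrite /A /mkset.
  have fh : 0 <= f z / h by apply: divr_ge0; [exact: D0|exact: ltW].
  by rewrite -ltr_pdivrMr//; case/andP: (truncn_itv fh).
have d2 : 0 < delta / 2 by rewrite divr_gt0.
have [N hN] := pr_bigcup_approx pi mA ndA d2.
rewrite AT pr_setT in hN.
(* The first bound keeps the mass of pi' above level N h below delta; the second gives N h e0 <= h,
   with + 1 covering N = 0. *)
pose e0 := Num.min (delta / 2) (h / (N%:R * h + 1)).
have Nh0 : 0 < N%:R * h + 1 by rewrite ltr_wpDl// mulr_ge0// ltW.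
have e00 : 0 < e0 by rewrite lt_min d2 divr_gt0.
exists e0 => // pi' c1 c2 tv.
have mfE : measurable_fun setT (fun z => (f z)%:E) by exact/measurable_EFinP.
have f0 z : 0 <= f z by exact: D0.
have fE0 z : (0 <= (f z)%:E)%E by rewrite lee_fin.
(* The sum is f rounded down to a multiple of h and capped at M h. *)
have step M z : [/\ \sum_(k < M) h * \1_(~` A k.+1) z <= f z,
    (f z < M%:R * h -> f z <= \sum_(k < M) h * \1_(~` A k.+1) z + h) &
    (M%:R * h <= f z -> \sum_(k < M) h * \1_(~` A k.+1) z = M%:R * h)].
  elim: M => [|M [s1 s2 s3]].
    rewrite big_ord0 mul0r; split=> // fz.
    by rewrite add0r (le_trans (ltW fz))// ltW.
  rewrite big_ord_recr/= indicE.
  have [fz|fz] := ltP (f z) (M.+1%:R * h).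
    have -> : (z \in ~` A M.+1) = false by apply/negbTE; rewrite notin_setE /A /=; apply; exact: fz.
    rewrite mulr0 addr0; split=> // _.
    have [fM|fM] := ltP (f z) (M%:R * h); first exact: s2.
    by rewrite s3//; move: fz; rewrite -natr1 mulrDl mul1r => /ltW.
  have -> : (z \in ~` A M.+1) = true by apply: mem_set; rewrite /A /=; apply/negP; rewrite -leNgt.
  have fM : M%:R * h <= f z by apply: le_trans fz; rewrite ler_pM2r// ler_nat.
  have NE : (M.+1%:R * h : R) = M%:R * h + h by rewrite -natr1 mulrDl mul1r.
  by rewrite s3// mulr1 -NE; split.
pose s z : R := \sum_(k < N) h * \1_(~` A k.+1) z.
have mAC k : measurable (~` A k) by exact: measurableC.
have s0 z : 0 <= s z by apply: sumr_ge0 => k _; rewrite mulr_ge0 ?(ltW h0)// indicE.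
have ms : measurable_fun setT (fun z => (s z)%:E).
  apply/measurable_EFinP; rewrite /s; apply: measurable_sum => k.
  by apply: measurable_funM => //; exact: measurable_indic.
pose S (P : probability (T * T)%type R) : R := \sum_(k < N) h * pr P (~` A k.+1).
have ints (P : probability (T * T)%type R) : (\int[P]_z (s z)%:E = (S P)%:E)%E.
  under eq_integral do rewrite /s -sumEFin.
  rewrite ge0_integral_sum//.
  - rewrite -sumEFin; apply: eq_bigr => k _.
    under eq_integral do rewrite EFinM.
    rewrite ge0_integralZl_EFin//; last 2 first.
    + exact/measurable_EFinP/measurable_indic.
    + exact: ltW.
    rewrite integral_indic// setIT; exact: (congr2 mule (erefl h%:E) (prE P (mAC k.+1))).
  - move=> k; apply/measurable_EFinP.
    by apply: measurable_funM => //; exact: measurable_indic.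
  - by move=> k z _; rewrite lee_fin mulr_ge0 ?(ltW h0)// indicE.
have h1 : ((S pi)%:E <= \int[pi]_z (f z)%:E)%E.
  rewrite -ints; apply: ge0_le_integral => // z _; rewrite lee_fin//.
  by have [] := step N z.
have h2 : S pi' <= S pi + h.
  apply: (@le_trans _ _ (\sum_(k < N) (h * pr pi (~` A k.+1) + h * e0))).
    by apply: ler_sum => k _; rewrite -mulrDr ler_pM2l// tv.
  rewrite big_split/= lerD2l sumr_const card_ord -mulr_natl mulrA.
  have : e0 <= h / (N%:R * h + 1) by rewrite /e0 ge_min lexx orbT.
  move=> he; apply: (@le_trans _ _ (N%:R * h * (h / (N%:R * h + 1)))).
    by rewrite ler_wpM2l// mulr_ge0// ltW.
  by rewrite mulrA ler_pdivrMr// mulrC ler_pM2l// lerDl.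
have h3 : (\int[pi']_(z in ~` A N) (f z)%:E <= h%:E)%E.
  apply: hdelta => //; rewrite prE// lee_fin.
  apply: le_trans (tv _ (mAC N)) _; rewrite pr_setC//.
  have : e0 <= delta / 2 by rewrite /e0 ge_min lexx.
  lra.
have h4 : (\int[pi']_(z in A N) (f z)%:E <= (S pi')%:E + h%:E)%E.
  have <- : (\int[pi']_z ((s z)%:E + h%:E) = (S pi')%:E + h%:E)%E.
    rewrite ge0_integralD//; first by rewrite ints probability_integral_cst.
    - by move=> z _; rewrite lee_fin.
    - by move=> z _; rewrite lee_fin ltW.
  apply: (@le_trans _ _ (\int[pi']_(z in A N) ((s z)%:E + h%:E))%E).
    apply: ge0_le_integral => //.
    - exact: measurable_funTS.
    - by apply: emeasurable_funD; [exact: measurable_funTS|exact: measurable_cst].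
    - by move=> z Az; rewrite -EFinD lee_fin; have [_ + _] := step N z; apply.
  apply: ge0_subset_integral => //.
  - by apply: emeasurable_funD => //; exact: measurable_cst.
  - by move=> z _; rewrite -EFinD lee_fin addr_ge0// ltW.
have -> : (\int[pi']_z (f z)%:E = \int[pi']_(z in A N) (f z)%:E + \int[pi']_(z in ~` A N) (f z)%:E)%E.
  rewrite -ge0_integral_setU//; first by rewrite setUv.
  - by rewrite setUv.
  - by apply/disj_set2P; rewrite setICr.
apply: (le_trans (leeD h4 h3)).
apply: (@le_trans _ _ ((S pi)%:E + eps%:E)%E); last exact: leeD2r.
rewrite -!EFinD lee_fin.
have : h * 3 = eps by rewrite /h mulfVK.
lra.
Qed.

End Approximation.

(** * Step approximations of finite joint laws *)

Section FiniteSteps.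
Context {R : realType}.

(** Two couplings through v, each a product of conditional laws given v. One factor is changed at a
    time, and the other factor, summed over its letter, is at most PV v. *)
Lemma product_step_dist (I L V : finType) (S : pred (I * L)) (P1 m1 : I -> V -> R)
    (P2 m2 : L -> V -> R) (PV : V -> R) :
  (forall i v, 0 <= P1 i v) -> (forall l v, 0 <= m2 l v) -> (forall v, 0 <= PV v) ->
  (forall v, \sum_i P1 i v <= PV v) -> (forall v, \sum_l m2 l v <= PV v) ->
  \sum_(c | S c) \sum_v m1 c.1 v * m2 c.2 v / PV v <=
  \sum_(c | S c) \sum_v P1 c.1 v * P2 c.2 v / PV v +
  (\sum_i \sum_v `|P1 i v - m1 i v| + \sum_l \sum_v `|P2 l v - m2 l v|).
Proof.
move=> P10 m20 PV0 sP1 sm2.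
rewrite -lerBlDl -sumrB.
apply: (@le_trans _ _ (\sum_(c : I * L) \sum_v
  (`|P1 c.1 v - m1 c.1 v| * m2 c.2 v + P1 c.1 v * `|P2 c.2 v - m2 c.2 v|) / PV v)).
  rewrite [leRHS](bigID S)/= -[leLHS]addr0; apply: lerD; last first.
    apply: sumr_ge0 => c _; apply: sumr_ge0 => v _.
    by rewrite divr_ge0// addr_ge0// mulr_ge0.
  apply: ler_sum => c _; rewrite -sumrB; apply: ler_sum => v _.
  rewrite -mulrBl ler_wpM2r ?invr_ge0//.
  have -> : m1 c.1 v * m2 c.2 v - P1 c.1 v * P2 c.2 v =
     - (P1 c.1 v - m1 c.1 v) * m2 c.2 v + P1 c.1 v * - (P2 c.2 v - m2 c.2 v) by ring.
  by apply: lerD; [rewrite ler_wpM2r//|rewrite ler_wpM2l//]; rewrite -normrN ler_norm.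
under eq_bigr do under eq_bigr do rewrite mulrDl.
under eq_bigr do rewrite big_split/=.
rewrite big_split/=; apply: lerD.
  rewrite big_pairE/=; apply: ler_sum => i _; rewrite exchange_big/=; apply: ler_sum => v _.
  rewrite -mulr_suml -mulr_sumr -mulrA ler_piMr//.
  have [->|pn] := eqVneq (PV v) 0; first by rewrite invr0 mulr0.
  by rewrite ler_pdivrMr ?mul1r// lt0r pn PV0.
rewrite big_pairE/= exchange_big/=; apply: ler_sum => l _; rewrite exchange_big/=; apply: ler_sum => v _.
rewrite -mulr_suml -mulr_suml mulrAC ler_piMl//.
have [->|pn] := eqVneq (PV v) 0; first by rewrite invr0 mulr0.
by rewrite ler_pdivrMr ?mul1r// lt0r pn PV0.
Qed.

Section StepClose.
Variables (I V I' V' : finType) (al : I' -> I) (ga : V' -> V) (P : I' -> V' -> R).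
Hypotheses (P0 : forall i v, 0 <= P i v) (P1 : \sum_i \sum_v P i v = 1).
Let PI i := \sum_v P i v.
Let PV v := \sum_i P i v.
Let Q i v := \sum_(i' | al i' == i) \sum_(v' | ga v' == v) P i' v'.
Let QI i := \sum_(i' | al i' == i) PI i'.
Let QV v := \sum_(v' | ga v' == v) PV v'.

(** The step approximation: the mass of each coarse cell is spread inside it proportionally to the
    product of the fine marginals. *)
Definition step_mass i v := Q (al i) (ga v) * (PI i * PV v) / (QI (al i) * QV (ga v)).

Let PI0 i : 0 <= PI i. Proof. by apply: sumr_ge0. Qed.
Let PV0 v : 0 <= PV v. Proof. by apply: sumr_ge0. Qed.
Let Q0 i v : 0 <= Q i v. Proof. by do 2 (apply: sumr_ge0 => ? _). Qed.
Let QI0 i : 0 <= QI i. Proof. by apply: sumr_ge0. Qed.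
Let QV0 v : 0 <= QV v. Proof. by apply: sumr_ge0. Qed.

Lemma step_mass_ge0 i v : 0 <= step_mass i v.
Proof. by rewrite divr_ge0 ?mulr_ge0. Qed.

Lemma step_mass_sum v : \sum_i step_mass i v <= PV v.
Proof.
have QVE v0 : \sum_i Q i v0 = QV v0.
  rewrite /Q /QV /PV [RHS]exchange_big/= [RHS](partition_big al predT)//=.
have e i : step_mass i v = (PV v / QV (ga v)) * (Q (al i) (ga v) / QI (al i) * PI i).
  by rewrite /step_mass invfM; ring.
under eq_bigr do rewrite e.
rewrite -mulr_sumr.
have s1 : \sum_i Q (al i) (ga v) / QI (al i) * PI i <= QV (ga v).
  rewrite -QVE (partition_big al predT)//=; apply: ler_sum => i0 _.
  under eq_bigr => i /eqP -> do [].
  rewrite -mulr_sumr -/(QI i0).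
  have [->|qn] := eqVneq (QI i0) 0; first by rewrite mulr0.
  by rewrite mulfVK.
apply: (@le_trans _ _ (PV v / QV (ga v) * QV (ga v))).
  by rewrite ler_wpM2l// divr_ge0.
have [->|qn] := eqVneq (QV (ga v)) 0; first by rewrite mulr0.
by rewrite mulfVK.
Qed.

(** By [kl_step] the divergence of P from its step approximation is the gain of information under
    refinement, here at most eta; summing [kl_term_dist] turns it into an L1 bound. *)
Lemma step_close eta l : 0 < l ->
  \sum_i \sum_v kl_term (P i v) (PI i * PV v) <=
    \sum_i \sum_v kl_term (Q i v) (QI i * QV v) + eta ->
  \sum_i \sum_v `|P i v - step_mass i v| <= eta / (2 * l) + 2 * l.
Proof.
move=> l0 h.
have PPI i v : P i v <= PI i by rewrite /PI (bigD1 v)//= lerDl sumr_ge0.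
have PPV i v : P i v <= PV v by rewrite /PV (bigD1 i)//= lerDl sumr_ge0.
have PIQ i : PI i <= QI (al i) by rewrite /QI (bigD1 i)//= lerDl sumr_ge0.
have PVQ v : PV v <= QV (ga v) by rewrite /QV (bigD1 v)//= lerDl sumr_ge0.
have PQ i v : P i v <= Q (al i) (ga v).
  rewrite /Q (bigD1 i)//= (bigD1 v)//= -addrA lerDl addr_ge0 ?sumr_ge0// => i' _.
  exact: sumr_ge0.
have ac i v : 0 < P i v -> 0 < step_mass i v.
  move=> p; have h1 := lt_le_trans p (PPI i v); have h2 := lt_le_trans p (PPV i v).
  have h3 := lt_le_trans h1 (PIQ i); have h4 := lt_le_trans h2 (PVQ v).
  have h5 := lt_le_trans p (PQ i v).
  by rewrite divr_gt0 ?mulr_gt0.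
have PVs : \sum_v PV v = 1 by rewrite /PV exchange_big.
have ms : \sum_i \sum_v step_mass i v <= 1.
  rewrite exchange_big/= -PVs; apply: ler_sum => v _; exact: step_mass_sum.
have kl : \sum_i \sum_v kl_term (P i v) (step_mass i v) <= eta.
  by rewrite (kl_step al ga P0) lerBlDl.
have l2 : 0 < 2 * l by rewrite mulr_gt0.
rewrite -(ler_pM2l l2).
have -> : 2 * l * (eta / (2 * l) + 2 * l) = eta + 4 * l ^+ 2 by field; rewrite gt_eqF.
rewrite mulr_sumr; under eq_bigr do rewrite mulr_sumr.
apply: (@le_trans _ _ (\sum_i \sum_v (kl_term (P i v) (step_mass i v) - P i v + step_mass i v
   + 2 * l ^+ 2 * (P i v + step_mass i v)))).
  apply: ler_sum => i _; apply: ler_sum => v _.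
  exact: kl_term_dist l0 (P0 i v) (step_mass_ge0 i v) (@ac i v).
under eq_bigr do rewrite !big_split/= sumrN -mulr_sumr big_split/=.
rewrite !big_split/= sumrN -mulr_sumr big_split/= P1.
have : l ^+ 2 * (\sum_i \sum_v step_mass i v) <= l ^+ 2 by rewrite ler_piMr// sqr_ge0.
set s := \sum_i \sum_v step_mass i v in ms *.
lra.
Qed.

End StepClose.

(** Conditional law of i given v, with the marginal of i as default when v has mass zero, so that
    every row is a probability. *)
Definition condc (I V : finType) (P : I -> V -> R) (v : V) (i : I) : R :=
  if \sum_j P j v == 0 then \sum_u P i u else P i v / \sum_j P j v.

Section Condc.
Variables (I V : finType) (P : I -> V -> R).
Hypotheses (P0 : forall i v, 0 <= P i v) (P1 : \sum_i \sum_v P i v = 1).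
Let w v := \sum_j P j v.

Lemma condcM v i : w v * condc P v i = P i v.
Proof.
rewrite /condc -/(w v); have [w0|wn] := eqVneq (w v) 0; last by rewrite mulrCA mulfV ?mulr1.
by rewrite w0 mul0r; apply/esym; apply: (sum_max0_eq0 (fun j => P0 j v) w0).
Qed.

Lemma condc_pmf v : fpmf (condc P v).
Proof.
rewrite /condc -/(w v); have [w0|wn] := eqVneq (w v) 0; split=> //.
- by move=> i; apply: sumr_ge0.
- by move=> i; rewrite divr_ge0// sumr_ge0.
- by rewrite -mulr_suml mulfV.
Qed.

Lemma pout_condc i : pout w (condc P) i = \sum_v P i v.
Proof. by apply: eq_bigr => v _; exact: condcM. Qed.

Lemma pinfo_condc : pinfo w (condc P) =
  \sum_i \sum_v kl_term (P i v) ((\sum_u P i u) * w v).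
Proof.
rewrite [RHS]exchange_big/=; apply: eq_bigr => v _; rewrite mulr_sumr; apply: eq_bigr => i _.
rewrite pout_condc; have [w0|wn] := eqVneq (w v) 0.
  have -> : P i v = 0 by apply: (sum_max0_eq0 (fun j => P0 j v) w0).
  by rewrite w0 mul0r /kl_term ltxx.
have wp : 0 < w v by rewrite lt0r wn sumr_ge0.
by rewrite -kl_termM// condcM [w v * _]mulrC.
Qed.

End Condc.

End FiniteSteps.

Section Levels.
Context {R : realType} d (U : measurableType d).

Lemma fcell_ffun (C J : finType) (f : C -> U -> J) :
  (forall c, fcell (f c)) -> fcell (fun u => [ffun c => f c u]).
Proof.
move=> mf x.
have -> : (fun u => [ffun c => f c u]) @^-1` [set x] = \bigcap_c (f c @^-1` [set x c]).
  apply/seteqP; split=> [u /= <- c _ /=|u h]; first by rewrite ffunE.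
  by apply/ffunP => c; rewrite ffunE; exact: h.
rewrite -[X in measurable X]setCK setC_bigcap; apply: measurableC.
apply: fin_bigcup_measurable => [|c _]; first exact: finite_finset.
by apply: measurableC; exact: mf.
Qed.

(** Rounds (N + 1) x down. The point x = 1 gets label N + 1, hence N + 2 labels. *)
Definition level (N : nat) (x : R) : 'I_N.+2 := inord (Num.truncn (N.+1%:R * x)).

Lemma levelP N x : 0 <= x <= 1 ->
  (level N x)%:R <= N.+1%:R * x < (level N x)%:R + 1.
Proof.
move=> /andP[x0 x1].
have Nx0 : 0 <= N.+1%:R * x by rewrite mulr_ge0.
have /andP[h1 h2] := truncn_itv Nx0.
have lt : (Num.truncn (N.+1%:R * x) < N.+2)%N.
  have : (Num.truncn (N.+1%:R * x))%:R <= (N.+1%:R : R).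
    by apply: le_trans h1 _; rewrite ler_piMr.
  by rewrite ler_nat ltnS.
by rewrite /level inordK// h1/= natr1.
Qed.

Lemma fcell_level N (f : U -> R) : measurable_fun setT f -> (forall u, 0 <= f u <= 1) ->
  fcell (fun u => level N (f u)).
Proof.
move=> mf f01 k.
have -> : (fun u => level N (f u)) @^-1` [set k] =
    setT `&` f @^-1` `[k%:R / N.+1%:R, (k%:R + 1) / N.+1%:R[.
  have N0 : (0 : R) < N.+1%:R by [].
  rewrite setTI; apply/seteqP; split=> u /=; rewrite in_itv/= ler_pdivrMr// ltr_pdivlMr// ![f u * _]mulrC.
    by move=> <-; exact: levelP.
  move=> /andP[h1 h2]; have /andP[h3 h4] := levelP N (f01 u).
  apply/val_inj/eqP; rewrite /= eqn_leq; apply/andP; split.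
    by rewrite -ltnS -(ltr_nat R) -natr1 (le_lt_trans h3 h2).
  by rewrite -ltnS -(ltr_nat R) -[ltRHS]natr1 (le_lt_trans h1 h4).
by apply: mf => //; exact: measurable_itv.
Qed.

End Levels.

Section CondIndep.
Context {R : realType} dO (Om : measurableType dO) (p : probability Om R)
  d1 (T1 : measurableType d1) d2 (U : measurableType d2) d3 (T3 : measurableType d3).
Variables (f : Om -> T1) (g : Om -> U) (h : Om -> T3).
Hypotheses (mf : measurable_fun setT f) (mg : measurable_fun setT g) (mh : measurable_fun setT h).

Let mpre d0 (T0 : measurableType d0) (k : Om -> T0) A :
  measurable_fun setT k -> measurable A -> measurable (k @^-1` A).
Proof. by move=> mk mA; rewrite -[X in measurable X]setTI; apply: mk. Qed.

(* Refining the conditioning variable by the level sets of the conditional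
   probability of [f @^-1` A] makes it nearly constant on every cell. *)
Lemma cond_indep_levels A B (N : nat) : cond_indep p f g h -> measurable A -> measurable B ->
  exists lev : U -> 'I_N.+2, fcell lev /\ forall C k, measurable C ->
    (C `<=` lev @^-1` [set k]) ->
    pr p (f @^-1` A `&` g @^-1` C) * pr p (h @^-1` B `&` g @^-1` C) / pr p (g @^-1` C)
      - pr p (h @^-1` B `&` g @^-1` C) / N.+1%:R <=
    pr p (f @^-1` A `&` h @^-1` B `&` g @^-1` C).
Proof.
move=> ci mA mB; have [a [b [ma [mb [a01 [b01 hab]]]]]] := ci A B mA mB.
exists (fun u => level N (a u)); split; first exact: fcell_level.
move=> C k mC Ck.
have N0 : (0 : R) < N.+1%:R by [].
have [e1 [e2 e3]] := hab C mC.
have mgC := mpre mg mC.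
have mfA := mpre mf mA; have mhB := mpre mh mB.
have ma' : measurable_fun setT (fun w => (a (g w))%:E).
  by apply/measurable_EFinP; exact: measurableT_comp.
have mb' : measurable_fun setT (fun w => (b (g w))%:E).
  by apply/measurable_EFinP; exact: measurableT_comp.
have mab : measurable_fun setT (fun w => (a (g w) * b (g w))%:E).
  by apply/measurable_EFinP; apply: measurable_funM; exact: measurableT_comp.
have lv w : (g @^-1` C) w -> k%:R / N.+1%:R <= a (g w) <= (k%:R + 1) / N.+1%:R.
  move=> /Ck /= <-; have /andP[h1 h2] := levelP N (a01 (g w)).
  by rewrite ler_pdivrMr// ler_pdivlMr// ![a _ * _]mulrC h1 ltW.
have k1 : 0 <= (k%:R + 1) / N.+1%:R :> R by rewrite divr_ge0// addr_ge0.
have k0 : 0 <= k%:R / N.+1%:R :> R by rewrite divr_ge0.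
have a0 u : 0 <= a u by case/andP: (a01 u).
have b0 u : 0 <= b u by case/andP: (b01 u).
(* On C the function a lies between k / (N + 1) and (k + 1) / (N + 1): the upper value bounds the
   factor for f, the lower one the joint probability. *)
have i1 : pr p (f @^-1` A `&` g @^-1` C) <= (k%:R + 1) / N.+1%:R * pr p (g @^-1` C).
  rewrite -lee_fin -prE; last exact: measurableI.
  rewrite e1 EFinM -prE//.
  rewrite -[X in (_ <= _ * p X)%E]setTI -integral_cst//.
    apply: (@le_trans _ _ (\int[p]_(w in g @^-1` C) ((k%:R + 1) / N.+1%:R)%:E)%E).
      apply: ge0_le_integral => //.
      - by move=> w _; rewrite lee_fin.
      - exact: measurable_funTS.
      - by move=> w /lv /andP[_ ?]; rewrite lee_fin.
    by rewrite setTI.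
  by rewrite setTI.
have i2 : k%:R / N.+1%:R * pr p (h @^-1` B `&` g @^-1` C) <= pr p (f @^-1` A `&` h @^-1` B `&` g @^-1` C).
  rewrite -lee_fin -prE; last by apply: measurableI => //; exact: measurableI.
  rewrite e3 EFinM -prE; last exact: measurableI.
  rewrite e2 -ge0_integralZl//; last 2 first.
  - exact: measurable_funTS.
  - by move=> w _; rewrite lee_fin.
  apply: ge0_le_integral => //.
  - by move=> w _; rewrite -EFinM lee_fin mulr_ge0.
  - by apply: measurable_funTS; apply: measurable_funeM.
  - exact: measurable_funTS.
  - by move=> w /lv /andP[? _]; rewrite -EFinM lee_fin ler_wpM2r.
have [pz|pn] := eqVneq (pr p (g @^-1` C)) 0.
  rewrite pz invr0 mulr0 sub0r; apply: le_trans (pr_ge0 _ _).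
  by rewrite oppr_le0 divr_ge0// pr_ge0.
have pp : 0 < pr p (g @^-1` C) by rewrite lt0r pn pr_ge0.
apply: le_trans i2.
rewrite mulrAC [X in _ - X]mulrC -mulrBl ler_wpM2r ?pr_ge0//.
by rewrite lerBlDr ler_pdivrMr//; move: i1; rewrite (mulrDl k%:R) mul1r.
Qed.

End CondIndep.

(** * Total variation between a law and its quantized coupling *)

Section Quantization.
Context {R : realType} d (T : measurableType d) dU (U : measurableType dU).

(** On null cells the law is pX itself, so every cell law is dominated by a multiple of pX; this
    later makes the cell averages of Delta finite. *)
Lemma cell_laws (I : finType) (pX : probability T R) (al : T -> I) : fcell al ->
  exists kap : I -> probability T R,
    [/\ (forall i A, measurable A ->
          pr pX (A `&` al @^-1` [set i]) = pr1 pX al i * pr (kap i) A),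
      (forall A, measurable A -> pr pX A = \sum_i pr1 pX al i * pr (kap i) A) &
      (forall i, exists2 c : R, 0 <= c & forall g : T -> \bar R, measurable_fun setT g ->
          (forall x, 0 <= g x)%E -> (\int[kap i]_x g x <= c%:E * \int[pX]_x g x)%E)].
Proof.
move=> mal.
have [Q hQ] := choice (fun i => conditional_law pX (mal i)).
pose kap i := if pr1 pX al i == 0 then pX else Q i.
have kE i A : measurable A -> pr pX (A `&` al @^-1` [set i]) = pr1 pX al i * pr (kap i) A.
  move=> mA; rewrite hQ// -/(pr1 _ _ _) /kap; case: eqP => // ->.
  by rewrite !mul0r.
exists kap; split => //.
  move=> A mA; rewrite (pr_cells pX mal mA); apply: eq_bigr => i _; exact: kE.
move=> i; rewrite /kap; case: eqP => [_|/eqP pn].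
  by exists 1 => // g _ _; rewrite mul1e.
have pp : 0 < pr1 pX al i by rewrite lt0r pn pr_ge0.
exists (pr1 pX al i)^-1; first by rewrite invr_ge0 ltW.
move=> g mg g0; rewrite (integral_total_law mal kE mg g0).
rewrite (bigD1 i)//= {1}/kap (negPf pn).
rewrite lee_pdivlMl// leeDl//; apply: sume_ge0 => j _.
by rewrite mule_ge0 ?lee_fin ?pr_ge0// integral_ge0.
Qed.

Variables (p : probability ((T * U) * T)%type R) (pX pXh : probability T R).
Let f1 (z : (T * U) * T) : T := z.1.1.
Let gu (z : (T * U) * T) : U := z.1.2.
Let f2 (z : (T * U) * T) : T := z.2.
Hypotheses (hX : forall A, measurable A -> pr p (f1 @^-1` A) = pr pX A)
  (hXh : forall B, measurable B -> pr p (f2 @^-1` B) = pr pXh B)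
  (ci : cond_indep p f1 gu f2).
Variables (I V L : finType) (al : T -> I) (ga : U -> V) (be : T -> L).
Hypotheses (mal : fcell al) (mga : fcell ga) (mbe : fcell be).

Let mf1 : measurable_fun setT f1.
Proof. exact: (measurableT_comp measurable_fst measurable_fst). Qed.
Let mgu : measurable_fun setT gu.
Proof. exact: (measurableT_comp measurable_snd measurable_fst). Qed.
Let mf2 : measurable_fun setT f2. Proof. exact: measurable_snd. Qed.

Let P1 := pr2 p (fun z => al (f1 z)) (fun z => ga (gu z)).
Let P2 := pr2 p (fun z => be (f2 z)) (fun z => ga (gu z)).
Let w := pr1 p (fun z => ga (gu z)).

Definition step_weight (i : I) (l : L) : R := \sum_v w v * (condc P1 v i * condc P2 v l).

(** The labels defining F are added to al and be, and U is cut further by levels of conditional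
    probabilities. On these finer cells p is nearly a mixture of products Q1 Q2 / QV ([claimA]),
    while pi' is exactly the mixture M1 M2 / QV of step approximations ([claimB]). Near-optimality
    of al, be and ga makes M1 and M2 close to Q1 and Q2. *)
Lemma quantized_tv (kap : I -> probability T R) (lam : L -> probability T R)
    (pi' : probability (T * T)%type R) (eta lm eps : R) :
  (forall i A, measurable A -> pr pX (A `&` al @^-1` [set i]) = pr1 pX al i * pr (kap i) A) ->
  (forall i A, measurable A -> pr pXh (A `&` be @^-1` [set i]) = pr1 pXh be i * pr (lam i) A) ->
  (forall A B, measurable A -> measurable B -> pr pi' (A `*` B) =
     \sum_i \sum_l step_weight i l * (pr (kap i) A * pr (lam l) B)) ->
  (forall (I' V' : finType) (al' : T -> I') (ga' : U -> V'), fcell al' -> fcell ga' ->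
     fmi p (fun z => al' (f1 z)) (fun z => ga' (gu z)) <=
     fmi p (fun z => al (f1 z)) (fun z => ga (gu z)) + eta) ->
  (forall (L' V' : finType) (be' : T -> L') (ga' : U -> V'), fcell be' -> fcell ga' ->
     fmi p (fun z => be' (f2 z)) (fun z => ga' (gu z)) <=
     fmi p (fun z => be (f2 z)) (fun z => ga (gu z)) + eta) ->
  0 < lm -> 0 < eps ->
  forall F, rect_alg F ->
  pr pi' F <= pr p [set z | F (f1 z, f2 z)] + (2 * (eta / (2 * lm) + 2 * lm) + eps).
Proof.
move=> hkap hlam hpi' H1 H2 lm0 eps0 F [I' [L' [al' [be' [S [mal' mbe' ->]]]]]].
pose al2 x := (al' x, al x); pose be2 x := (be' x, be x).
have mal2 : fcell al2 by exact: fcell_pair.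
have mbe2 : fcell be2 by exact: fcell_pair.
pose C := ((I' * I) * (L' * L))%type.
(* Each pair of cells costs 1 / (N + 1) in the approximate Markov property, so the number of pairs
   divided by N + 1 must be at most eps. *)
pose N := Num.truncn (#|{: C}|%:R / eps : R).
have N0 : (0 : R) < N.+1%:R by [].
have NC : #|{: C}|%:R / N.+1%:R <= eps.
  rewrite ler_pdivrMr// mulrC -ler_pdivrMr//; apply: ltW.
  have : 0 <= #|{: C}|%:R / eps by rewrite divr_ge0// ltW.
  by move=> /truncn_itv /andP[].
(* One family of level sets per pair of cells; U is refined by all of them at once. *)
have [lev hlev] := choice (fun c : C => cond_indep_levels mf1 mgu mf2 N ci (mal2 c.1) (mbe2 c.2)).
pose ga2 u := ([ffun c => lev c u], ga u).
have mga2 : fcell ga2.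
  by apply: fcell_pair => //; apply: fcell_ffun => c; have [] := hlev c.
pose D := ({ffun C -> 'I_N.+2} * V)%type.
pose Q1 : I' * I -> D -> R := pr2 p (fun z => al2 (f1 z)) (fun z => ga2 (gu z)).
pose Q2 : L' * L -> D -> R := pr2 p (fun z => be2 (f2 z)) (fun z => ga2 (gu z)).
pose QV : D -> R := pr1 p (fun z => ga2 (gu z)).
have cal2 := fcell_precomp mf1 mal2.
have cbe2 := fcell_precomp mf2 mbe2.
have cga2 := fcell_precomp mgu mga2.
have cal := fcell_precomp mf1 mal.
have cbe := fcell_precomp mf2 mbe.
have cga := fcell_precomp mgu mga.
have Q10 i v : 0 <= Q1 i v by exact: pr_ge0.
have Q20 i v : 0 <= Q2 i v by exact: pr_ge0.
have QV0 v : 0 <= QV v by exact: pr_ge0.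
have sQ1 v : \sum_i Q1 i v = QV v by exact: pr2_suml.
have sQ2 v : \sum_i Q2 i v = QV v by exact: pr2_suml.
have sQV : \sum_v QV v = 1 by have [] := pr1_pmf p cga2.
have tQ1 : \sum_i \sum_v Q1 i v = 1.
  by rewrite exchange_big/= -sQV; apply: eq_bigr => v _; exact: sQ1.
have tQ2 : \sum_i \sum_v Q2 i v = 1.
  by rewrite exchange_big/= -sQV; apply: eq_bigr => v _; exact: sQ2.
have s1V i : \sum_v Q1 i v = pr1 pX al2 i.
  by rewrite /Q1 pr2_sumr// /pr1 -hX.
have s2V i : \sum_v Q2 i v = pr1 pXh be2 i.
  by rewrite /Q2 pr2_sumr// /pr1 -hXh.
have c1 i v : \sum_(i' | snd i' == i) \sum_(v' | snd v' == v) Q1 i' v' = P1 i v.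
  by rewrite -(pr2_coarsen p snd snd i v cal2 cga2).
have c2 i v : \sum_(i' | snd i' == i) \sum_(v' | snd v' == v) Q2 i' v' = P2 i v.
  by rewrite -(pr2_coarsen p snd snd i v cbe2 cga2).
have cV v : \sum_(v' | snd v' == v) QV v' = w v.
  by rewrite -(pr1_coarsen p snd v cga2).
have cX i : \sum_(i' | snd i' == i) pr1 pX al2 i' = pr1 pX al i.
  by rewrite -(pr1_coarsen pX snd i mal2).
have cXh i : \sum_(i' | snd i' == i) pr1 pXh be2 i' = pr1 pXh be i.
  by rewrite -(pr1_coarsen pXh snd i mbe2).
pose M1 := step_mass (snd : I' * I -> I) (snd : D -> V) Q1.
pose M2 := step_mass (snd : L' * L -> L) (snd : D -> V) Q2.
have M1E i v : M1 i v = P1 i.2 v.2 * (pr1 pX al2 i * QV v) / (pr1 pX al i.2 * w v.2).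
  rewrite /M1 /step_mass c1 s1V sQ1; congr (_ / (_ * _)).
    by under eq_bigr do rewrite s1V; rewrite cX.
  by under eq_bigr do rewrite sQ1; rewrite cV.
have M2E i v : M2 i v = P2 i.2 v.2 * (pr1 pXh be2 i * QV v) / (pr1 pXh be i.2 * w v.2).
  rewrite /M2 /step_mass c2 s2V sQ2; congr (_ / (_ * _)).
    by under eq_bigr do rewrite s2V; rewrite cXh.
  by under eq_bigr do rewrite sQ2; rewrite cV.
have prf1 (J : finType) (h : T -> J) j : fcell h -> pr1 p (fun z => h (f1 z)) j = pr1 pX h j.
  by move=> mh; rewrite /pr1 -hX.
have prf2 (J : finType) (h : T -> J) j : fcell h -> pr1 p (fun z => h (f2 z)) j = pr1 pXh h j.
  by move=> mh; rewrite /pr1 -hXh.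
have d1 : \sum_i \sum_v `|Q1 i v - M1 i v| <= eta / (2 * lm) + 2 * lm.
  apply: step_close => //.
  apply: (@le_trans _ _ (fmi p (fun z => al2 (f1 z)) (fun z => ga2 (gu z)))).
    by rewrite /fmi; apply: ler_sum => i _; apply: ler_sum => v _; rewrite s1V sQ1 prf1.
  apply: (le_trans (H1 _ _ al2 ga2 mal2 mga2)).
  rewrite lerD2r le_eqVlt; apply/orP; left; apply/eqP.
  apply: eq_bigr => i _; apply: eq_bigr => v _; rewrite c1; congr (kl_term _ (_ * _)).
    by under eq_bigr do rewrite s1V; rewrite cX prf1.
  by under eq_bigr do rewrite sQ1; rewrite cV.
have d2 : \sum_i \sum_v `|Q2 i v - M2 i v| <= eta / (2 * lm) + 2 * lm.
  apply: step_close => //.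
  apply: (@le_trans _ _ (fmi p (fun z => be2 (f2 z)) (fun z => ga2 (gu z)))).
    by rewrite /fmi; apply: ler_sum => i _; apply: ler_sum => v _; rewrite s2V sQ2 prf2.
  apply: (le_trans (H2 _ _ be2 ga2 mbe2 mga2)).
  rewrite lerD2r le_eqVlt; apply/orP; left; apply/eqP.
  apply: eq_bigr => i _; apply: eq_bigr => v _; rewrite c2; congr (kl_term _ (_ * _)).
    by under eq_bigr do rewrite s2V; rewrite cXh prf2.
  by under eq_bigr do rewrite sQ2; rewrite cV.
pose S2 (c : C) := S (c.1.1, c.2.1).
have piE : pr pi' [set z | S (al' z.1, be' z.2)] =
    \sum_(c | S2 c) pr pi' ((al2 @^-1` [set c.1]) `*` (be2 @^-1` [set c.2])).
  have mm : fcell (fun z : T * T => (al2 z.1, be2 z.2)).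
    by apply: fcell_pair; [exact: (fcell_precomp measurable_fst mal2)|exact: (fcell_precomp measurable_snd mbe2)].
  have := pr_pred pi' S2 mm measurableT; rewrite setTI => ->.
  apply: eq_bigr => -[c1' c2'] _; rewrite setTI; congr pr.
  by apply/seteqP; split=> z /= => [[<- <-]|[<- <-]].
have pE : pr p [set z | S (al' (f1 z), be' (f2 z))] =
    \sum_(c | S2 c) pr p (f1 @^-1` (al2 @^-1` [set c.1]) `&` f2 @^-1` (be2 @^-1` [set c.2])).
  have mm : fcell (fun z => (al2 (f1 z), be2 (f2 z))) by exact: fcell_pair.
  have := pr_pred p S2 mm measurableT; rewrite setTI => ->.
  apply: eq_bigr => -[c1' c2'] _; rewrite setTI; congr pr.
  by apply/seteqP; split=> z /= => [[<- <-]|[<- <-]].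
have claimA (c : C) : \sum_v Q1 c.1 v * Q2 c.2 v / QV v - N.+1%:R^-1 <=
    pr p (f1 @^-1` (al2 @^-1` [set c.1]) `&` f2 @^-1` (be2 @^-1` [set c.2])).
  rewrite (pr_cells p cga2); last by apply: measurableI; [exact: cal2|exact: cbe2].
  apply: (@le_trans _ _ (\sum_v (Q1 c.1 v * Q2 c.2 v / QV v - Q2 c.2 v / N.+1%:R))).
    rewrite sumrB lerD2l lerN2 -mulr_suml ler_piMl ?invr_ge0//.
    rewrite -tQ2 [leRHS](bigD1 c.2)//= lerDl; apply: sumr_ge0 => i _; exact: sumr_ge0.
  apply: ler_sum => v _; have [_ hl] := hlev c.
  apply: (hl (ga2 @^-1` [set v]) (v.1 c) (mga2 v)).
  by move=> u /= <-; rewrite /ga2/= ffunE.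
have kapE i A : measurable A -> A `<=` al @^-1` [set i] -> pr1 pX al i != 0 ->
    pr (kap i) A = pr pX A / pr1 pX al i.
  move=> mA Ai pn; have := hkap i A mA; rewrite (setIidl Ai) => ->.
  by rewrite mulrAC mulfV ?mul1r.
have lamE i A : measurable A -> A `<=` be @^-1` [set i] -> pr1 pXh be i != 0 ->
    pr (lam i) A = pr pXh A / pr1 pXh be i.
  move=> mA Ai pn; have := hlam i A mA; rewrite (setIidl Ai) => ->.
  by rewrite mulrAC mulfV ?mul1r.
have kap0 i j A : measurable A -> A `<=` al @^-1` [set j] -> i != j -> pr1 pX al i != 0 ->
    pr (kap i) A = 0.
  move=> mA Aj ij pn; have := hkap i A mA.
  have -> : A `&` al @^-1` [set i] = set0.
    apply/seteqP; split=> // x [/Aj /= e1 /= e2]; move: ij; rewrite -e1 -e2 eqxx//.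
  by rewrite {1}/pr measure0 => /eqP; rewrite eq_sym mulf_eq0 (negPf pn) => /eqP.
have lam0 i j A : measurable A -> A `<=` be @^-1` [set j] -> i != j -> pr1 pXh be i != 0 ->
    pr (lam i) A = 0.
  move=> mA Aj ij pn; have := hlam i A mA.
  have -> : A `&` be @^-1` [set i] = set0.
    apply/seteqP; split=> // x [/Aj /= e1 /= e2]; move: ij; rewrite -e1 -e2 eqxx//.
  by rewrite {1}/pr measure0 => /eqP; rewrite eq_sym mulf_eq0 (negPf pn) => /eqP.
have P10 i v : 0 <= P1 i v by exact: pr_ge0.
have P20 i v : 0 <= P2 i v by exact: pr_ge0.
have w1 v : \sum_i P1 i v = w v by exact: pr2_suml.
have w2 v : \sum_i P2 i v = w v by exact: pr2_suml.
have WE i l : step_weight i l = \sum_v P1 i v * P2 l v / w v.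
  apply: eq_bigr => v _; rewrite mulrA -{1}w1 condcM// /condc w2.
  case: eqP => [wz|]; last by rewrite mulrA.
  rewrite -w1 in wz; rewrite (sum_max0_eq0 (fun j => P10 j v) wz).
  by rewrite !mul0r.
have P1z i v : pr1 pX al i = 0 -> P1 i v = 0.
  rewrite -(prf1 _ _ _ mal) -(pr2_sumr p i cal cga) => h.
  exact: (sum_max0_eq0 (fun j => P10 i j) h).
have P2z i v : pr1 pXh be i = 0 -> P2 i v = 0.
  rewrite -(prf2 _ _ _ mbe) -(pr2_sumr p i cbe cga) => h.
  exact: (sum_max0_eq0 (fun j => P20 i j) h).
have Wz1 i l : pr1 pX al i = 0 -> step_weight i l = 0.
  by move=> h; rewrite WE big1// => v _; rewrite (P1z _ _ h) !mul0r.
have Wz2 i l : pr1 pXh be l = 0 -> step_weight i l = 0.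
  by move=> h; rewrite WE big1// => v _; rewrite (P2z _ _ h) mulr0 mul0r.
have claimB (c : C) : pr pi' ((al2 @^-1` [set c.1]) `*` (be2 @^-1` [set c.2])) =
    \sum_v M1 c.1 v * M2 c.2 v / QV v.
  rewrite (hpi' _ _ (mal2 c.1) (mbe2 c.2)).
  have sub1 : al2 @^-1` [set c.1] `<=` al @^-1` [set c.1.2] by move=> x /= <-.
  have sub2 : be2 @^-1` [set c.2] `<=` be @^-1` [set c.2.2] by move=> x /= <-.
  rewrite (bigD1 c.1.2)//= [X in _ + X]big1 ?addr0; last first.
    move=> i ic; rewrite big1// => l _.
    have [pz|pn] := eqVneq (pr1 pX al i) 0; first by rewrite Wz1// mul0r.
    by rewrite (kap0 i _ _ (mal2 c.1) sub1)// mul0r mulr0.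
  rewrite (bigD1 c.2.2)//= [X in _ + X]big1 ?addr0; last first.
    move=> l lc.
    have [pz|pn] := eqVneq (pr1 pXh be l) 0; first by rewrite Wz2// mul0r.
    by rewrite (lam0 l _ _ (mbe2 c.2) sub2)// !mulr0.
  have -> : step_weight c.1.2 c.2.2 * (pr (kap c.1.2) (al2 @^-1` [set c.1]) * pr (lam c.2.2) (be2 @^-1` [set c.2])) =
     step_weight c.1.2 c.2.2 * ((pr1 pX al2 c.1 / pr1 pX al c.1.2) * (pr1 pXh be2 c.2 / pr1 pXh be c.2.2)).
    have [pz|pn] := eqVneq (pr1 pX al c.1.2) 0; first by rewrite Wz1// !mul0r.
    have [qz|qn] := eqVneq (pr1 pXh be c.2.2) 0; first by rewrite Wz2// !mul0r.
    by rewrite (kapE _ _ (mal2 c.1) sub1)// (lamE _ _ (mbe2 c.2) sub2).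
  set r := _ / _ * (_ / _).
  rewrite WE [RHS](partition_big snd predT)//= mulr_suml; apply: eq_bigr => v _.
  transitivity (\sum_(v' | snd v' == v) P1 c.1.2 v * P2 c.2.2 v / (w v * w v) * r * QV v').
    rewrite -mulr_sumr cV; have [wz|wn] := eqVneq (w v) 0.
      by rewrite wz invr0 !mulr0 !mul0r.
    by rewrite invfM; field; rewrite wn.
  apply: eq_bigr => v' /eqP v'v; rewrite M1E M2E v'v.
  have [qz|qn] := eqVneq (QV v') 0; first by rewrite qz invr0 !mulr0.
  transitivity (P1 c.1.2 v * P2 c.2.2 v / (w v * w v) * r * (QV v' * QV v' * (QV v')^-1)).
    by rewrite mulfK.
  by rewrite /r !invfM; ring.
rewrite piE pE.
under eq_bigr do rewrite claimB.
have sM2 v : \sum_l M2 l v <= QV v.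
  by rewrite -sQ2; exact: (step_mass_sum _ _ Q20).
have sQ1' v : \sum_i Q1 i v <= QV v by rewrite sQ1.
have M20 l v : 0 <= M2 l v by exact: step_mass_ge0.
apply: (le_trans (@product_step_dist R _ _ _ S2 Q1 M1 Q2 M2 QV Q10 M20 QV0 sQ1' sM2)).
have : \sum_(c | S2 c) \sum_v Q1 c.1 v * Q2 c.2 v / QV v <=
   \sum_(c | S2 c) pr p (f1 @^-1` (al2 @^-1` [set c.1]) `&` f2 @^-1` (be2 @^-1` [set c.2])) + eps.
  apply: (@le_trans _ _ (\sum_(c | S2 c) (pr p (f1 @^-1` (al2 @^-1` [set c.1]) `&` f2 @^-1` (be2 @^-1` [set c.2])) + N.+1%:R^-1))).
    by apply: ler_sum => c _; rewrite -lerBlDr.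
  rewrite big_split/= lerD2l; apply: le_trans NC.
  rewrite sumr_const -[leLHS]mulr_natl ler_wpM2r ?invr_ge0// ler_nat; exact: max_card.
lra.
Qed.

End Quantization.

(** * Achievability of the right-hand side of (i) *)

Section Achievability.
Context {R : realType} d (T : measurableType d).
Variables (pX pXh : probability T R) (Delta : T -> T -> R) (Rt Rc : R).
Hypotheses (mD : measurable_fun setT (fun z : T * T => Delta z.1 z.2))
  (D0 : forall x y, 0 <= Delta x y) (ui : unif_integrable pX pXh Delta)
  (Rt0 : 0 <= Rt) (Rc0 : 0 <= Rc).

Let mDe : measurable_fun setT (fun z : T * T => (Delta z.1 z.2)%:E).
Proof. exact/measurable_EFinP. Qed.

(** Delta is at most N off an event of mass at most delta, where uniform integrability bounds its
    integral by 1. *)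
Lemma ui_finite (pi : probability (T * T)%type R) :
  (forall A, measurable A -> pi (A `*` setT) = pX A) ->
  (forall B, measurable B -> pi (setT `*` B) = pXh B) ->
  (\int[pi]_z (Delta z.1 z.2)%:E < +oo)%E.
Proof.
move=> c1 c2; have [delta [delta0 hdelta]] := ui ltr01.
pose f (z : T * T) := Delta z.1 z.2.
have f0 z : 0 <= f z by exact: D0.
pose A n := [set z | f z < n%:R].
have mA n : measurable (A n).
  rewrite (_ : A n = setT `&` f @^-1` `]-oo, n%:R[).
    by apply: mD => //.
  by rewrite setTI; apply/seteqP; split=> z /=; rewrite in_itv.
have ndA : nondecreasing_seq A.
  move=> m n mn; apply/subsetPset => z /= fz; apply: lt_le_trans fz _.
  by rewrite ler_nat.
have AT : \bigcup_n A n = setT.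
  apply/seteqP; split=> // z _; exists (Num.truncn (f z)).+1 => //; rewrite /A /mkset.
  by case/andP: (truncn_itv (f0 z)).
have [N hN] := pr_bigcup_approx pi mA ndA delta0.
rewrite AT pr_setT in hN.
have mAC k : measurable (~` A k) by exact: measurableC.
have h3 : (\int[pi]_(z in ~` A N) (f z)%:E <= 1%:E)%E.
  by apply: hdelta => //; rewrite prE// lee_fin pr_setC//; lra.
have fE0 z : (0 <= (f z)%:E)%E by rewrite lee_fin.
have h4 : (\int[pi]_(z in A N) (f z)%:E <= N%:R%:E)%E.
  rewrite -[leRHS](probability_integral_cst pi).
  apply: (@le_trans _ _ (\int[pi]_(z in A N) (N%:R)%:E)%E).
    apply: ge0_le_integral => //; first exact: measurable_funTS.
    by move=> z Az; rewrite lee_fin ltW.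
  by apply: ge0_subset_integral.
have -> : (\int[pi]_z (f z)%:E = \int[pi]_(z in A N) (f z)%:E + \int[pi]_(z in ~` A N) (f z)%:E)%E.
  rewrite -ge0_integral_setU//; first by rewrite setUv.
  - by rewrite setUv.
  - by apply/disj_set2P; rewrite setICr.
by apply: le_lt_trans (leeD h4 h3) _; rewrite -EFinD ltry.
Qed.

Lemma Dopt_le_rhs_i : (Dopt pX pXh Delta Rt Rc <= rhs_i pX pXh Delta Rt Rc)%E.
Proof.
apply: le_ereal_inf_tmp => _ [dU [U [p [hX [hXh [ci [hI1 [hI2 ->]]]]]]]].
apply/lee_addgt0Pr => eps eps0.
have e2 : 0 < eps / 2 by rewrite divr_gt0.
pose f1 (z : (T * U) * T) : T := z.1.1.
pose gu (z : (T * U) * T) : U := z.1.2.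
pose f2 (z : (T * U) * T) : T := z.2.
have mf1 : measurable_fun setT f1 by exact: (measurableT_comp measurable_fst measurable_fst).
have mgu : measurable_fun setT gu by exact: (measurableT_comp measurable_snd measurable_fst).
have mf2 : measurable_fun setT f2 by exact: measurable_snd.
have prX A : measurable A -> pr p (f1 @^-1` A) = pr pX A.
  move=> mA; rewrite {2}/pr -hX//; congr pr.
  by apply/seteqP; split=> [[[x u] y]|[[x u] y] [[]]].
have prXh A : measurable A -> pr p (f2 @^-1` A) = pr pXh A.
  move=> mA; rewrite {2}/pr -hXh//; congr pr.
  by apply/seteqP; split=> [[[x u] y]|[[x u] y] [[]]].
have m12 : measurable_fun setT (fun z => (f1 z, f2 z)) by exact: measurable_fun_pair.
have [pi [piE pint]] := pushforward_probability p m12.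
have De0 (z : T * T) : (0 <= (Delta z.1 z.2)%:E)%E by rewrite lee_fin.
have [e0 e00 transfer] := ui_transfer pi mD D0 ui e2.
(* With these values 2 (eta / (2 lm) + 2 lm) + e0 / 3 = e0, the three thirds being eta / lm, 4 lm
   and the error of the Markov property. *)
pose lm := e0 / 12; have lm0 : 0 < lm by rewrite divr_gt0.
pose eta := e0 * lm / 3; have eta0 : 0 < eta by rewrite divr_gt0// mulr_gt0.
have [I [V1 [al [ga1 [mal mga1 H1]]]]] := mutual_info_approx hI1 eta0.
have [L [V2 [be [ga2 [mbe mga2 H2]]]]] := mutual_info_approx hI2 eta0.
pose V := (V1 * V2)%type.
(* The two informations come with their own partitions of U. The common refinement stays nearly
   optimal for both. *)
pose ga u : V := (ga1 u, ga2 u).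
have mga : fcell ga by exact: fcell_pair.
have cal := fcell_precomp mf1 mal.
have cbe := fcell_precomp mf2 mbe.
have cga := fcell_precomp mgu mga.
pose P1 : I -> V -> R := pr2 p (fun z => al (f1 z)) (fun z => ga (gu z)).
pose P2 : L -> V -> R := pr2 p (fun z => be (f2 z)) (fun z => ga (gu z)).
pose w : V -> R := pr1 p (fun z => ga (gu z)).
have P10 i v : 0 <= P1 i v by exact: pr_ge0.
have P20 i v : 0 <= P2 i v by exact: pr_ge0.
have w1 : w = (fun v => \sum_j P1 j v) by apply/funext => v; rewrite /P1 pr2_suml.
have w2 : w = (fun v => \sum_j P2 j v) by apply/funext => v; rewrite /P2 pr2_suml.
have wp : fpmf w by exact: pr1_pmf.
have t1 : \sum_i \sum_v P1 i v = 1.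
  by rewrite exchange_big/=; have [_ <-] := wp; rewrite w1.
have t2 : \sum_i \sum_v P2 i v = 1.
  by rewrite exchange_big/=; have [_ <-] := wp; rewrite w2.
have aP : forall v, fpmf (condc P1 v) by exact: condc_pmf.
have bP : forall v, fpmf (condc P2 v) by exact: condc_pmf.
have [kap [hkap kapS kapD]] := cell_laws pX mal.
have [lam [hlam lamS lamD]] := cell_laws pXh mbe.
have poa i : pout w (condc P1) i = pr1 pX al i.
  by rewrite w1 pout_condc// /P1 pr2_sumr// /pr1 -prX.
have pob i : pout w (condc P2) i = pr1 pXh be i.
  by rewrite w2 pout_condc// /P2 pr2_sumr// /pr1 -prXh.
have pia : pinfo w (condc P1) <= Rt.
  rewrite w1 pinfo_condc//.
  have := le_trans (@fmi_le_mutual_info _ _ _ p _ _ _ _ f1 gu _ _ al ga mal mga) hI1.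
  rewrite lee_fin; apply: le_trans; rewrite le_eqVlt; apply/orP; left; apply/eqP.
  by apply: eq_bigr => i _; apply: eq_bigr => v _; rewrite /P1 pr2_sumr// pr2_suml.
have pib : pinfo w (condc P2) <= Rt + Rc.
  rewrite w2 pinfo_condc//.
  have := le_trans (@fmi_le_mutual_info _ _ _ p _ _ _ _ f2 gu _ _ be ga mbe mga) hI2.
  rewrite lee_fin; apply: le_trans; rewrite le_eqVlt; apply/orP; left; apply/eqP.
  by apply: eq_bigr => i _; apply: eq_bigr => v _; rewrite /P2 pr2_sumr// pr2_suml.
pose W (c : I * L) := \sum_v w v * (condc P1 v c.1 * condc P2 v c.2).
have Wp : fpmf W.
  split=> [c|].
    apply: sumr_ge0 => v _; rewrite !mulr_ge0 ?pr_ge0//; [by case: (aP v)|by case: (bP v)].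
  rewrite /W exchange_big/=; have [_ <-] := wp; apply: eq_bigr => v _.
  rewrite -mulr_sumr big_pairE/=; under eq_bigr do rewrite -mulr_sumr.
  rewrite (eq_bigr (fun i => condc P1 v i)); first by case: (aP v) => _ ->; rewrite mulr1.
  by move=> i _; case: (bP v) => _ ->; rewrite mulr1.
have [pi' [pi'E pi'int]] := mixture_probability
  (fun c : I * L => (kap c.1 \x lam c.2)%E : probability _ R) Wp.
have pi'pr A B : measurable A -> measurable B ->
    pr pi' (A `*` B) = \sum_i \sum_l step_weight p al ga be i l * (pr (kap i) A * pr (lam l) B).
  move=> mA mB; rewrite {1}/pr pi'E.
  have e c : ((kap c.1 \x lam c.2)%E : probability _ R) (A `*` B) = (pr (kap c.1) A * pr (lam c.2) B)%:E.
    by rewrite prE ?pr_product//; exact: measurableX.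
  under eq_bigr do rewrite e -EFinM.
  by rewrite sumEFin /= big_pairE.
have c1 A : measurable A -> pi' (A `*` setT) = pX A.
  move=> mA; rewrite prE; last exact: measurableX.
  rewrite prE// pi'pr//; congr EFin; rewrite kapS//; apply: eq_bigr => i _.
  rewrite -poa /pout /step_weight; under eq_bigr do rewrite pr_setT mulr1.
  rewrite -mulr_suml; congr (_ * _); rewrite exchange_big/=; apply: eq_bigr => v _.
  by rewrite -mulr_sumr -mulr_sumr; case: (bP v) => _ ->; rewrite mulr1.
have c2 A : measurable A -> pi' (setT `*` A) = pXh A.
  move=> mA; rewrite prE; last exact: measurableX.
  rewrite prE// pi'pr//; congr EFin; rewrite lamS// exchange_big/=; apply: eq_bigr => l _.
  rewrite -pob /pout /step_weight; under eq_bigr do rewrite pr_setT mul1r.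
  rewrite -mulr_suml; congr (_ * _); rewrite exchange_big/=; apply: eq_bigr => v _.
  by rewrite -mulr_sumr -mulr_suml; case: (aP v) => _ ->; rewrite mul1r.
have e3 : 0 < e0 / 3 by rewrite divr_gt0.
have H1' (I' V' : finType) (al' : T -> I') (ga' : U -> V') : fcell al' -> fcell ga' ->
     fmi p (fun z => al' (f1 z)) (fun z => ga' (gu z)) <=
     fmi p (fun z => al (f1 z)) (fun z => ga (gu z)) + eta.
  move=> m1 m2; apply: le_trans (H1 _ _ _ _ m1 m2) _; rewrite lerD2r.
  exact: (fmi_coarsen p id fst cal cga).
have H2' (I' V' : finType) (al' : T -> I') (ga' : U -> V') : fcell al' -> fcell ga' ->
     fmi p (fun z => al' (f2 z)) (fun z => ga' (gu z)) <=
     fmi p (fun z => be (f2 z)) (fun z => ga (gu z)) + eta.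
  move=> m1 m2; apply: le_trans (H2 _ _ _ _ m1 m2) _; rewrite lerD2r.
  exact: (fmi_coarsen p id snd cbe cga).
have tv F : measurable F -> pr pi' F <= pr pi F + e0.
  apply: rect_alg_dominates => {}F aF.
  apply: le_trans (quantized_tv prX prXh ci mal mga mbe hkap hlam pi'pr H1' H2' lm0 e3 aF) _.
  have -> : pr pi F = pr p [set z | F (f1 z, f2 z)] by rewrite {1}/pr piE.
  rewrite lerD2l le_eqVlt; apply/orP; left; apply/eqP.
  by rewrite /eta /lm; field; rewrite gt_eqF.
have := transfer pi' c1 c2 tv; rewrite pint//= => tr.
(* The cell laws are dominated by multiples of pX and pXh, and the product coupling has finite
   distortion by [ui_finite]. *)
have fin i l : (\int[kap i]_x \int[lam l]_y (Delta x y)%:E \is a fin_num)%E.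
  have [ck ck0 hk] := kapD i; have [cl cl0 hl] := lamD l.
  have mFy (Q : probability T R) : measurable_fun setT (fun x => \int[Q]_y (Delta x y)%:E)%E.
    exact: (measurable_fun_fubini_tonelli_F _ mDe De0).
  have Fy0 (Q : probability T R) x : (0 <= \int[Q]_y (Delta x y)%:E)%E.
    by apply: integral_ge0 => y _; rewrite lee_fin.
  rewrite ge0_fin_numE; last exact: integral_ge0.
  apply: (le_lt_trans (hk _ (mFy (lam l)) (Fy0 (lam l)))).
  have prodfin : (\int[pX]_x \int[pXh]_y (Delta x y)%:E < +oo)%E.
    have := @ui_finite ((pX \x pXh)%E : probability _ R).
    rewrite (@fubini_tonelli1 _ _ _ _ _ pX pXh (fun z => (Delta z.1 z.2)%:E))//.
    apply.
    - move=> A mA; apply: etrans (product_measure1E _ _ mA measurableT) _.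
      by apply: etrans (congr2 mule erefl (probability_setT pXh)) _; rewrite mule1.
    - move=> A mA; apply: etrans (product_measure1E _ _ measurableT mA) _.
      by apply: etrans (congr2 mule (probability_setT pX) erefl) _; rewrite mul1e.
  apply: lte_mul_pinfty; rewrite ?lee_fin//.
  apply: (@le_lt_trans _ _ (\int[pX]_x (cl%:E * \int[pXh]_y (Delta x y)%:E))%E).
    apply: ge0_le_integral => //.
    - by apply: measurable_funeM.
    - move=> x _; apply: hl => [|y]; last by rewrite lee_fin.
      exact: (measurableT_comp mDe (measurable_pair1 x)).
  rewrite ge0_integralZl//.
  by apply: lte_mul_pinfty; rewrite ?lee_fin.
pose dd i l := fine (\int[kap i]_x \int[lam l]_y (Delta x y)%:E)%E.
have hdd i l : (\int[kap i]_x \int[lam l]_y (Delta x y)%:E = (dd i l)%:E)%E.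
  by rewrite /dd fineK.
have hX' A : measurable A -> pr pX A = \sum_i pout w (condc P1) i * pr (kap i) A.
  by move=> mA; rewrite kapS//; apply: eq_bigr => i _; rewrite poa.
have hXh' A : measurable A -> pr pXh A = \sum_i pout w (condc P2) i * pr (lam i) A.
  by move=> mA; rewrite lamS//; apply: eq_bigr => i _; rewrite pob.
have ach := step_achievable mD D0 wp aP bP hX' hXh' Rt0 Rc0 pia pib e2 hdd.
set Dfin := \sum_v _ in ach.
have DfinE : (\int[pi']_z (Delta z.1 z.2)%:E = Dfin%:E)%E.
  rewrite pi'int//.
  have e (c : I * L) : (\int[(kap c.1 \x lam c.2)%E : probability _ R]_z (Delta z.1 z.2)%:E = (dd c.1 c.2)%:E)%E.
    by rewrite -hdd (@fubini_tonelli1 _ _ _ _ _ (kap c.1) (lam c.2) (fun z => (Delta z.1 z.2)%:E)).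
  under eq_bigr do rewrite e -EFinM.
  rewrite sumEFin; congr EFin; rewrite /W; under eq_bigr do rewrite mulr_suml.
  rewrite exchange_big/=; apply: eq_bigr => v _.
  rewrite big_pairE/= mulr_sumr; apply: eq_bigr => i _.
  by rewrite mulr_sumr; apply: eq_bigr => l _; rewrite !mulrA.
apply: (@le_trans _ _ (Dfin + eps / 2)%:E).
  by apply: ereal_inf_lbound; exists (Dfin + eps / 2).
rewrite EFinD -DfinE; apply: le_trans (leeD2r _ tr) _.
rewrite -addeA -EFinD; apply: leeD => //.
by rewrite lee_fin; lra.
Qed.

End Achievability.

(** * Squared error *)

Section SecondMoments.
Context {R : realType}.

(** The condition E[X|Y] = Y involves signed integrals, while the change of variables formulas hold
    for nonnegative functions. The positive and negative parts are transferred separately,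
    integrability on each component making the subtraction legitimate. *)
Lemma signed_transfer d1 d2 (Om : measurableType d1) (T : measurableType d2)
    (M : probability Om R) (I : finType) (c : I -> R) (mu : I -> probability T R)
    (phi : I -> T -> Om) (D : set Om) (f : Om -> R) :
  measurable D -> (forall i, 0 <= c i) -> measurable_fun setT f ->
  (forall g : Om -> \bar R, measurable_fun setT g -> (forall z, 0 <= g z)%E ->
     (\int[M]_(z in D) g z)%E = (\sum_i (c i)%:E * \int[mu i]_x g (phi i x))%E) ->
  (forall i, (mu i).-integrable setT (fun x => (f (phi i x))%:E)) ->
  M.-integrable D (fun z => (f z)%:E) /\
  (\int[M]_(z in D) (f z)%:E)%E = (\sum_i (c i)%:E * \int[mu i]_x (f (phi i x))%:E)%E.
Proof.
move=> mD c0 mf hM fi.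
pose F z := (f z)%:E.
have mF : measurable_fun setT F by exact/measurable_EFinP.
have mFp : measurable_fun setT (F^\+)%E by exact: measurable_funepos.
have mFn : measurable_fun setT (F^\-)%E by exact: measurable_funeneg.
have pfin i : (\int[mu i]_x (F^\+%E (phi i x)))%E \is a fin_num.
  have := integrable_fin_num measurableT (integrable_funepos measurableT (fi i)).
  by rewrite -[X in funepos X]/(F \o phi i) funepos_comp.
have nfin i : (\int[mu i]_x (F^\-%E (phi i x)))%E \is a fin_num.
  have := integrable_fin_num measurableT (integrable_funeneg measurableT (fi i)).
  by rewrite -[X in funeneg X]/(F \o phi i) funeneg_comp.
split.
  apply/integrableP; split; first exact: measurable_funTS.
  rewrite (hM (fun z => `|F z|)%E)//; last exact: measurableT_comp.
  apply: lte_sum_pinfty => i _; apply: lte_mul_pinfty => //; first by rewrite lee_fin.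
  by have /integrableP[] := fi i.
rewrite integralE (hM _ mFp)// (hM _ mFn)//.
have tF (u v : I -> R) : ((\sum_i (c i)%:E * (u i)%:E) - (\sum_i (c i)%:E * (v i)%:E))%E =
    (\sum_i (c i)%:E * (u i - v i)%:E)%E.
  transitivity ((\sum_i c i * u i) - (\sum_i c i * v i))%:E.
    by rewrite EFinB -!sumEFin; congr (_ - _)%E; apply: eq_bigr => i _; rewrite EFinM.
  rewrite -sumrB -sumEFin; apply: eq_bigr => i _; rewrite -EFinM; congr EFin; ring.
transitivity (\sum_i (c i)%:E * (fine (\int[mu i]_x (F^\+%E (phi i x)))%E -
    fine (\int[mu i]_x (F^\-%E (phi i x)))%E)%:E)%E.
  by rewrite -tF; congr (_ - _)%E; apply: eq_bigr => i _; rewrite fineK.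
apply: eq_bigr => i _; rewrite EFinB !fineK//; congr (_ * _)%E.
apply: esym; transitivity (\int[mu i]_x (F \o phi i) x)%E => //.
by rewrite integralE funepos_comp funeneg_comp.
Qed.

Lemma second_moment d (Om : measurableType d) (Q : probability Om R) (X : Om -> R) :
  measurable_fun setT X -> (\int[Q]_w (X w ^+ 2)%:E < +oo)%E ->
  exists m s : R, [/\ Q.-integrable setT (fun w => (X w)%:E),
    (\int[Q]_w (X w)%:E = m%:E)%E,
    (forall t, (\int[Q]_w ((X w - t) ^+ 2)%:E = (s - 2 * t * m + t ^+ 2)%:E)%E) &
    m ^+ 2 <= s].
Proof.
move=> mX h2.
have mX2 : measurable_fun setT (fun w => (X w ^+ 2)%:E).
  by apply/measurable_EFinP; exact: measurable_funX.
have mXE : measurable_fun setT (fun w => (X w)%:E) by exact/measurable_EFinP.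
have iX2 : Q.-integrable setT (fun w => (X w ^+ 2)%:E).
  apply/integrableP; split => //.
  by under eq_integral do rewrite abse_EFin (ger0_norm (sqr_ge0 _)).
have i1 (c : R) : Q.-integrable setT (fun _ => c%:E).
  apply/integrableP; split; first exact: measurable_cst.
  by under eq_integral do rewrite abse_EFin; rewrite probability_integral_cst ltry.
have iX : Q.-integrable setT (fun w => (X w)%:E).
  apply: (@le_integrable _ _ _ _ _ _ _ (fun w => (X w ^+ 2)%:E + 1%:E)%E) => //.
    move=> w _; rewrite -EFinD !abse_EFin lee_fin [leRHS]ger0_norm ?addr_ge0 ?sqr_ge0//.
    rewrite -(@real_normK _ (X w)) ?num_real//; set z := `|X w|.
    have := sqr_ge0 (z - 1); have := normr_ge0 (X w); rewrite -/z => z0.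
    have -> : (z - 1) ^+ 2 = z ^+ 2 - 2 * z + 1 by ring.
    lra.
  exact: integrableD.
have fX := integrable_fin_num measurableT iX.
have fX2 := integrable_fin_num measurableT iX2.
pose m := fine (\int[Q]_w (X w)%:E)%E; pose s := fine (\int[Q]_w (X w ^+ 2)%:E)%E.
have hm : (\int[Q]_w (X w)%:E = m%:E)%E by rewrite /m fineK.
have hs : (\int[Q]_w (X w ^+ 2)%:E = s%:E)%E by rewrite /s fineK.
have ht t : (\int[Q]_w ((X w - t) ^+ 2)%:E = (s - 2 * t * m + t ^+ 2)%:E)%E.
  transitivity (\int[Q]_w ((X w ^+ 2)%:E + (- (2 * t))%:E * (X w)%:E + (t ^+ 2)%:E))%E.
    by apply: eq_integral => w _; rewrite -EFinM -!EFinD; congr EFin; ring.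
  have iz : Q.-integrable setT (fun w => ((- (2 * t))%:E * (X w)%:E)%E) by exact: integrableZl.
  rewrite integralD//; last exact: integrableD.
  rewrite integralD// integralZl// hm hs probability_integral_cst -EFinM -!EFinD.
  by congr EFin; ring.
exists m, s; split => //.
have : (0 <= \int[Q]_w ((X w - m) ^+ 2)%:E)%E.
  by apply: integral_ge0 => w _; rewrite lee_fin sqr_ge0.
rewrite ht lee_fin; have -> : s - 2 * m * m + m ^+ 2 = s - m ^+ 2 by ring.
by rewrite subr_ge0.
Qed.

Lemma conditional_integral d (Om : measurableType d) (P Q : probability Om R) (C : set Om) :
  measurable C -> (forall A, measurable A -> pr P (A `&` C) = pr P C * pr Q A) ->
  forall g : Om -> \bar R, measurable_fun setT g -> (forall z, 0 <= g z)%E ->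
    (\int[P]_(z in C) g z = (pr P C)%:E * \int[Q]_z g z)%E.
Proof.
move=> mC hQ g mg g0.
have c0 := pr_ge0 P C.
have [pz|pn] := eqVneq (pr P C) 0.
  rewrite pz mul0e; apply: null_set_integral => //; first exact: measurable_funTS.
  by apply: etrans (prE P mC) _; rewrite pz.
have QC : pr Q C = 1.
  by have := hQ _ mC; rewrite setIid => h; apply: (mulfI pn); rewrite -h mulr1.
pose S : {measure set Om -> \bar R} := mscale (NngNum c0) Q.
rewrite (eq_measure_integral S); last first.
  move=> A mA AC; apply: etrans (prE P mA) _.
  rewrite -{1}(setIidl AC) hQ// EFinM.
  exact: (congr2 mule (erefl (pr P C)%:E) (esym (prE Q mA))).
rewrite ge0_integral_mscale//; last exact: measurable_funTS.
congr (_ * _)%E.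
rewrite -[in RHS](setUv C) ge0_integral_setU//; last 3 first.
- exact: measurableC.
- by rewrite setUv.
- by apply/disj_set2P; rewrite setICr.
rewrite [X in (_ + X)%E]null_set_integral ?adde0//.
- exact: measurableC.
- exact: measurable_funTS.
by apply: etrans (prE Q (measurableC mC)) _; rewrite pr_setC// QC subrr.
Qed.

Lemma tail_second_moment (mu : probability R R) (eta : R) :
  (\int[mu]_x (x ^+ 2)%:E < +oo)%E -> 0 < eta ->
  exists M : R, 0 < M /\ (\int[mu]_(x in ~` [set x : R | (`|x| < M)%R]) (x ^+ 2)%:E <= eta%:E)%E.
Proof.
move=> h2 eta0.
have mX2 : measurable_fun setT (fun x : R => (x ^+ 2)%:E).
  by apply/measurable_EFinP; exact: measurable_funX.
have iX2 : mu.-integrable setT (fun x : R => (x ^+ 2)%:E).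
  apply/integrableP; split => //.
  by under eq_integral do rewrite abse_EFin (ger0_norm (sqr_ge0 _)).
have [delta [delta0 hd]] := integral_normr_continuous iX2 eta0.
pose A n := [set x : R | `|x| < n.+1%:R].
have mA n : measurable (A n).
  have mn : measurable_fun setT (fun x : R => `|x|) by exact: measurableT_comp.
  rewrite (_ : A n = setT `&` (fun x : R => `|x|) @^-1` `]-oo, n.+1%:R[).
    by apply: mn => //; exact: measurable_itv.
  by rewrite setTI; apply/seteqP; split=> z /=; rewrite in_itv.
have ndA : nondecreasing_seq A.
  move=> m n mn; apply/subsetPset => z /= fz; apply: lt_le_trans fz _.
  by rewrite ler_nat.
have AT : \bigcup_n A n = setT.
  apply/seteqP; split=> // z _; exists (Num.truncn `|z|) => //; rewrite /A /mkset.
  by case/andP: (truncn_itv (normr_ge0 z)).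
have d2 : 0 < delta / 2 by rewrite divr_gt0.
have [N hN] := pr_bigcup_approx mu mA ndA d2.
rewrite AT pr_setT in hN.
exists N.+1%:R; split => //.
have mC : measurable (~` A N) by exact: measurableC.
have lt : (mu (~` A N) < delta%:E)%E by rewrite prE// lte_fin pr_setC//; lra.
have := hd _ mC lt; rewrite /Rintegral -lte_fin fineK.
  move=> /ltW; apply: le_trans; rewrite le_eqVlt; apply/orP; left; apply/eqP.
  by apply: eq_integral => x _; rewrite /= ger0_norm ?sqr_ge0.
apply: integrable_fin_num => //.
have := integrable_abse (integrableS measurableT mC (@subsetT _ _) iX2).
by apply.
Qed.

End SecondMoments.

(** * Uniform integrability of squared error *)

Section SquaredError.
Context {R : realType}.

Lemma norm_lt_measurable (M : R) : measurable [set x : R | (`|x| < M)%R].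
Proof.
have -> : [set x : R | (`|x| < M)%R] = setT `&` (@Num.norm R R) @^-1` `]-oo, M[.
  by rewrite setTI; apply/seteqP; split=> z /=; rewrite in_itv.
by apply: normr_measurable => //; exact: measurable_itv.
Qed.

(** By Z^2 <= M^2 + Z^2 1(|Z| >= M). The bound involves only the law of Z and the mass of E, which
    makes it uniform over couplings. *)
Lemma second_moment_on_event d (Om : measurableType d) (P : probability Om R)
    (Z : Om -> R) (mu : probability R R) (M eta : R) (E : set Om) :
  measurable_fun setT Z -> measurable E ->
  (forall A, measurable A -> P (Z @^-1` A) = mu A) ->
  (\int[mu]_(x in ~` [set x : R | (`|x| < M)%R]) (x ^+ 2)%:E <= eta%:E)%E ->
  (\int[P]_(z in E) (Z z ^+ 2)%:E <= (M ^+ 2 * pr P E + eta)%:E)%E.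
Proof.
move=> mZ mE hZ tl.
have [Q [QE Qint]] := pushforward_probability P mZ.
pose A := ~` [set x : R | (`|x| < M)%R].
have mA : measurable A by apply: measurableC; exact: norm_lt_measurable.
have msq : measurable_fun setT (fun x : R => (x ^+ 2)%:E).
  by apply/measurable_EFinP; exact: measurable_funX.
pose g := (fun x : R => (x ^+ 2)%:E) \_ A.
have mg : measurable_fun setT g.
  by apply/(measurable_restrictT _ mA); exact: measurable_funTS.
have g0 x : (0 <= g x)%E.
  by rewrite /g patchE; case: ifP => // _; rewrite lee_fin sqr_ge0.
have tl' : (\int[P]_z g (Z z) <= eta%:E)%E.
  rewrite -Qint//; apply: le_trans tl; rewrite (integral_mkcond A).
  rewrite le_eqVlt; apply/orP; left; apply/eqP.
  by apply: eq_measure_integral => B mB _; exact: etrans (QE B) (hZ B mB).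
have mgZ : measurable_fun setT (g \o Z) by exact: measurableT_comp.
have mZ2 : measurable_fun setT (fun z => (Z z ^+ 2)%:E) by exact: (measurableT_comp msq mZ).
have mS : measurable_fun setT (fun z => ((M ^+ 2)%:E + g (Z z))%E).
  by apply: emeasurable_funD => //; exact: mgZ.
apply: (@le_trans _ _ (\int[P]_(z in E) ((M ^+ 2)%:E + g (Z z)))%E).
  apply: ge0_le_integral => //.
  - by move=> z _; rewrite lee_fin sqr_ge0.
  - exact: measurable_funTS.
  - exact: measurable_funTS.
  move=> z _; rewrite /g patchE; case: ifPn => [_|]; first by rewrite leeDr// lee_fin sqr_ge0.
  rewrite notin_setE /A => /contrapT /= h; rewrite adde0 lee_fin.
  by rewrite -(@real_normK _ (Z z)) ?num_real// lerXn2r ?nnegrE ?normr_ge0 ?(le_trans _ (ltW h))// ltW.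
rewrite ge0_integralD//; last 2 first.
- by move=> z _; rewrite lee_fin sqr_ge0.
- exact: measurable_funTS.
rewrite EFinD leeD//.
  rewrite integral_cst// (EFinM (M ^+ 2)).
  have -> : (pr P E)%:E = P E by rewrite prE.
  exact: lexx.
apply: le_trans tl'; apply: ge0_subset_integral => //.
Qed.

Lemma squared_error_le (a b : R) : (a - b) ^+ 2 <= 2 * a ^+ 2 + 2 * b ^+ 2.
Proof.
rewrite -subr_ge0; have -> : 2 * a ^+ 2 + 2 * b ^+ 2 - (a - b) ^+ 2 = (a + b) ^+ 2 by ring.
exact: sqr_ge0.
Qed.

Lemma squared_error_measurable :
  measurable_fun setT (fun z : R * R => ((z.1 - z.2) ^+ 2)%R).
Proof.
by apply: measurable_funX; apply: measurable_funB; [exact: measurable_fst|exact: measurable_snd].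
Qed.

Lemma squared_error_unif_integrable (mu nu : probability R R) :
  (\int[mu]_x (x ^+ 2)%:E < +oo)%E -> (\int[nu]_x (x ^+ 2)%:E < +oo)%E ->
  unif_integrable mu nu (fun x y => (x - y) ^+ 2).
Proof.
move=> h1 h2 eps eps0.
have e8 : 0 < eps / 8 by rewrite divr_gt0.
have [M1 [M10 t1]] := tail_second_moment h1 e8.
have [M2 [M20 t2]] := tail_second_moment h2 e8.
pose S := M1 ^+ 2 + M2 ^+ 2.
have S0 : 0 < S by rewrite addr_gt0// exprn_gt0.
(* The truncated parts contribute 2 S times this value, that is eps / 2, and the two tails 2 eps / 8
   each. *)
exists (eps / (4 * S)); split; first by rewrite divr_gt0// mulr_gt0.
move=> P hP1 hP2 E mE PE.
have h1' A : measurable A -> P (fst @^-1` A) = mu A by move=> mA; rewrite -hP1// setXT.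
have h2' A : measurable A -> P (snd @^-1` A) = nu A by move=> mA; rewrite -hP2// setTX.
have b1 := second_moment_on_event measurable_fst mE h1' t1.
have b2 := second_moment_on_event measurable_snd mE h2' t2.
have msq (f : R * R -> R) : measurable_fun setT f -> measurable_fun E (fun x : R * R => (2%:E * (f x ^+ 2)%:E)%E).
  move=> mf; apply: measurable_funTS; apply: measurable_funeM; apply/measurable_EFinP.
  exact: measurable_funX.
apply: (@le_trans _ _ (\int[P]_(z in E) (2%:E * (z.1 ^+ 2)%:E + 2%:E * (z.2 ^+ 2)%:E))%E).
  apply: ge0_le_integral => //.
  - by move=> z _; rewrite lee_fin sqr_ge0.
  - by apply: measurable_funTS; apply/measurable_EFinP; exact: squared_error_measurable.
  - by apply: emeasurable_funD; apply: msq; [exact: measurable_fst|exact: measurable_snd].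
  by move=> z _; rewrite -!EFinM -EFinD lee_fin squared_error_le.
have sq0 (f : R * R -> R) z : E z -> (0 <= (f z ^+ 2)%:E)%E by rewrite lee_fin sqr_ge0.
have msq1 (f : R * R -> R) : measurable_fun setT f -> measurable_fun E (fun x : R * R => (f x ^+ 2)%:E).
  by move=> mf; apply: measurable_funTS; apply/measurable_EFinP; exact: measurable_funX.
rewrite ge0_integralD//; last 4 first.
- by move=> z _; rewrite mule_ge0// lee_fin sqr_ge0.
- by apply: msq; exact: measurable_fst.
- by move=> z _; rewrite mule_ge0// lee_fin sqr_ge0.
- by apply: msq; exact: measurable_snd.
rewrite !ge0_integralZl_EFin//; last 4 first.
- exact: sq0.
- by apply: msq1; exact: measurable_snd.
- exact: sq0.
- by apply: msq1; exact: measurable_fst.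
apply: (le_trans (leeD (lee_wpmul2l _ b1) (lee_wpmul2l _ b2))) => //.
rewrite -!EFinM -EFinD lee_fin.
have PE' : pr P E <= eps / (4 * S) by rewrite -lee_fin; apply: le_trans PE; rewrite prE.
have -> : 2 * (M1 ^+ 2 * pr P E + eps / 8) + 2 * (M2 ^+ 2 * pr P E + eps / 8) =
    2 * S * pr P E + eps / 2 by rewrite /S; field.
apply: (@le_trans _ _ (2 * S * (eps / (4 * S)) + eps / 2)).
  by rewrite lerD2r ler_wpM2l// mulr_ge0// ltW.
rewrite le_eqVlt; apply/orP; left; apply/eqP; field; exact: lt0r_neq0.
Qed.

End SquaredError.

(** * From a finite test channel to the right-hand side of (ii) *)

Section MeanChannel.
Context {R : realType}.

Lemma mixture_integral d (T : measurableType d) (V : finType) (w : V -> R)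
    (mu : V -> probability T R) (P : probability T R) : fpmf w ->
  (forall A, measurable A -> pr P A = \sum_v w v * pr (mu v) A) ->
  forall g : T -> \bar R, measurable_fun setT g -> (forall x, 0 <= g x)%E ->
    (\int[P]_x g x = \sum_v (w v)%:E * \int[mu v]_x g x)%E.
Proof.
move=> wp hP g mg g0.
have [Q [QE Qint]] := mixture_probability mu wp.
rewrite -Qint//; apply: eq_measure_integral => A mA _.
apply: etrans (prE P mA) _; apply: esym; apply: etrans (QE A) _.
rewrite hP// -sumEFin; apply: eq_bigr => v _.
by rewrite EFinM; congr (_ * _)%E; exact: prE.
Qed.

Lemma mixture_pushforward d d' (T : measurableType d) (S : measurableType d') (V : finType)
    (w : V -> R) (mu : V -> probability T R) (phi : V -> T -> S) : fpmf w ->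
  (forall v, measurable_fun setT (phi v)) ->
  exists Q : probability S R,
    (forall A, measurable A -> pr Q A = \sum_v w v * pr (mu v) (phi v @^-1` A)) /\
    (forall g : S -> \bar R, measurable_fun setT g -> (forall x, 0 <= g x)%E ->
    (\int[Q]_x g x = \sum_v (w v)%:E * \int[mu v]_x g (phi v x))%E).
Proof.
move=> wp mphi.
have [q hq] := choice (fun v => pushforward_probability (mu v) (mphi v)).
have [Q [QE Qint]] := mixture_probability q wp.
exists Q; split=> [A mA|g mg g0].
  apply: EFin_inj; rewrite -sumEFin -prE// QE; apply: eq_bigr => v _.
  rewrite EFinM; congr (_ * _)%E; have [-> _] := hq v.
  by apply: prE; rewrite -[X in measurable X]setTI; exact: mphi.
rewrite Qint//; apply: eq_bigr => v _; congr (_ * _)%E.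
by have [_ ->] := hq v.
Qed.

(** With Y the mean of the component v, Y is a function of v, so I(X;Y) is at most the information
    in v. On each event about Y, the integrals of X and Y are the same weighted sum of means. *)
Lemma mean_coupling (V : finType) (w : V -> R) (mu : V -> probability R R)
    (P : probability R R) (m s : V -> R) (c : R) : fpmf w ->
  (forall A, measurable A -> pr P A = \sum_v w v * pr (mu v) A) ->
  (forall v, (mu v).-integrable setT (fun x => x%:E)) ->
  (forall v, \int[mu v]_x x%:E = (m v)%:E)%E ->
  (forall v, \int[mu v]_x ((x - m v) ^+ 2)%:E = (s v)%:E)%E ->
  (forall (I : finType) (al : R -> I), fcell al -> vinfo w mu al <= c) ->
  exists p : probability (R * R)%type R,
    [/\ (forall A, measurable A -> p (A `*` setT) = P A),
        cexp_id p, (mutual_info p fst snd <= c%:E)%E,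
        (\int[p]_z ((z.1 - z.2) ^+ 2)%:E = (\sum_v w v * s v)%:E)%E &
        (forall B, measurable B -> pr p (setT `*` B) = \sum_v w v * (m v \in B)%:R)].
Proof.
move=> wp hP ix im iv hI; have [w0 w1] := wp.
pose phi (v : V) (x : R) : R * R := (x, m v).
have mphi v : measurable_fun setT (phi v).
  by apply: measurable_fun_pair; [exact: measurable_id|exact: measurable_cst].
have [p [pE pint]] := mixture_pushforward mu wp mphi.
have pAB A B : measurable A -> measurable B ->
    pr p (A `*` B) = \sum_v w v * ((m v \in B)%:R * pr (mu v) A).
  move=> mA mB; rewrite pE; last exact: measurableX.
  apply: eq_bigr => v _; congr (_ * _).
  have [vB|vB] := boolP (m v \in B).
    rewrite mul1r; congr pr; apply/seteqP; split=> [x []//|x Ax]; split=> //=.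
    by rewrite inE in vB.
  rewrite mul0r (_ : _ @^-1` _ = set0) ?/pr ?measure0//.
  by apply/seteqP; split=> // x [_ /= h]; case/negP: vB; rewrite inE.
have pY B : measurable B -> pr p (setT `*` B) = \sum_v w v * (m v \in B)%:R.
  by move=> mB; rewrite pAB//; apply: eq_bigr => v _; rewrite pr_setT mulr1.
exists p; split => //.
- move=> A mA; rewrite prE; last exact: measurableX.
  rewrite prE// pAB// hP//; congr EFin; apply: eq_bigr => v _.
  by rewrite in_setT mul1r.
- have key (B : set R) : measurable B -> forall g : R * R -> \bar R, measurable_fun setT g ->
      (forall z, 0 <= g z)%E ->
      (\int[p]_(z in setT `*` B) g z)%E =
      (\sum_v (w v * (m v \in B)%:R)%:E * \int[mu v]_x g (phi v x))%E.
    move=> mB g mg g0; have mTB : measurable ([set: R] `*` B) by exact: measurableX.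
    rewrite integral_mkcond pint; last 2 first.
    + by apply/(measurable_restrictT _ mTB); exact: measurable_funTS.
    + by move=> z; rewrite patchE; case: ifP.
    apply: eq_bigr => v _; rewrite EFinM -muleA; congr (_ * _)%E.
    have [vB|vB] := boolP (m v \in B).
      rewrite mul1e; apply: eq_integral => x _; rewrite patchE mem_set//.
      by split=> //=; rewrite inE in vB.
    rewrite mul0e integral0_eq// => x _; rewrite patchE memNset// => -[_ /= h].
    by case/negP: vB; rewrite inE.
  have c0 (B : set R) v : 0 <= w v * (m v \in B)%:R by rewrite mulr_ge0.
  have im2 v : (mu v).-integrable setT (fun x => (phi v x).2%:E).
    apply/integrableP; split; first by rewrite /phi/=; exact: measurable_cst.
    by rewrite (eq_integral (fun=> `|m v|%:E))// probability_integral_cst ltry.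
  have tr1 B : measurable B -> (\int[p]_(z in setT `*` B) z.1%:E =
      \sum_v (w v * (m v \in B)%:R)%:E * \int[mu v]_x x%:E)%E.
    move=> mB; have mTB : measurable ([set: R] `*` B) by exact: measurableX.
    by have [_] := signed_transfer mTB (c0 B) measurable_fst (key B mB) ix.
  have tr2 B : measurable B -> p.-integrable (setT `*` B) (fun z => z.2%:E) /\
      (\int[p]_(z in setT `*` B) z.2%:E =
      \sum_v (w v * (m v \in B)%:R)%:E * \int[mu v]_x (m v)%:E)%E.
    move=> mB; have mTB : measurable ([set: R] `*` B) by exact: measurableX.
    exact: (signed_transfer mTB (c0 B) measurable_snd (key B mB) im2).
  split; first by have [] := tr2 _ measurableT; rewrite setXTT.
  move=> B mB; rewrite tr1//; have [_ ->] := tr2 B mB.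
  by apply: eq_bigr => v _; rewrite im probability_integral_cst.
- apply: mutual_info_le => I J al be mal mbe.
  apply: le_trans (hI _ _ mal).
  apply: (mixture_fmi_le (c := m) wp _ mal mbe) => A C mA mC.
  by apply: etrans (pAB A C mA mC); congr pr; apply/seteqP; split.
- rewrite pint; last 2 first.
  + by apply/measurable_EFinP; exact: squared_error_measurable.
  + by move=> z; rewrite lee_fin sqr_ge0.
  rewrite -sumEFin; apply: eq_bigr => v _; rewrite EFinM; congr (_ * _)%E; exact: iv.
Qed.

Lemma product_squared_error (mu nu : probability R R) (m s n t : R) :
  (forall a, \int[mu]_x ((x - a) ^+ 2)%:E = (s - 2 * a * m + a ^+ 2)%:E)%E ->
  (forall a, \int[nu]_x ((x - a) ^+ 2)%:E = (t - 2 * a * n + a ^+ 2)%:E)%E ->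
  n ^+ 2 <= t ->
  (\int[mu]_x \int[nu]_y ((x - y) ^+ 2)%:E = (s - 2 * m * n + t)%:E)%E.
Proof.
move=> hmu hnu nt.
transitivity (\int[mu]_x (((x - n) ^+ 2)%:E + (t - n ^+ 2)%:E))%E.
  apply: eq_integral => x _.
  transitivity (\int[nu]_y ((y - x) ^+ 2)%:E)%E.
    by apply: eq_integral => y _; rewrite -sqrrN opprB.
  by rewrite hnu -EFinD; congr EFin; ring.
rewrite ge0_integralD//.
- by rewrite hmu probability_integral_cst -EFinD; congr EFin; ring.
- by move=> x _; rewrite lee_fin sqr_ge0.
- by apply/measurable_EFinP; apply: measurable_funX; exact: measurable_funB.
- by move=> x _; rewrite lee_fin subr_ge0.
Qed.

Lemma finite_mixture_component (V : finType) (w : V -> R) (mu : V -> probability R R)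
    (P : probability R R) v : fpmf w ->
  (forall A, measurable A -> pr P A = \sum_v w v * pr (mu v) A) ->
  (\int[P]_x (x ^+ 2)%:E < +oo)%E -> 0 < w v -> (\int[mu v]_x (x ^+ 2)%:E < +oo)%E.
Proof.
move=> wp hP h wv.
have mX2 : measurable_fun setT (fun x : R => (x ^+ 2)%:E).
  by apply/measurable_EFinP; exact: measurable_funX.
have x0 (x : R) : (0 <= (x ^+ 2)%:E)%E by rewrite lee_fin sqr_ge0.
have w0 : forall v, 0 <= w v by case: wp.
move: h; rewrite (mixture_integral wp hP mX2 x0) (bigD1 v)//= => h.
rewrite -(@lte_pmul2l _ (w v)%:E)//.
rewrite [X in (_ < X)%E]mulry gtr0_sg// mul1e; apply: le_lt_trans h.
rewrite leeDl// sume_ge0// => u _; rewrite mule_ge0// ?lee_fin//.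
by apply: integral_ge0 => x _; exact: x0.
Qed.

(** Components of weight zero may have infinite second moment; replacing them by P gives every
    component moments without changing any weighted quantity. *)
Lemma second_moment_components (V : finType) (w : V -> R) (mu : V -> probability R R)
    (P : probability R R) : fpmf w ->
  (forall A, measurable A -> pr P A = \sum_v w v * pr (mu v) A) ->
  (\int[P]_x (x ^+ 2)%:E < +oo)%E ->
  exists (mu' : V -> probability R R) (m s : V -> R),
   [/\ (forall v A, w v * pr (mu' v) A = w v * pr (mu v) A),
     (forall v, w v != 0 -> mu' v = mu v),
     (forall v, (mu' v).-integrable setT (fun x => x%:E)),
     (forall v, \int[mu' v]_x x%:E = (m v)%:E)%E &
     (forall v a, \int[mu' v]_x ((x - a) ^+ 2)%:E = (s v - 2 * a * m v + a ^+ 2)%:E)%E /\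
     (forall v, m v ^+ 2 <= s v)].
Proof.
move=> wp hP h; have [w0 w1] := wp.
pose mu' v := if w v == 0 then P else mu v.
have h' v : (\int[mu' v]_x (x ^+ 2)%:E < +oo)%E.
  rewrite /mu'; have [//|wv] := eqVneq (w v) 0.
  by apply: (finite_mixture_component wp hP h); rewrite lt0r wv w0.
have ex v : exists z : R * R, [/\ (mu' v).-integrable setT (fun x => x%:E),
    (\int[mu' v]_x x%:E = z.1%:E)%E,
    (forall t, (\int[mu' v]_w ((w - t) ^+ 2)%:E = (z.2 - 2 * t * z.1 + t ^+ 2)%:E)%E) &
    z.1 ^+ 2 <= z.2].
  by have [m [s h4]] := second_moment (@measurable_id _ R setT) (h' v); exists (m, s).
have [z hz] := choice ex.
exists mu', (fun v => (z v).1), (fun v => (z v).2); split.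
- by move=> v A; rewrite /mu'; have [->|//] := eqVneq (w v) 0; rewrite !mul0r.
- by move=> v /negPf wv; rewrite /mu' wv.
- by move=> v; have [] := hz v.
- by move=> v; have [] := hz v.
- by split=> [v a|v]; have [] := hz v.
Qed.

Lemma eq_vinfo (V I : finType) (w : V -> R) (mu mu' : V -> probability R R) (al : R -> I) :
  (forall v A, w v * pr (mu' v) A = w v * pr (mu v) A) -> vinfo w mu' al = vinfo w mu al.
Proof.
move=> h; apply: eq_bigr => v _; apply: eq_bigr => i _.
by rewrite /pr1 h; under eq_bigr do rewrite h.
Qed.

(** For letters independent given v, the squared error splits as (s - m^2) + (t - n^2) + (m - n)^2.
    The last term is the cost of the coupling of Y and Yh obtained by drawing v and outputting both
    means; it bounds [W2sq] from above. *)
Lemma fin_channel_rhs_ii (pX pXh : probability R R) (Rt Rc : R) (D : \bar R) :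
  (\int[pX]_x (x ^+ 2)%:E < +oo)%E -> (\int[pXh]_x (x ^+ 2)%:E < +oo)%E ->
  fin_channel pX pXh (fun x y => (x - y) ^+ 2) Rt Rc D -> (rhs_ii pX pXh Rt Rc <= D)%E.
Proof.
move=> h1 h2 [V [w [mu0 [nu0 [wp [hX0 hXh0 hR0 hRc0 hD]]]]]]; have [w0 w1] := wp.
have [mu [m [s [emu nmu ix im [iv ms]]]]] := second_moment_components wp hX0 h1.
have [nu [n [t [enu nnu iy in_ [it nt]]]]] := second_moment_components wp hXh0 h2.
have hX A : measurable A -> pr pX A = \sum_v w v * pr (mu v) A.
  by move=> mA; rewrite hX0//; apply: eq_bigr => v _; rewrite emu.
have hXh A : measurable A -> pr pXh A = \sum_v w v * pr (nu v) A.
  by move=> mA; rewrite hXh0//; apply: eq_bigr => v _; rewrite enu.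
have hR (I : finType) (al : R -> I) : fcell al -> vinfo w mu al <= Rt.
  by move=> mal; rewrite (eq_vinfo al emu) hR0.
have hRc (I : finType) (al : R -> I) : fcell al -> vinfo w nu al <= Rt + Rc.
  by move=> mal; rewrite (eq_vinfo al enu) hRc0.
have vs v : (\int[mu v]_x ((x - m v) ^+ 2)%:E = (s v - m v ^+ 2)%:E)%E.
  by rewrite iv; congr EFin; ring.
have vt v : (\int[nu v]_x ((x - n v) ^+ 2)%:E = (t v - n v ^+ 2)%:E)%E.
  by rewrite it; congr EFin; ring.
have [p [p1 p2 p3 p4 p5]] := mean_coupling wp hX ix im vs hR.
have [q [q1 q2 q3 q4 q5]] := mean_coupling wp hXh iy in_ vt hRc.
have DE : (\sum_v (w v)%:E * \int[mu0 v]_x \int[nu0 v]_y ((x - y) ^+ 2)%:E =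
    (\sum_v w v * (s v - 2 * m v * n v + t v))%:E)%E.
  rewrite -sumEFin; apply: eq_bigr => v _; rewrite EFinM.
  have [->|wv] := eqVneq (w v) 0; first by rewrite !mul0e.
  by rewrite -(nmu v wv) -(nnu v wv) (product_squared_error (iv v) (it v)).
rewrite DE in hD; apply: le_trans hD.
pose e := (\int[p]_z ((z.1 - z.2) ^+ 2)%:E + \int[q]_z ((z.1 - z.2) ^+ 2)%:E
          + W2sq (fun B => p (setT `*` B)) (fun B => q (setT `*` B)))%E.
apply: (@le_trans _ _ e).
  by apply: ereal_inf_lbound; exists p, q.
have [r [rE rint]] := mixture_probability (fun v => \d_(m v, n v) : probability (R * R)%type R) wp.
have dE (A : set (R * R)) (z : R * R) : measurable A -> \d_z A = (z \in A)%:R%:E :> \bar R.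
  by move=> mA; rewrite diracE.
have W : (W2sq (fun B => p (setT `*` B)) (fun B => q (setT `*` B)) <=
    (\sum_v w v * (m v - n v) ^+ 2)%:E)%E.
  apply: ereal_inf_lbound; exists r.
    split=> A mA.
      rewrite rE [RHS]prE; last exact: measurableX.
      rewrite p5// -sumEFin; apply: eq_bigr => v _; rewrite EFinM; congr (_ * _)%E.
      apply: etrans (dE _ _ (measurableX mA measurableT)) _; congr ((nat_of_bool _)%:R%:E); apply/idP/idP.
        by rewrite !inE => -[].
      by rewrite !inE.
    rewrite rE [RHS]prE; last exact: measurableX.
    rewrite q5// -sumEFin; apply: eq_bigr => v _; rewrite EFinM; congr (_ * _)%E.
    apply: etrans (dE _ _ (measurableX measurableT mA)) _; congr ((nat_of_bool _)%:R%:E); apply/idP/idP.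
      by rewrite !inE => -[].
    by rewrite !inE.
  have mse : measurable_fun setT (fun z : R * R => ((z.1 - z.2) ^+ 2)%:E).
    by apply/measurable_EFinP; exact: squared_error_measurable.
  rewrite rint//; last by move=> z; rewrite lee_fin sqr_ge0.
  rewrite -sumEFin; apply: eq_bigr => v _; rewrite EFinM; congr (_ * _)%E.
  by rewrite integral_dirac// diracT mul1e.
apply: (@le_trans _ _ ((\sum_v w v * (s v - m v ^+ 2))%:E + (\sum_v w v * (t v - n v ^+ 2))%:E +
  (\sum_v w v * (m v - n v) ^+ 2)%:E)%E).
  by rewrite /e p4 q4 leeD2l.
rewrite -!EFinD lee_fin -!big_split/=; apply: ler_sum => v _.
by rewrite le_eqVlt; apply/orP; left; apply/eqP; ring.
Qed.

End MeanChannel.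

(** * Quantizing the real line *)

Section Cells.
Context {R : realType}.

Lemma fcell_measurable d (T : measurableType d) d' (S : measurableType d') (J : finType)
    (q : T -> J) (r : J -> S) : fcell q -> measurable_fun setT (fun x => r (q x)).
Proof.
move=> mq _ Y mY; rewrite setTI.
have -> : (fun x => r (q x)) @^-1` Y = [set x | (fun j => `[< Y (r j) >]) (q x)].
  by apply/seteqP; split=> x /=; [move=> h; exact/asboolP|move/asboolP].
exact: (fcell_pred (fun j => `[< Y (r j) >]) mq).
Qed.

Lemma cell_integral d (T : measurableType d) (I : finType) (Z : T -> I)
    (P : probability T R) (Q : I -> probability T R) (f : T -> \bar R) (g : I -> T -> \bar R) :
  fcell Z ->
  (forall i A, measurable A -> pr P (A `&` Z @^-1` [set i]) = pr1 P Z i * pr (Q i) A) ->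
  measurable_fun setT f -> (forall x, 0 <= f x)%E ->
  (forall i, measurable_fun setT (g i)) -> (forall i x, 0 <= g i x)%E ->
  (forall x, f x = g (Z x) x) ->
  (\int[P]_x f x = \sum_i (pr1 P Z i)%:E * \int[Q i]_x g i x)%E.
Proof.
move=> mZ hQ mf f0 mg g0 fg.
rewrite (integral_total_law mZ hQ mf f0); apply: eq_bigr => i _.
have cond h : measurable_fun setT h -> (forall x, 0 <= h x)%E ->
    ((pr1 P Z i)%:E * \int[Q i]_x h x = \int[P]_(x in Z @^-1` [set i]) h x)%E.
  move=> mh h0; apply: esym; apply: (conditional_integral (mZ i)) => // A mA.
  exact: hQ.
rewrite !cond//; apply: eq_integral => x; rewrite inE => /= e.
by rewrite fg e.
Qed.

Lemma integral_finite_valued d (T : measurableType d) (I : finType) (Z : T -> I)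
    (P : probability T R) (f : I -> R) : fcell Z -> (forall i, 0 <= f i) ->
  (\int[P]_x (f (Z x))%:E = (\sum_i pr1 P Z i * f i)%:E)%E.
Proof.
move=> mZ f0; have [Q [hQ _ _]] := cell_laws P mZ.
rewrite (@cell_integral _ _ _ Z P Q _ (fun i _ => (f i)%:E))//.
- by rewrite -sumEFin; apply: eq_bigr => i _; rewrite probability_integral_cst EFinM.
- exact: (fcell_measurable (fun i => (f i)%:E) mZ).
- by move=> x; rewrite lee_fin.
- by move=> i x; rewrite lee_fin.
Qed.

Lemma integral_le_comb3 d (T : measurableType d) (P : probability T R)
    (f g h k : T -> R) (a b c G H K : R) :
  measurable_fun setT f -> measurable_fun setT g -> measurable_fun setT h ->
  measurable_fun setT k ->
  (forall x, 0 <= f x) -> (forall x, 0 <= g x) -> (forall x, 0 <= h x) -> (forall x, 0 <= k x) ->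
  0 <= a -> 0 <= b -> 0 <= c -> (forall x, f x <= a * g x + b * h x + c * k x) ->
  (\int[P]_x (g x)%:E <= G%:E)%E -> (\int[P]_x (h x)%:E <= H%:E)%E ->
  (\int[P]_x (k x)%:E <= K%:E)%E ->
  (\int[P]_x (f x)%:E <= (a * G + b * H + c * K)%:E)%E.
Proof.
move=> mf mg mh mk f0 g0 h0 k0 a0 b0 c0 le hG hH hK.
have mE (u : T -> R) : measurable_fun setT u -> measurable_fun setT (fun x => (u x)%:E).
  by move=> mu; exact/measurable_EFinP.
have mZ (t : R) (u : T -> R) : measurable_fun setT u -> measurable_fun setT (fun x => (t%:E * (u x)%:E)%E).
  by move=> mu; apply: measurable_funeM; exact: mE.
have ge (t : R) (u : T -> R) x : 0 <= t -> (forall x, 0 <= u x) -> (0 <= t%:E * (u x)%:E)%E.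
  by move=> t0 u0; rewrite -EFinM lee_fin mulr_ge0.
apply: (@le_trans _ _ (\int[P]_x (a%:E * (g x)%:E + b%:E * (h x)%:E + c%:E * (k x)%:E))%E).
  apply: ge0_le_integral => //.
  - by move=> x _; rewrite lee_fin.
  - exact: mE.
  - by apply: emeasurable_funD; [apply: emeasurable_funD|]; exact: mZ.
  - by move=> x _; rewrite -!EFinM -!EFinD lee_fin.
rewrite ge0_integralD//; last 4 first.
- by move=> x _; rewrite adde_ge0 ?ge.
- by apply: emeasurable_funD; exact: mZ.
- by move=> x _; exact: ge.
- exact: mZ.
rewrite ge0_integralD//; last 4 first.
- by move=> x _; exact: ge.
- exact: mZ.
- by move=> x _; exact: ge.
- exact: mZ.
have int (t : R) (u : T -> R) (S : R) : 0 <= t -> measurable_fun setT u -> (forall x, 0 <= u x) ->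
    (\int[P]_x (u x)%:E <= S%:E)%E -> (\int[P]_x (t%:E * (u x)%:E) <= (t * S)%:E)%E.
  move=> t0 mu u0 hu; rewrite ge0_integralZl_EFin//; last 2 first.
  - by move=> x _; rewrite lee_fin.
  - exact: mE.
  by rewrite EFinM lee_wpmul2l.
by rewrite !EFinD !leeD//; exact: int.
Qed.

Lemma same_law_integral d (T : measurableType d) d1 (T1 : measurableType d1)
    d2 (T2 : measurableType d2) (P : probability T1 R) (Q : probability T2 R)
    (f : T1 -> T) (h : T2 -> T) :
  measurable_fun setT f -> measurable_fun setT h ->
  (forall A, measurable A -> P (f @^-1` A) = Q (h @^-1` A)) ->
  forall g : T -> \bar R, measurable_fun setT g -> (forall x, 0 <= g x)%E ->
  (\int[P]_x g (f x) = \int[Q]_x g (h x))%E.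
Proof.
move=> mf mh fh g mg g0.
have [P' [PE Pint]] := pushforward_probability P mf.
have [Q' [QE Qint]] := pushforward_probability Q mh.
rewrite -Pint// -Qint//; apply: eq_measure_integral => A mA _.
exact: etrans (PE A) (etrans (fh A mA) (esym (QE A))).
Qed.

(** Equal intervals on |x| < M, with left endpoints as representatives, and the value 0 elsewhere,
    where the error is the tail of the second moment. One quantizer serves both laws. *)
Lemma quantizer (mu nu : probability R R) (eta : R) :
  (\int[mu]_x (x ^+ 2)%:E < +oo)%E -> (\int[nu]_x (x ^+ 2)%:E < +oo)%E -> 0 < eta ->
  exists (J : finType) (q : R -> J) (r : J -> R), [/\ fcell q,
    (\int[mu]_x ((x - r (q x)) ^+ 2)%:E <= eta%:E)%E &
    (\int[nu]_x ((x - r (q x)) ^+ 2)%:E <= eta%:E)%E].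
Proof.
move=> h1 h2 eta0; have e2 : 0 < eta / 2 by rewrite divr_gt0.
have [M1 [M10 t1]] := tail_second_moment h1 e2.
have [M2 [M20 t2]] := tail_second_moment h2 e2.
pose M := M1 + M2; have M0 : 0 < M by rewrite addr_gt0.
pose A := [set x : R | (`|x| < M)%R].
have mA : measurable A by exact: norm_lt_measurable.
have msq : measurable_fun setT (fun x : R => (x ^+ 2)%:E).
  by apply/measurable_EFinP; exact: measurable_funX.
have tail (k : probability R R) (M' : R) : M' <= M ->
   (\int[k]_(x in ~` [set x : R | (`|x| < M')%R]) (x ^+ 2)%:E <= (eta / 2)%:E)%E ->
   (\int[k]_(x in ~` A) (x ^+ 2)%:E <= (eta / 2)%:E)%E.
  move=> M'M; apply: le_trans; apply: ge0_subset_integral => //.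
  - exact: measurableC.
  - by apply: measurableC; exact: norm_lt_measurable.
  - exact: measurable_funTS.
  - by move=> x _; rewrite lee_fin sqr_ge0.
  - by move=> x /= h h'; apply: h; rewrite /A/=; apply: lt_le_trans h' M'M.
(* Rescales |x| < M into [0, 1], so that [level] can be reused. *)
pose f (x : R) := (x + M) / (2 * M) * \1_A x.
have f01 x : 0 <= f x <= 1.
  rewrite /f indicE; have [xA|xA] := boolP (x \in A); last by rewrite mulr0 lexx ler01.
  move: xA; rewrite inE /A /= ltr_norml => /andP[l1 l2].
  rewrite mulr1 divr_ge0 ?ler_pdivrMr ?mulr_gt0//; [lra|lra|by rewrite ltW// mulr_gt0].
have mf : measurable_fun setT f.
  by apply: measurable_funM => //; apply: measurable_funM => //; exact: measurable_funD.
pose N := Num.truncn ((2 * M) ^+ 2 / (eta / 2)).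
have N0 : (0 : R) < N.+1%:R by [].
pose cc := 2 * M / N.+1%:R.
have cc2 : cc ^+ 2 <= eta / 2.
  rewrite /cc expr_div_n ler_pdivrMr ?exprn_gt0// [leRHS]mulrC -ler_pdivrMr//.
  have : 0 <= (2 * M) ^+ 2 / (eta / 2) by rewrite divr_ge0 ?sqr_ge0// ltW.
  move=> /truncn_itv /andP[_ lt]; apply: le_trans (ltW lt) _.
  by rewrite expr2 ler_peMr// ler1n.
pose J := (bool * 'I_N.+2)%type.
pose q (x : R) : J := (`[< A x >], level N (f x)).
pose r (j : J) : R := if j.1 then 2 * M * j.2%:R / N.+1%:R - M else 0.
exists J, q, r.
have mq : fcell q by apply: fcell_pair; [exact: fcell_asbool|exact: fcell_level].
have mr : measurable_fun setT (fun x : R => ((x - r (q x)) ^+ 2)%:E).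
  apply/measurable_EFinP; apply: measurable_funX; apply: measurable_funB => //.
  exact: (fcell_measurable r mq).
have inA x : A x -> (x - r (q x)) ^+ 2 <= cc ^+ 2.
  move=> Ax; rewrite /r /q /= (asboolT Ax).
  have /andP[] := levelP N (f01 x); set k := (level _ _)%:R.
  rewrite /f indicE mem_set// mulr1 => l1 l2.
  have e : N.+1%:R * ((x + M) / (2 * M)) = (x + M) / cc.
    by rewrite /cc; field; rewrite !gt_eqF.
  have c0 : 0 < cc by rewrite divr_gt0// mulr_gt0.
  rewrite e ler_pdivlMr// in l1; rewrite e ltr_pdivrMr// in l2.
  have -> : 2 * M * k / N.+1%:R = k * cc by rewrite /cc; ring.
  rewrite ler_pXn2r ?nnegrE//; [lra|lra|exact: ltW].
have outA x : (~` A) x -> (x - r (q x)) ^+ 2 = x ^+ 2.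
  by move=> Ax; rewrite /r /q /= (asboolF Ax) subr0.
have fin (k : probability R R) : (\int[k]_(x in ~` A) (x ^+ 2)%:E <= (eta / 2)%:E)%E ->
    (\int[k]_x ((x - r (q x)) ^+ 2)%:E <= eta%:E)%E.
  move=> tk.
  have -> : (\int[k]_x ((x - r (q x)) ^+ 2)%:E = \int[k]_(x in A) ((x - r (q x)) ^+ 2)%:E +
      \int[k]_(x in ~` A) ((x - r (q x)) ^+ 2)%:E)%E.
    rewrite -ge0_integral_setU//; first by rewrite setUv.
    - exact: measurableC.
    - by rewrite setUv.
    - by move=> x _; rewrite lee_fin sqr_ge0.
    - by apply/disj_set2P; rewrite setICr.
  rewrite (splitr eta) EFinD; apply: leeD.
    apply: (@le_trans _ _ (\int[k]_(x in A) (eta / 2)%:E)%E).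
      apply: ge0_le_integral => //.
      - by move=> x _; rewrite lee_fin sqr_ge0.
      - exact: measurable_funTS.
      - by move=> x Ax; rewrite lee_fin (le_trans (inA x Ax)).
    rewrite -[leRHS](probability_integral_cst k); apply: ge0_subset_integral => //.
    by move=> x _; rewrite lee_fin ltW.
  apply: le_trans tk; rewrite le_eqVlt; apply/orP; left; apply/eqP.
  by apply: eq_integral => x; rewrite inE => Ax; rewrite outA.
split => //; apply: fin.
  by apply: tail t1; rewrite /M lerDl ltW.
by apply: tail t2; rewrite /M lerDr ltW.
Qed.

End Cells.

Section Quantized.
Context {R : realType}.

(** The letter X is conditioned on the cell of Y. On a cell of positive weight E[X|Y] = Y gives X
    and Y the same mean, so by Jensen (m - r)^2 is at most the mean of (Y - r)^2 on the cell. The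
    information bound holds because the cell is a function of Y. *)
Lemma quantized_half (p : probability (R * R)%type R) (P : probability R R) (c : R)
    (J : finType) (q : R -> J) (r : J -> R) :
  (forall A, measurable A -> p (A `*` setT) = P A) -> cexp_id p ->
  (mutual_info p fst snd <= c%:E)%E ->
  (\int[p]_z (z.1 ^+ 2)%:E < +oo)%E -> (\int[p]_z (z.2 ^+ 2)%:E < +oo)%E -> fcell q ->
  exists (mu : J -> probability R R) (m s : J -> R),
   [/\ (forall A, measurable A -> pr P A = \sum_u pr1 p (fun z => q z.2) u * pr (mu u) A),
     (forall (I : finType) (al : R -> I), fcell al ->
        vinfo (pr1 p (fun z => q z.2)) mu al <= c),
     (forall u, (forall a, \int[mu u]_x ((x - a) ^+ 2)%:E = (s u - 2 * a * m u + a ^+ 2)%:E)%E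
        /\ m u ^+ 2 <= s u),
     (\int[p]_z ((z.1 - r (q z.2)) ^+ 2)%:E =
       (\sum_u pr1 p (fun z => q z.2) u * (s u - 2 * r u * m u + r u ^+ 2))%:E)%E &
     ((\sum_u pr1 p (fun z => q z.2) u * (m u - r u) ^+ 2)%:E <=
       \int[p]_z ((z.2 - r (q z.2)) ^+ 2)%:E)%E].
Proof.
move=> hP [iy ce] hI hx hy mq.
pose Z (z : R * R) := q z.2.
have mZ : fcell Z by exact: (fcell_precomp measurable_snd mq).
pose w := pr1 p Z; have [w0 w1] : fpmf w by exact: pr1_pmf.
have [k [hk kS kD]] := cell_laws p mZ.
have kfin (g : R * R -> \bar R) : measurable_fun setT g -> (forall z, 0 <= g z)%E ->
    (\int[p]_z g z < +oo)%E -> forall u, (\int[k u]_z g z < +oo)%E.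
  move=> mg g0 h u; have [cu cu0 hu] := kD u.
  by apply: le_lt_trans (hu g mg g0) _; apply: lte_mul_pinfty.
have msq (f : R * R -> R) : measurable_fun setT f -> measurable_fun setT (fun z => (f z ^+ 2)%:E).
  by move=> mf; apply/measurable_EFinP; exact: measurable_funX.
have sq0 (f : R * R -> R) z : (0 <= (f z ^+ 2)%:E)%E by rewrite lee_fin sqr_ge0.
have ex1 u : exists a : R * R, [/\ (k u).-integrable setT (fun z => z.1%:E),
    (\int[k u]_z z.1%:E = a.1%:E)%E,
    (forall t, (\int[k u]_z ((z.1 - t) ^+ 2)%:E = (a.2 - 2 * t * a.1 + t ^+ 2)%:E)%E) &
    a.1 ^+ 2 <= a.2].
  have h := kfin _ (msq _ measurable_fst) (sq0 fst) hx u.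
  by have [m [s h4]] := second_moment measurable_fst h; exists (m, s).
have ex2 u : exists a : R * R, [/\ (k u).-integrable setT (fun z => z.2%:E),
    (\int[k u]_z z.2%:E = a.1%:E)%E,
    (forall t, (\int[k u]_z ((z.2 - t) ^+ 2)%:E = (a.2 - 2 * t * a.1 + t ^+ 2)%:E)%E) &
    a.1 ^+ 2 <= a.2].
  have h := kfin _ (msq _ measurable_snd) (sq0 snd) hy u.
  by have [m [s h4]] := second_moment measurable_snd h; exists (m, s).
have [a1 h1] := choice ex1; have [a2 h2] := choice ex2.
have [mu hmu] := choice (fun u => pushforward_probability (k u) measurable_fst).
have muE u A : pr (mu u) A = pr (k u) (fst @^-1` A) by rewrite /pr; have [-> _] := hmu u.
have mfst A : measurable A -> measurable (fst @^-1` A : set (R * R)).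
  by move=> mA; rewrite -[X in measurable X]setTI; exact: measurable_fst.
have cond u : forall A, measurable A -> pr p (A `&` Z @^-1` [set u]) = w u * pr (k u) A.
  by move=> A mA; exact: hk.
(* Apply [cexp_id] to the event that Y lies in the cell. On a null cell the law k u is arbitrary and
   the two means may differ. *)
have mean u : w u != 0 -> (a1 u).1 = (a2 u).1.
  move=> wu; have wu0 : 0 < w u by rewrite lt0r wu w0.
  have mC : measurable (Z @^-1` [set u]) by exact: mZ.
  have CE : Z @^-1` [set u] = setT `*` (q @^-1` [set u]).
    by apply/seteqP; split=> [[x y]//|[x y] []].
  have tr (g : R * R -> \bar R) : measurable_fun setT g -> (forall z, 0 <= g z)%E ->
      (\int[p]_(z in Z @^-1` [set u]) g z =
       \sum_(i : unit) (w u)%:E * \int[k u]_z g (id z))%E.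
    move=> mg g0; rewrite (big_pred1 tt) => [|[]//].
    exact: (conditional_integral mC (cond u)).
  have [i1 e1 _ _] := h1 u; have [i2 e2 _ _] := h2 u.
  have [_ f1] := signed_transfer (mu := fun _ : unit => k u) (phi := fun _ => id)
    mC (fun _ => w0 u) measurable_fst tr (fun _ => i1).
  have [_ f2] := signed_transfer (mu := fun _ : unit => k u) (phi := fun _ => id)
    mC (fun _ => w0 u) measurable_snd tr (fun _ => i2).
  have := ce _ (mq u); rewrite -CE f1 f2 !(big_pred1 tt) => [|[]//|[]//].
  by rewrite e1 e2 -!EFinM => -[]; exact: mulfI wu _ _.
exists mu, (fun u => (a1 u).1), (fun u => (a1 u).2); split.
- move=> A mA.
  have -> : pr P A = pr p (fst @^-1` A) by rewrite /pr -hP// setXT.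
  by rewrite kS; [apply: eq_bigr => u _; rewrite muE|exact: mfst].
- move=> I al mal.
  have e u i : w u * pr1 (mu u) al i = pr2 p (fun z => al z.1) Z i u.
    by rewrite /pr1 muE -cond//; exact: mfst.
  have := le_trans (fmi_le_mutual_info p fst snd mal mq) hI; rewrite lee_fin.
  apply: le_trans; rewrite le_eqVlt; apply/orP; left; apply/eqP.
  rewrite /vinfo exchange_big/=; apply: eq_bigr => i _; apply: eq_bigr => u _.
  rewrite e; congr (kl_term _ (_ * _)).
  rewrite -(pr2_sumr p i (fcell_precomp measurable_fst mal) mZ).
  by apply: eq_bigr => u' _; exact: e.
- move=> u; have [_ _ h4 h5] := h1 u; split=> // a.
  rewrite -h4; have [_ ->//] := hmu u; first by apply/measurable_EFinP; apply: measurable_funX; exact: measurable_funB.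
  by move=> x; rewrite lee_fin sqr_ge0.
- rewrite (@cell_integral _ _ _ _ Z p k _ (fun u z => ((z.1 - r u) ^+ 2)%:E))//.
  + rewrite -sumEFin; apply: eq_bigr => u _.
    by have [_ _ -> _] := h1 u; rewrite EFinM.
  + apply: (msq (fun z => z.1 - r (q z.2))); apply: measurable_funB; first exact: measurable_fst.
    exact: (fcell_measurable r mZ).
  + by move=> z; rewrite lee_fin sqr_ge0.
  + by move=> u; apply: (msq (fun z => z.1 - r u)); apply: measurable_funB => //; exact: measurable_fst.
  + by move=> u z; rewrite lee_fin sqr_ge0.
rewrite (@cell_integral _ _ _ _ Z p k _ (fun u z => ((z.2 - r u) ^+ 2)%:E))//.
- rewrite -sumEFin; apply: lee_sum => u _.
  have [_ _ -> h5] := h2 u; rewrite EFinM.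
  have [wz|wu] := eqVneq (w u) 0; first by rewrite [pr1 _ _ _]wz !mul0e.
  rewrite lee_wpmul2l ?lee_fin ?pr_ge0//.
  rewrite (mean u wu) -subr_ge0.
  have -> : (a2 u).2 - 2 * r u * (a2 u).1 + r u ^+ 2 - ((a2 u).1 - r u) ^+ 2 =
     (a2 u).2 - (a2 u).1 ^+ 2 by ring.
  by rewrite subr_ge0.
- apply: (msq (fun z => z.2 - r (q z.2))); apply: measurable_funB; first exact: measurable_snd.
  exact: (fcell_measurable r mZ).
- by move=> z; rewrite lee_fin sqr_ge0.
- by move=> u; apply: (msq (fun z => z.2 - r u)); apply: measurable_funB => //; exact: measurable_snd.
- by move=> u z; rewrite lee_fin sqr_ge0.
Qed.

(** The letter depends on v only through j v, so the rest of v carries no further information about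
    it. Here v is a pair of cells and j a projection. *)
Lemma vinfo_refine (V J I : finType) (W : V -> R) (w : J -> R) (j : V -> J)
    (mu : J -> probability R R) (al : R -> I) : (forall v, 0 <= W v) ->
  (forall u, \sum_(v | j v == u) W v = w u) ->
  vinfo W (fun v => mu (j v)) al = vinfo w mu al.
Proof.
move=> W0 hw.
have agg (F : J -> R) : \sum_v W v * F (j v) = \sum_u w u * F u.
  rewrite (partition_big j predT)//=; apply: eq_bigr => u _.
  by rewrite -hw mulr_suml; apply: eq_bigr => v /eqP ->.
have kE x y i : 0 <= x ->
    kl_term (x * pr1 (mu y) al i) ((\sum_u w u * pr1 (mu u) al i) * x) =
    x * kl_term (pr1 (mu y) al i) (\sum_u w u * pr1 (mu u) al i).
  rewrite le0r => /orP[/eqP->|x0]; first by rewrite !mul0r /kl_term ltxx.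
  by rewrite [X in kl_term _ X]mulrC kl_termM.
pose F u := \sum_i kl_term (pr1 (mu u) al i) (\sum_u w u * pr1 (mu u) al i).
transitivity (\sum_v W v * F (j v)).
  apply: eq_bigr => v _; rewrite mulr_sumr; apply: eq_bigr => i _.
  by rewrite (agg (fun u => pr1 (mu u) al i)) kE.
rewrite agg; apply: eq_bigr => u _; rewrite mulr_sumr; apply: eq_bigr => i _.
by rewrite kE// -hw sumr_ge0.
Qed.

Lemma peter_paul (l b g : R) : 0 < l -> (b + g) ^+ 2 <= (1 + l) * b ^+ 2 + (1 + l^-1) * g ^+ 2.
Proof.
move=> l0; rewrite -subr_ge0.
have -> : (1 + l) * b ^+ 2 + (1 + l^-1) * g ^+ 2 - (b + g) ^+ 2 = (l * b - g) ^+ 2 / l.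
  by field; rewrite gt_eqF.
by rewrite divr_ge0 ?sqr_ge0// ltW.
Qed.

(** With a = m - r1, b = n - r2 and e = r1 - r2, the cross terms are 2 e (a - b) - 2 a b. The first
    is absorbed by l e^2 + (a - b)^2 / l, and the means being close to the representatives makes a
    and b small. *)
Lemma mean_error_bound (l s m t n r1 r2 : R) : 0 < l ->
  s - 2 * m * n + t <= (s - 2 * r1 * m + r1 ^+ 2) + (t - 2 * r2 * n + r2 ^+ 2)
    + (1 + l) * (r1 - r2) ^+ 2 + (2 / l + 1) * ((m - r1) ^+ 2 + (n - r2) ^+ 2).
Proof.
move=> l0; rewrite -subr_ge0.
set a := m - r1; set b := n - r2; set e := r1 - r2.
have -> : (s - 2 * r1 * m + r1 ^+ 2) + (t - 2 * r2 * n + r2 ^+ 2) + (1 + l) * e ^+ 2 +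
   (2 / l + 1) * (a ^+ 2 + b ^+ 2) - (s - 2 * m * n + t) =
   (l * e - (a - b)) ^+ 2 / l + (a + b) ^+ 2 / l + (a + b) ^+ 2.
  by rewrite /a /b /e; field; rewrite gt_eqF.
have h x : 0 <= x ^+ 2 / l by rewrite divr_ge0 ?sqr_ge0// ltW.
by rewrite addr_ge0 ?sqr_ge0// addr_ge0.
Qed.

End Quantized.

(** * From the right-hand side of (ii) to a finite test channel *)

Section QuantizedChannel.
Context {R : realType}.

Lemma coordinate_second_moment (p : probability (R * R)%type R) (P : probability R R) :
  (forall A, measurable A -> p (A `*` setT) = P A) ->
  (\int[P]_x (x ^+ 2)%:E < +oo)%E ->
  (\int[p]_z ((z.1 - z.2) ^+ 2)%:E < +oo)%E ->
  (\int[p]_z (z.1 ^+ 2)%:E < +oo)%E /\ (\int[p]_z (z.2 ^+ 2)%:E < +oo)%E.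
Proof.
move=> hP h1 hd.
have sq0 (x : R) : (0 <= (x ^+ 2)%:E)%E by rewrite lee_fin sqr_ge0.
have hx : (\int[p]_z (z.1 ^+ 2)%:E < +oo)%E.
  have msq : measurable_fun setT (fun x : R => (x ^+ 2)%:E).
    by apply/measurable_EFinP; exact: measurable_funX.
  have hA A : measurable A -> p (fst @^-1` A) = P (id @^-1` A).
    by move=> mA; rewrite -hP// setXT.
  by have -> := same_law_integral measurable_fst (@measurable_id _ R setT) hA msq sq0.
have fE (f : R * R -> R) : (\int[p]_z (f z ^+ 2)%:E < +oo)%E ->
    (\int[p]_z (f z ^+ 2)%:E <= (fine (\int[p]_z (f z ^+ 2)%:E)%E)%:E)%E.
  by move=> h; rewrite fineK// ge0_fin_numE//; apply: integral_ge0.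
split=> //; apply: (le_lt_trans _ (ltry (2 * fine (\int[p]_z (z.1 ^+ 2)%:E)%E +
  2 * fine (\int[p]_z ((z.1 - z.2) ^+ 2)%:E)%E + 0 * fine (\int[p]_z (z.1 ^+ 2)%:E)%E))).
have mf1 : measurable_fun setT (fun z : R * R => z.1 ^+ 2).
  by apply: measurable_funX; exact: measurable_fst.
apply: (integral_le_comb3 (f := fun z : R * R => z.2 ^+ 2) (g := fun z => z.1 ^+ 2)
  (h := fun z => (z.1 - z.2) ^+ 2) (k := fun z => z.1 ^+ 2)) => //.
- by apply: measurable_funX; exact: measurable_snd.
- exact: squared_error_measurable.
- by move=> z; exact: sqr_ge0.
- by move=> z; exact: sqr_ge0.
- by move=> z; exact: sqr_ge0.
- by move=> z; exact: sqr_ge0.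
- move=> z; rewrite mul0r addr0.
  have -> : z.2 = z.1 - (z.1 - z.2) by ring.
  rewrite {2}(_ : z.1 - (z.1 - z.2) = z.2); last by ring.
  exact: squared_error_le.
- exact: (fE fst).
- exact: (fE (fun z => z.1 - z.2)).
- exact: (fE fst).
Qed.

(** The index v is the pair of cells of (Y, Yh) under the coupling pi. Each of the three costs moves
    to the representatives at the price of a factor 1 + l and of multiples of eta; the factor in
    front of eta depends on l alone. *)
Lemma quantized_channel (pX pXh : probability R R) (Rt Rc : R)
    (p q pi : probability (R * R)%type R) (a b c l eta : R) :
  (\int[pX]_x (x ^+ 2)%:E < +oo)%E -> (\int[pXh]_x (x ^+ 2)%:E < +oo)%E ->
  (forall A, measurable A -> p (A `*` setT) = pX A) ->
  (forall A, measurable A -> q (A `*` setT) = pXh A) ->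
  cexp_id p -> cexp_id q ->
  (mutual_info p fst snd <= Rt%:E)%E -> (mutual_info q fst snd <= (Rt + Rc)%:E)%E ->
  (forall A, measurable A -> pi (A `*` setT) = p (setT `*` A)) ->
  (forall A, measurable A -> pi (setT `*` A) = q (setT `*` A)) ->
  (\int[p]_z ((z.1 - z.2) ^+ 2)%:E <= a%:E)%E -> (\int[q]_z ((z.1 - z.2) ^+ 2)%:E <= b%:E)%E ->
  (\int[pi]_z ((z.1 - z.2) ^+ 2)%:E <= c%:E)%E -> 0 < l -> 0 < eta ->
  fin_channel pX pXh (fun x y => (x - y) ^+ 2) Rt Rc
    ((1 + l) ^+ 2 * (a + b + c) +
     (2 * (1 + l^-1) + 4 * ((1 + l) * (1 + l^-1)) + 2 * (2 / l + 1)) * eta)%:E.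
Proof.
move=> hX hXh p1 q1 cp cq Ip Iq pi1 pi2 ha hb hc l0 eta0.
have [px py] := coordinate_second_moment p1 hX (le_lt_trans ha (ltry _)).
have [qx qy] := coordinate_second_moment q1 hXh (le_lt_trans hb (ltry _)).
have [Y [YE Yint]] := pushforward_probability p measurable_snd.
have [Yh [YhE Yhint]] := pushforward_probability q measurable_snd.
have msqr : measurable_fun setT (fun x : R => (x ^+ 2)%:E).
  by apply/measurable_EFinP; exact: measurable_funX.
have sq0 (x : R) : (0 <= (x ^+ 2)%:E)%E by rewrite lee_fin sqr_ge0.
have Y2 : (\int[Y]_x (x ^+ 2)%:E < +oo)%E by rewrite Yint.
have Yh2 : (\int[Yh]_x (x ^+ 2)%:E < +oo)%E by rewrite Yhint.
have [J [g [r [mg etaY etaYh]]]] := quantizer Y2 Yh2 eta0.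
pose e (x : R) := x - r (g x).
have me : measurable_fun setT e by apply: measurable_funB => //; exact: (fcell_measurable r mg).
have meE : measurable_fun setT (fun x => (e x ^+ 2)%:E) by apply/measurable_EFinP; exact: measurable_funX.
have ep : (\int[p]_z (e z.2 ^+ 2)%:E <= eta%:E)%E.
  by rewrite -(Yint (fun x => (e x ^+ 2)%:E)).
have eq : (\int[q]_z (e z.2 ^+ 2)%:E <= eta%:E)%E.
  by rewrite -(Yhint (fun x => (e x ^+ 2)%:E)).
have piY A : measurable A -> pi (fst @^-1` A) = p (snd @^-1` A).
  by move=> mA; rewrite -setXT pi1// setTX.
have piYh A : measurable A -> pi (snd @^-1` A) = q (snd @^-1` A).
  by move=> mA; rewrite -setTX pi2// setTX.
have epi1 : (\int[pi]_z (e z.1 ^+ 2)%:E <= eta%:E)%E.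
  by rewrite (same_law_integral measurable_fst measurable_snd piY (g := fun x => (e x ^+ 2)%:E)).
have epi2 : (\int[pi]_z (e z.2 ^+ 2)%:E <= eta%:E)%E.
  by rewrite (same_law_integral measurable_snd measurable_snd piYh (g := fun x => (e x ^+ 2)%:E)).
have [mu [m [s [muS muI muM muX muY]]]] := quantized_half r p1 cp Ip px py mg.
have [nu [n [t [nuS nuI nuM nuX nuY]]]] := quantized_half r q1 cq Iq qx qy mg.
set wp := pr1 p _ in muS muI muX muY; set wq := pr1 q _ in nuS nuI nuX nuY.
pose Z (z : R * R) := (g z.1, g z.2).
have mg1 : fcell (fun z : R * R => g z.1) by exact: (fcell_precomp measurable_fst mg).
have mg2 : fcell (fun z : R * R => g z.2) by exact: (fcell_precomp measurable_snd mg).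
have mZ : fcell Z by exact: fcell_pair.
pose W := pr1 pi Z; have [W0 W1] : fpmf W by exact: pr1_pmf.
have Wp u : \sum_(v | fst v == u) W v = wp u.
  rewrite -(pr1_coarsen pi fst u mZ); exact: congr1 (piY _ (mg u)).
have Wq u : \sum_(v | snd v == u) W v = wq u.
  rewrite -(pr1_coarsen pi snd u mZ); exact: congr1 (piYh _ (mg u)).
have aggp (F : J -> R) : \sum_v W v * F v.1 = \sum_u wp u * F u.
  rewrite (partition_big fst predT)//=; apply: eq_bigr => u _.
  by rewrite -Wp mulr_suml; apply: eq_bigr => v /eqP ->.
have aggq (F : J -> R) : \sum_v W v * F v.2 = \sum_u wq u * F u.
  rewrite (partition_big snd predT)//=; apply: eq_bigr => u _.
  by rewrite -Wq mulr_suml; apply: eq_bigr => v /eqP ->.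
exists (J * J)%type, W, (fun v => mu v.1), (fun v => nu v.2); split=> //; split.
- by move=> A mA; rewrite muS// -aggp.
- by move=> A mA; rewrite nuS// -aggq.
- by move=> I al mal; rewrite (@vinfo_refine _ _ J _ W wp)//; exact: muI.
- by move=> I al mal; rewrite (@vinfo_refine _ _ J _ W wq)//; exact: nuI.
have li : 0 < l^-1 by rewrite invr_gt0.
pose L := 1 + l^-1; have L0 : 0 <= L by rewrite /L addr_ge0// ltW.
have msub (f h : R * R -> R) : measurable_fun setT f -> measurable_fun setT h ->
    measurable_fun setT (fun z => (f z - h z) ^+ 2).
  by move=> mf mh; apply: measurable_funX; exact: measurable_funB.
have mz1 : measurable_fun setT (fun z : R * R => e z.1) by exact: (measurableT_comp me measurable_fst).
have mz2 : measurable_fun setT (fun z : R * R => e z.2) by exact: (measurableT_comp me measurable_snd).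
have mr1 : measurable_fun setT (fun z : R * R => r (g z.1)) by exact: (fcell_measurable r mg1).
have mr2 : measurable_fun setT (fun z : R * R => r (g z.2)) by exact: (fcell_measurable r mg2).
have one (k : probability (R * R)%type R) (a' : R) :
    (\int[k]_z ((z.1 - z.2) ^+ 2)%:E <= a'%:E)%E -> (\int[k]_z (e z.2 ^+ 2)%:E <= eta%:E)%E ->
    (\int[k]_z ((z.1 - r (g z.2)) ^+ 2)%:E <= ((1 + l) * a' + L * eta + 0 * eta)%:E)%E.
  move=> ha' he; apply: (integral_le_comb3 (f := fun z : R * R => (z.1 - r (g z.2)) ^+ 2)
    (g := fun z => (z.1 - z.2) ^+ 2) (h := fun z => e z.2 ^+ 2) (k := fun z => e z.2 ^+ 2)) => //.
  - by apply: msub => //; exact: measurable_fst.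
  - exact: squared_error_measurable.
  - exact: measurable_funX.
  - exact: measurable_funX.
  - by move=> z; exact: sqr_ge0.
  - by move=> z; exact: sqr_ge0.
  - by move=> z; exact: sqr_ge0.
  - by move=> z; exact: sqr_ge0.
  - by rewrite addr_ge0// ltW.
  - move=> z; rewrite mul0r addr0.
    have -> : z.1 - r (g z.2) = (z.1 - z.2) + e z.2 by rewrite /e; ring.
    exact: peter_paul.
have eP := one p a ha ep; rewrite muX lee_fin in eP.
have eQ := one q b hb eq; rewrite nuX lee_fin in eQ.
have fP : \sum_u wp u * (m u - r u) ^+ 2 <= eta by rewrite -lee_fin; exact: le_trans muY ep.
have fQ : \sum_u wq u * (n u - r u) ^+ 2 <= eta by rewrite -lee_fin; exact: le_trans nuY eq.
have ePi : \sum_v W v * (r v.1 - r v.2) ^+ 2 <= (1 + l) * c + 2 * L * eta + 2 * L * eta.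
  rewrite -lee_fin -(@integral_finite_valued _ _ _ _ Z pi (fun v => (r v.1 - r v.2) ^+ 2))//=; last first.
    by move=> v; exact: sqr_ge0.
  apply: (integral_le_comb3 (f := fun z : R * R => (r (g z.1) - r (g z.2)) ^+ 2)
    (g := fun z => (z.1 - z.2) ^+ 2) (h := fun z => e z.1 ^+ 2) (k := fun z => e z.2 ^+ 2)) => //.
  - exact: msub.
  - exact: squared_error_measurable.
  - exact: measurable_funX.
  - exact: measurable_funX.
  - by move=> z; exact: sqr_ge0.
  - by move=> z; exact: sqr_ge0.
  - by move=> z; exact: sqr_ge0.
  - by move=> z; exact: sqr_ge0.
  - by rewrite addr_ge0// ltW.
  - by rewrite mulr_ge0.
  - by rewrite mulr_ge0.
  - move=> z; have -> : r (g z.1) - r (g z.2) = (z.1 - z.2) + (e z.2 - e z.1) by rewrite /e; ring.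
    apply: le_trans (peter_paul _ _ l0) _; rewrite -[leRHS]addrA lerD2l -/L.
    have -> : 2 * L * e z.1 ^+ 2 + 2 * L * e z.2 ^+ 2 = L * (2 * e z.2 ^+ 2 + 2 * e z.1 ^+ 2) by ring.
    by rewrite ler_wpM2l// squared_error_le.
have cost : (\sum_v (W v)%:E * \int[mu v.1]_x \int[nu v.2]_y ((x - y) ^+ 2)%:E =
    (\sum_v W v * (s v.1 - 2 * m v.1 * n v.2 + t v.2))%:E)%E.
  rewrite -sumEFin; apply: eq_bigr => v _; rewrite EFinM.
  have [h1 h2] := muM v.1; have [h3 h4] := nuM v.2.
  by rewrite (product_squared_error h1 h3).
rewrite cost lee_fin.
apply: (@le_trans _ _ (\sum_v W v * ((s v.1 - 2 * r v.1 * m v.1 + r v.1 ^+ 2) +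
  (t v.2 - 2 * r v.2 * n v.2 + r v.2 ^+ 2) + (1 + l) * (r v.1 - r v.2) ^+ 2 +
  (2 / l + 1) * ((m v.1 - r v.1) ^+ 2 + (n v.2 - r v.2) ^+ 2)))).
  by apply: ler_sum => v _; rewrite ler_wpM2l//; exact: mean_error_bound.
pose k := 2 / l + 1; have k0 : 0 <= k by rewrite /k addr_ge0// divr_ge0// ltW.
rewrite -/k.
have -> : \sum_v W v * ((s v.1 - 2 * r v.1 * m v.1 + r v.1 ^+ 2) +
  (t v.2 - 2 * r v.2 * n v.2 + r v.2 ^+ 2) + (1 + l) * (r v.1 - r v.2) ^+ 2 +
  k * ((m v.1 - r v.1) ^+ 2 + (n v.2 - r v.2) ^+ 2)) =
  (\sum_v W v * (s v.1 - 2 * r v.1 * m v.1 + r v.1 ^+ 2)) +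
  (\sum_v W v * (t v.2 - 2 * r v.2 * n v.2 + r v.2 ^+ 2)) +
  (1 + l) * (\sum_v W v * (r v.1 - r v.2) ^+ 2) +
  k * ((\sum_v W v * (m v.1 - r v.1) ^+ 2) + (\sum_v W v * (n v.2 - r v.2) ^+ 2)).
  rewrite -!big_split/= !mulr_sumr -!big_split/=; apply: eq_bigr => v _; ring.
rewrite (aggp (fun u => s u - 2 * r u * m u + r u ^+ 2)) (aggp (fun u => (m u - r u) ^+ 2)).
rewrite (aggq (fun u => t u - 2 * r u * n u + r u ^+ 2)) (aggq (fun u => (n u - r u) ^+ 2)).
have l1 : 0 <= 1 + l by rewrite addr_ge0// ltW.
have hfg := ler_wpM2l k0 (lerD fP fQ).
have hpi := ler_wpM2l l1 ePi.
(* The coupling cost c picks up 1 + l twice, a and b only once; the slack l (1 + l) (a + b) rounds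
   this to a common square. *)
apply: (le_trans (lerD (lerD (lerD eP eQ) hpi) hfg)).
have ab0 : 0 <= a + b.
  rewrite addr_ge0// -lee_fin; [apply: le_trans ha|apply: le_trans hb];
    by apply: integral_ge0 => z _; rewrite lee_fin sqr_ge0.
rewrite -subr_ge0 -/L.
set lhs := (X in 0 <= X); have -> : lhs = (l * (1 + l)) * (a + b) by rewrite /lhs; ring.
by rewrite mulr_ge0// mulr_ge0// ltW.
Qed.

Lemma rhs_i_le_rhs_ii (pX pXh : probability R R) (Rt Rc : R) :
  (\int[pX]_x (x ^+ 2)%:E < +oo)%E -> (\int[pXh]_x (x ^+ 2)%:E < +oo)%E ->
  (rhs_i pX pXh (fun x y => ((x - y) ^+ 2)%R) Rt Rc <= rhs_ii pX pXh Rt Rc)%E.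
Proof.
move=> hX hXh; apply: le_ereal_inf_tmp => e0 [p [q [p1 [q1 [cp [cq [Ip [Iq ->]]]]]]]].
set A := (\int[p]_z _)%E; set B := (\int[q]_z _)%E; set W := W2sq _ _.
have sq0 (k : probability (R * R)%type R) : (0 <= \int[k]_z ((z.1 - z.2) ^+ 2)%:E)%E.
  by apply: integral_ge0 => z _; rewrite lee_fin sqr_ge0.
have A0 : (0 <= A)%E by exact: sq0.
have B0 : (0 <= B)%E by exact: sq0.
have W0 : (0 <= W)%E by apply: le_ereal_inf_tmp => _ [k _ <-]; exact: sq0.
have [->|fin] := eqVneq (A + B + W)%E +oo%E; first by rewrite leey.
have ABW : (A + B + W \is a fin_num)%E.
  by rewrite ge0_fin_numE; [rewrite ltey|do 2 apply: adde_ge0 => //].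
have /andP[ABf Wf] : (A + B \is a fin_num)%E && (W \is a fin_num) by rewrite -fin_numD.
have /andP[Af Bf] : (A \is a fin_num) && (B \is a fin_num) by rewrite -fin_numD.
apply/lee_addgt0Pr => eps eps0.
have e3 : 0 < eps / 3 by rewrite divr_gt0.
have [_ [pi [pi1 pi2] <-] hpi] := lb_ereal_inf_adherent e3 Wf.
pose S := fine A + fine B + (fine W + eps / 3).
have S0 : 0 <= S by rewrite /S !addr_ge0 ?fine_ge0// ltW.
(* Chosen with l <= 1 and 3 l S <= eps / 3, so that (1 + l)^2 S <= S + eps / 3. The factor K depends
   on l, so eta = eps / (3 K) is fixed afterwards; the last third pays for a nearly optimal
   coupling. *)
pose l := eps / (9 * (S + 1) + 3 * eps).
have den : 0 < 9 * (S + 1) + 3 * eps by rewrite addr_gt0// mulr_gt0// ltr_wpDl.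
have l0 : 0 < l by rewrite divr_gt0.
have l1 : l <= 1 by rewrite ler_pdivrMr// mul1r; lra.
have lS : 3 * l * S <= eps / 3.
  rewrite /l -mulrA [X in 3 * X]mulrAC mulrA ler_pdivrMr//.
  rewrite -subr_ge0; have -> : eps / 3 * (9 * (S + 1) + 3 * eps) - 3 * (eps * S) = 3 * eps + eps ^+ 2 by field.
  by rewrite addr_ge0 ?sqr_ge0// mulr_ge0// ltW.
pose K := 2 * (1 + l^-1) + 4 * ((1 + l) * (1 + l^-1)) + 2 * (2 / l + 1).
have li : 0 < l^-1 by rewrite invr_gt0.
have l01 : 0 < 1 + l by rewrite addr_gt0.
have li1 : 0 < 1 + l^-1 by rewrite addr_gt0.
have l2' : 0 < 2 / l + 1 by rewrite addr_gt0// divr_gt0.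
have K0 : 0 < K.
  by rewrite /K; apply: addr_gt0; [apply: addr_gt0|]; rewrite !mulr_gt0.
have eta0 : 0 < eps / 3 / K by rewrite divr_gt0.
have hA : (A <= (fine A)%:E)%E by rewrite fineK.
have hB : (B <= (fine B)%:E)%E by rewrite fineK.
have hW : (\int[pi]_z ((z.1 - z.2) ^+ 2)%:E <= (fine W + eps / 3)%:E)%E.
  by rewrite EFinD fineK// ltW.
have ch := quantized_channel hX hXh p1 q1 cp cq Ip Iq pi1 pi2 hA hB hW l0 eta0.
have D0 (x y : R) : 0 <= (x - y) ^+ 2 by exact: sqr_ge0.
apply: le_trans (fin_channel_rhs_i squared_error_measurable D0 ch) _.
have -> : (A + B + W + eps%:E = (fine A + fine B + fine W + eps)%:E)%E by rewrite !EFinD !fineK.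
rewrite lee_fin -/S -/K mulrC [X in _ + X]mulrC divfK ?gt_eqF//.
have : l ^+ 2 <= l by rewrite expr2 ler_piMl// ltW.
move=> l2; have : (l ^+ 2 + 2 * l) * S <= 3 * l * S.
  by rewrite ler_wpM2r//; lra.
have -> : S * (1 + l) ^+ 2 = S + (l ^+ 2 + 2 * l) * S by ring.
rewrite /S in lS *; lra.
Qed.

End QuantizedChannel.

(** For (ii) the circle is Dopt <= rhs_i <= rhs_ii <= Dopt, the first step being (i) for squared
    error. In [rhs_ii] the bound Rt + Rc is imposed on I(Xh; Yh), where the English statement writes
    I(Y; Yh). *)
Theorem theorem1 (R : realType) (Rt Rc : R) (hRt : 0 <= Rt) (hRc : 0 <= Rc) :
  (forall (d : measure_display) (T : measurableType d) (pX pXh : probability T R)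
      (Delta : T -> T -> R),
     measurable_fun setT (fun z : T * T => Delta z.1 z.2) ->
     (forall x y, 0 <= Delta x y) ->
     unif_integrable pX pXh Delta ->
     Dopt pX pXh Delta Rt Rc = rhs_i pX pXh Delta Rt Rc) /\
  (forall pX pXh : probability R R,
     (\int[pX]_x (x ^+ 2)%:E < +oo)%E ->
     (\int[pXh]_x (x ^+ 2)%:E < +oo)%E ->
     Dopt pX pXh (fun x y => (x - y) ^+ 2) Rt Rc = rhs_ii pX pXh Rt Rc).
Proof.
split=> [d T pX pXh Delta mD D0 ui|pX pXh hX hXh]; apply/eqP; rewrite eq_le; apply/andP; split.
- exact: Dopt_le_rhs_i.
- apply: le_ereal_inf_tmp => _ [D /= ach <-].
  exact: fin_channel_rhs_i mD D0 (converse mD D0 ach).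
- apply: le_trans (rhs_i_le_rhs_ii Rt Rc hX hXh).
  apply: Dopt_le_rhs_i => //; first exact: squared_error_measurable.
  - by move=> x y; exact: sqr_ge0.
  - exact: squared_error_unif_integrable.
- apply: le_ereal_inf_tmp => _ [D /= ach <-].
  apply: fin_channel_rhs_ii => //; apply: converse ach; first exact: squared_error_measurable.
  by move=> x y; exact: sqr_ge0.
Qed.
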